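(* Let $n\geq 4$. Then the Euclidean unit sphere $S^{n-1}=\{x\in\mathbb{R}^n : |x|=1\}$ is not a set of reduced spectral synthesis for the locally compact group $\mathbb{R}^n$.
   Context: For a locally compact group $G$ with left Haar measure, let $\lambda$ be the left regular representation on $L^2(G)$, $(\lambda_t\xi)(s)=\xi(t^{-1}s)$, and for $f\in L^1(G)$ let $\lambda(f)g=f*g$, $g\in L^2(G)$. The reduced group C*-algebra $C^*_r(G)$ is the norm closure of $\{\lambda(f):f\in L^1(G)\}$ in $\mathcal{B}(L^2(G))$, and the group von Neumann algebra $\mathrm{VN}(G)$ is its weak* closure. The Fourier algebra $A(G)$ consists of the functions $u(x)=(\lambda_x\xi,\eta)$, $\xi,\eta\in L^2(G)$; its Banach space dual is identified with $\mathrm{VN}(G)$ via $\langle u,T\rangle=(T\xi,\eta)$. For a closed set $E\subseteq G$ let $I(E)=\{u\in A(G): u(s)=0 \text{ for all } s\in E\}$ and let $J(E)$ be the closure in $A(G)$ of $\{u\in A(G): u \text{ has compact support disjoint from } E\}$. Annihilators $I(E)^\perp, J(E)^\perp$ are taken in $\mathrm{VN}(G)$. The closed set $E$ is a set of reduced spectral synthesis (for $G$) if $C^*_r(G)\cap I(E)^\perp=C^*_r(G)\cap J(E)^\perp$. *)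

(* Defs.v *)
From mathcomp Require Import all_boot all_order all_algebra.
From mathcomp Require Import complex.
From mathcomp Require Import all_classical all_reals all_analysis.
Set Implicit Arguments.
Unset Strict Implicit.
Unset Printing Implicit Defensive.
Import Order.TTheory GRing.Theory Num.Theory.
Import numFieldNormedType.Exports.
Local Open Scope classical_set_scope.
Local Open Scope ring_scope.

(* R^n with its Borel sigma-algebra.  The topology of 'rV[R]_n is the product
   topology. *)
Notation borel_rV R n := (g_sigma_algebraType (@open 'rV[R]_n)).

(* The library's norm `|x| on 'rV[R]_n is the sup norm, hence this definition. *)
Definition euclidean_norm (R : realType) (n : nat) (x : 'rV[R]_n) : R :=
  Num.sqrt (\sum_(i < n) x 0 i ^+ 2).

Definition unit_sphere (R : realType) (n : nat) : set 'rV[R]_n :=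
  [set x | euclidean_norm x = 1].

Section ReducedSynthesis.
Variables (R : realType) (n : nat).
Local Notation C := R[i].
Local Notation G := 'rV[R]_n.
Variable mu : {measure set (borel_rV R n) -> \bar R}.
Implicit Types (f g xi eta u v : G -> C) (S T : (G -> C) -> G -> C).

Definition haar_measure : Prop :=
  [/\ (exists2 A : set G, measurable (A : set (borel_rV R n)) & mu A != 0%E),
      (forall (x : G) (A : set G), measurable (A : set (borel_rV R n)) ->
         mu ((fun y => x + y) @` A) = mu A),
      (forall K : set G, compact K -> (mu K < +oo)%E),
      (forall A : set G, measurable (A : set (borel_rV R n)) ->
         mu A = ereal_inf (mu @` [set U | open U /\ A `<=` U]))
    & (forall U : set G, open U ->
         mu U = ereal_sup (mu @` [set K | compact K /\ K `<=` U]))].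

(* Elements of L^p are handled through representatives: L^p is the predicate Lp
   on functions, and operators on L^2 are functions on representatives that
   are linear almost everywhere.  Closures and annihilators below are
   stable under almost everywhere equality of the values on L^2, so that
   equality of such sets is equality of the sets of classes. *)
Definition Cmeasurable f : Prop :=
  measurable_fun [set: borel_rV R n] (fun x : borel_rV R n => complex.Re (f x)) /\
  measurable_fun [set: borel_rV R n] (fun x : borel_rV R n => complex.Im (f x)).

Definition CLnorm (p : \bar R) f : \bar R :=
  ('N[mu]_p[(fun x : borel_rV R n => (complex.Re `|f x|)%:E)])%E.

Definition Lp (p : \bar R) : set (G -> C) :=
  [set f | Cmeasurable f /\ (CLnorm p f < +oo)%E].

Local Notation L1 := (Lp 1%:E).
Local Notation L2 := (Lp 2%:E).
Local Notation norm2 := (CLnorm 2%:E).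

Definition Cintegral f : C :=
  Complex (\int[mu]_(x in [set: borel_rV R n]) complex.Re (f x))
          (\int[mu]_(x in [set: borel_rV R n]) complex.Im (f x)).

Definition inner xi eta : C := Cintegral (fun x => xi x * (eta x)^*).

Definition left_regular (t : G) xi : G -> C := fun s => xi (- t + s).

Definition convolution f g : G -> C :=
  fun s => Cintegral (fun t => f t * g (- t + s)).

Definition bounded_operator T : Prop :=
  [/\ (forall xi, L2 xi -> L2 (T xi)),
      (forall (a : C) xi eta, L2 xi -> L2 eta ->
         {ae mu, forall x : borel_rV R n,
            T (fun y => a * xi y + eta y) x = a * T xi x + T eta x})
    & (exists M : R, forall xi, L2 xi -> (norm2 (T xi) <= M%:E * norm2 xi)%E)].

Definition norm_closure (A : set ((G -> C) -> G -> C)) :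
    set ((G -> C) -> G -> C) :=
  [set T | bounded_operator T /\
     forall e : R, 0 < e -> exists2 S, A S &
       forall xi, L2 xi ->
         (norm2 (fun x => T xi x - S xi x)%R <= e%:E * norm2 xi)%E].

Definition square_summable (xi : nat -> G -> C) : Prop :=
  (forall k, L2 (xi k)) /\ (\sum_(0 <= k <oo) norm2 (xi k) ^+ 2 < +oo)%E.

(* The weak* continuous functionals T |-> sum_k (T xi_k, eta_k) on B(L^2). *)
Definition weakstar_functional (xi eta : nat -> G -> C) T : C :=
  Complex (limn (series (fun k => complex.Re (inner (T (xi k)) (eta k)))))
          (limn (series (fun k => complex.Im (inner (T (xi k)) (eta k))))).

Definition weakstar_closure (A : set ((G -> C) -> G -> C)) :
    set ((G -> C) -> G -> C) :=
  [set T | bounded_operator T /\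
     forall (m : nat) (xi eta : 'I_m -> nat -> G -> C),
       (forall j, square_summable (xi j) /\ square_summable (eta j)) ->
       forall e : R, 0 < e -> exists2 S, A S &
         forall j, complex.Re `|weakstar_functional (xi j) (eta j) T
                                - weakstar_functional (xi j) (eta j) S| < e].

Definition reduced_group_Cstar_algebra : set ((G -> C) -> G -> C) :=
  norm_closure (convolution @` L1).

Definition group_von_Neumann_algebra : set ((G -> C) -> G -> C) :=
  weakstar_closure reduced_group_Cstar_algebra.

Definition coefficient xi eta : G -> C :=
  fun x => inner (left_regular x xi) eta.

Definition Fourier_algebra : set (G -> C) :=
  [set u | exists xi eta, [/\ L2 xi, L2 eta & u = coefficient xi eta]].

(* Eymard's norm, i.e. the norm of A(G) as the predual of VN(G); it is +oo
   outside A(G). *)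
Definition Fourier_norm u : \bar R :=
  ereal_inf [set z | exists xi eta,
    [/\ L2 xi, L2 eta, u = coefficient xi eta & z = (norm2 xi * norm2 eta)%E]].

Definition ideal_I (E : set G) : set (G -> C) :=
  [set u | Fourier_algebra u /\ forall s, E s -> u s = 0].

Definition closed_support u : set G := closure [set x | u x != 0].

Definition ideal_J (E : set G) : set (G -> C) :=
  [set u | Fourier_algebra u /\
     forall e : R, 0 < e -> exists v,
       [/\ Fourier_algebra v, compact (closed_support v),
           closed_support v `&` E = set0
         & (Fourier_norm (fun x => u x - v x)%R < e%:E)%E]].

(* The pairing <u, T> = (T xi, eta), for u = coefficient xi eta, does not depend
   on the choice of xi and eta when T is in VN(G). *)
Definition annihilator (X : set (G -> C)) : set ((G -> C) -> G -> C) :=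
  [set T | group_von_Neumann_algebra T /\
     forall xi eta, L2 xi -> L2 eta -> X (coefficient xi eta) ->
       inner (T xi) eta = 0].

Definition reduced_spectral_synthesis (E : set G) : Prop :=
  reduced_group_Cstar_algebra `&` annihilator (ideal_I E) =
  reduced_group_Cstar_algebra `&` annihilator (ideal_J E).

End ReducedSynthesis.

(* Main.v *)
(* Regularise the derivative delta'(|y|^2 - 1), multiplied by a smooth weight on a
   small cap of the sphere, at the scales e_k ~ 2^-k; call the result f_k.  If the
   operators lambda(f_k) converge in norm, the limit T lies in the reduced
   C*-algebra, and it annihilates J(S) because the supports of the f_k shrink to
   the sphere S.  It does not annihilate I(S): some coefficient u of the regular
   representation equals A (|y|^2 - 1) with A > 0 for |y| <= 2, so u vanishes
   on S, but <u, T> is a limit of integrals of f_k u bounded away from 0.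

   Convergence in norm is obtained without the Fourier transform.  By the
   C*-identity, |lambda(g)|^2 is at most the L^1 norm of the autocorrelation K of g,
   and for g = f_(k+1) - f_k one has |K(x)| = O(e_k^-3) and, for |x| > 6 e_k,
   |K(x)| = O(e_k |x|^-4).  In dimension at least 4 the L^1 norm of K is then
   O(k 2^-k).  The second bound comes from four integrations by parts along a
   rotation field of the (y_o, y_j) plane, where |x_j| is maximal: the field
   annihilates |y|^2 and its action on |x + y|^2 is of size |x_j|, so each step
   replaces the profile of |x + y|^2 - 1 by an antiderivative, which gains a
   factor e_k / |x_j|. *)
From HB Require Import structures.
Require Import Defs.
From mathcomp Require Import all_boot all_order all_algebra.
From mathcomp Require Import complex.
From mathcomp Require Import all_classical all_reals all_analysis.
From mathcomp Require Import measurable_realfun.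
From mathcomp Require Import ring lra.
From mathcomp Require Import zify.
Set Implicit Arguments.
Unset Strict Implicit.
Unset Printing Implicit Defensive.
Import Order.TTheory GRing.Theory Num.Theory.
Import numFieldNormedType.Exports.
Local Open Scope classical_set_scope.
Local Open Scope ring_scope.

(** * Haar measure on R^n *)

(** The L^1 norms of the f_k and of their differences grow like 1/e_k, so Young's inequality applied
    to them directly gives nothing; hence the detour through K. The weight is built from (y_o -
    c)_+^5, so that four integrations by parts consume four powers and still leave a continuous
    integrand. The profiles are splines whose antiderivatives up to the fourth agree at both scales
    outside |s| < 3 e, so those of a difference of scales keep compact support. On the cap y_o is
    close to 1 and the other coordinates are tiny, which bounds the rotation coefficient y_o - (x_o
    / x_j) y_j from below; and where K(x) != 0, the condition |x| > 6 e_k forces the largest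
    coordinate of x to be some x_j with j != o. Dimension 4 is the borderline: the decay |x|^-4
    against the volume r^4 gives every dyadic annulus the same mass, hence the factor k. Haar
    measure is used through its axioms only: volumes are bounded by packing disjoint translates, and
    derivatives integrate to 0 as limits of difference quotients. *)

Section BorelRow.
Context {R : realType} {n : nat}.
Local Notation G := 'rV[R]_n.+1.
Local Notation B := (borel_rV R n.+1).

Lemma open_measurable_rV (U : set G) : open U -> measurable (U : set B).
Proof. by move=> oU; apply: sub_sigma_algebra. Qed.

Lemma closed_measurable_rV (A : set G) : closed A -> measurable (A : set B).
Proof.
move=> cA; rewrite -(setCK A); apply: measurableC.
by apply: open_measurable_rV; apply: closed_openC.
Qed.

Lemma continuous_measurable_rV (g : G -> R) :
  continuous g -> measurable_fun [set: B] (g : B -> R).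
Proof.
move=> cg; apply: (measurability _ (RGenOInfty.measurableE R)) => //.
move=> _ [_ [r ->] <-]; rewrite setTI; apply: open_measurable_rV.
by apply: open_comp => // x _; exact: cg.
Qed.

Lemma coord_measurable_rV i : measurable_fun [set: B] (fun y : B => (y : G) ord0 i).
Proof. by apply: (@continuous_measurable_rV (fun y => y ord0 i)); exact: coord_continuous. Qed.

Lemma normr_rV_lt (x : G) (r : R) : 0 < r ->
  (`|x| < r) <-> (forall i, `|x ord0 i| < r).
Proof.
move=> r0; have -> : (`|x| < r : Prop) = ball_ (fun x : G => `|x|) 0 r x.
  by rewrite /ball_ /= sub0r normrN.
rewrite -mx_norm_ball; split=> [[_ h] i|h].
  by have := h ord0 i; rewrite /ball /= mxE sub0r normrN.
by split=> // i j; rewrite /ball /= mxE sub0r normrN (ord1 i).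
Qed.

Lemma normr_rV_le (x : G) (r : R) : 0 <= r ->
  (`|x| <= r) <-> (forall i, `|x ord0 i| <= r).
Proof.
move=> r0; split=> [xr i|h].
  apply/ler_addgt0Pr => e e0; apply/ltW.
  apply: (normr_rV_lt x (ltr_wpDl r0 e0)).1.
  by rewrite (le_lt_trans xr)// ltrDl.
apply/ler_addgt0Pr => e e0; apply/ltW.
apply/(normr_rV_lt x (ltr_wpDl r0 e0)) => i.
by rewrite (le_lt_trans (h i))// ltrDl.
Qed.

Lemma coord_le_normr (x : G) i : `|x ord0 i| <= `|x|.
Proof. exact: (normr_rV_le x (normr_ge0 x)).1 (lexx _) i. Qed.

(* Rational balls form a countable basis, so that measurability into the Borel
   space is tested on coordinates. *)
Lemma measurable_fun_rV d (T : measurableType d) (phi : T -> G) :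
  (forall i, measurable_fun setT (fun x => phi x ord0 i)) ->
  measurable_fun setT (phi : T -> B).
Proof.
move=> mphi; apply: (@measurability _ _ T B setT phi (@open G)) => //.
move=> _ [U oU <-]; rewrite setTI.
pose c (p : 'rV[rat]_n.+1 * nat) : G := map_mx ratr p.1.
pose bl (p : 'rV[rat]_n.+1 * nat) : set G := [set y | `|y - c p| < p.2.+1%:R^-1].
pose D := [set p | bl p `<=` U].
have -> : phi @^-1` U = \bigcup_(p in D) (phi @^-1` bl p).
  apply/seteqP; split=> [x Ux|x [p Dp px]]; last exact: Dp.
  have /nbhs_ballP[e/= e0 eU] : nbhs (phi x) U by apply: open_nbhs_nbhs.
  have [k ke] : exists k : nat, k.+1%:R^-1 < e / 2.
    have [k _ /(_ k (leqnn _))] := near_infty_natSinv_lt (PosNum (divr_gt0 e0 (ltr0n _ 2))).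
    by exists k.
  have k0 : 0 < k.+1%:R^-1 :> R by rewrite invr_gt0.
  have hq i : {q : rat | `|phi x ord0 i - ratr q| < k.+1%:R^-1}.
    apply: cid; have := @dense_rat R (ball (phi x ord0 i) k.+1%:R^-1).
    case.
    - by exists (phi x ord0 i); apply: ballxx.
    - exact: ball_open.
    - by move=> z [zb [q _ qz]]; exists q; rewrite qz.
  exists ((\row_i sval (hq i)), k).
    move=> y; rewrite /bl /= => yb; apply: eU; rewrite -ball_normE /ball_/=.
    have xb : `|phi x - c (\row_i sval (hq i), k)| < k.+1%:R^-1.
      by apply/normr_rV_lt => // i; rewrite !mxE; exact: (svalP (hq i)).
    rewrite -(subrK (c (\row_i sval (hq i), k)) (phi x)) -addrA.
    apply: le_lt_trans (ler_normD _ _) _; rewrite [e]splitr ltrD//.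
      exact: lt_trans ke.
    by rewrite distrC; apply: lt_trans ke.
  by rewrite /bl /=; apply/normr_rV_lt => // i; rewrite !mxE; exact: (svalP (hq i)).
rewrite bigcup_mkcond; apply: countable_bigcupT_measurable => [|p].
  exact: countableP.
case: ifP => // _.
have -> : phi @^-1` bl p = \bigcap_(i in [set: 'I_n.+1])
     [set x | `|phi x ord0 i - c p ord0 i| < p.2.+1%:R^-1].
  have k0 : 0 < p.2.+1%:R^-1 :> R by rewrite invr_gt0.
  apply/seteqP; split=> x /=; rewrite /bl /=.
    by move=> /normr_rV_lt h i _; have := h k0 i; rewrite !mxE.
  by move=> h; apply/normr_rV_lt => // i; have := h i I; rewrite !mxE.
apply: fin_bigcap_measurable => // i _.
have mb : measurable_fun setT (fun x => `|phi x ord0 i - c p ord0 i| < p.2.+1%:R^-1).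
  apply: measurable_fun_ltr => //; apply: measurableT_comp => //.
  by apply: measurable_funB => //; exact: mphi.
have := mb measurableT [set true] I; rewrite setTI.
by congr measurable; apply/seteqP; split.
Qed.

(** Fubini's theorem needs sums to be measurable for the product sigma-algebra on [B * B], which is
    not by definition a Borel one; passing through coordinates settles this for any source [T]. *)
Lemma measurable_addrV d (T : measurableType d) (f g : T -> G) :
  measurable_fun setT (f : T -> B) -> measurable_fun setT (g : T -> B) ->
  measurable_fun setT ((fun x => f x + g x) : T -> B).
Proof.
move=> mf mg; apply: measurable_fun_rV => i.
rewrite (_ : (fun x => _) = (fun x => f x ord0 i + g x ord0 i)); last first.
  by apply/funext => x; rewrite mxE.
by apply: measurable_funD;
  [exact: (measurableT_comp (coord_measurable_rV i) mf)|
   exact: (measurableT_comp (coord_measurable_rV i) mg)].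
Qed.

Lemma measurable_opprV d (T : measurableType d) (f : T -> G) :
  measurable_fun setT (f : T -> B) ->
  measurable_fun setT ((fun x => - f x) : T -> B).
Proof.
move=> mf; apply: measurable_fun_rV => i.
rewrite (_ : (fun x => _) = (fun x => - f x ord0 i)); last first.
  by apply/funext => x; rewrite mxE.
apply: measurableT_comp => //.
exact: (measurableT_comp (coord_measurable_rV i) mf).
Qed.

Lemma measurable_shift (x : G) : measurable_fun setT ((fun y => x + y) : B -> B).
Proof. by apply: measurable_addrV => //; exact: measurable_cst. Qed.

Definition cube (r : R) : set G := [set y | `|y| <= r].

Lemma cube_measurable r : measurable (cube r : set B).
Proof.
apply: closed_measurable_rV.
have -> : cube r = (fun y : G => `|y|) @^-1` [set z | z <= r] by [].
by apply: closed_comp => [y _|]; [exact: norm_continuous|exact: closed_le].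
Qed.

Lemma cube_compact r : compact (cube r).
Proof.
apply: bounded_closed_compact.
  exists r; split; first exact: num_real.
  by move=> M rM y /= yr; rewrite (le_trans yr)// ltW.
have -> : cube r = (fun y : G => `|y|) @^-1` [set z | z <= r] by [].
by apply: closed_comp => [y _|]; [exact: norm_continuous|exact: closed_le].
Qed.

End BorelRow.

Section Haar.
Context {R : realType} {n : nat}.
Local Notation G := 'rV[R]_n.+1.
Local Notation B := (borel_rV R n.+1).
Variable mu : {sigma_finite_measure set B -> \bar R}.
Hypothesis hmu : haar_measure mu.

Let mu_shift (x : G) (A : set G) : measurable (A : set B) ->
  mu ((fun y => x + y) @` A) = mu A.
Proof. by case: hmu => _ h _ _ _; exact: h. Qed.

Let mu_compact (K : set G) : compact K -> (mu K < +oo)%E.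
Proof. by case: hmu => _ _ h _ _; exact: h. Qed.

Let mu_neq0 : exists2 A : set G, measurable (A : set B) & mu A != 0%E.
Proof. by case: hmu. Qed.

Lemma mu_preimage_shift (x : G) (A : set G) : measurable (A : set B) ->
  mu ((fun y => x + y) @^-1` A) = mu A.
Proof.
move=> mA; rewrite -(mu_shift (- x) mA); congr (mu _).
apply/seteqP; split=> y /=; first by exists (x + y) => //; rewrite addKr.
by move=> [z Az <-]; rewrite addNKr.
Qed.

Lemma ge0_integral_shift (x : G) (f : B -> \bar R) :
  measurable_fun setT f -> (forall y, (0 <= f y)%E) ->
  (\int[mu]_y f (x + y)%R = \int[mu]_y f y)%E.
Proof.
move=> mf f0.
have mp := measurable_shift x.
transitivity (\int[pushforward mu ((fun y => (x + y)%R) : B -> B)]_y f y)%E.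
  by rewrite ge0_integral_pushforward.
apply: eq_measure_integral => A mA _.
by rewrite /= /pushforward mu_preimage_shift.
Qed.

Lemma mu_cube_fin r : (mu (cube r) < +oo)%E.
Proof. by apply: mu_compact; exact: cube_compact. Qed.

(** If a ball were null, so would be its translates by rational points; these are countably many and
    cover the space, which contradicts [mu_neq0]. *)
Lemma mu_ball_gt0 (r : R) : 0 < r -> (0 < mu [set y : G | (`|y| < r)%R])%E.
Proof.
move=> r0; rewrite lt0e measure_ge0 andbT; apply/negP => /eqP mu0.
have [A mA /eqP] := mu_neq0; apply.
pose c (p : 'rV[rat]_n.+1) : G := map_mx ratr p.
have mb : measurable ([set y : G | `|y| < r] : set B).
  apply: open_measurable_rV.
  have -> : [set y : G | `|y| < r] = (fun y : G => `|y|) @^-1` [set z | z < r] by [].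
  by apply: open_comp => [y _|]; [exact: norm_continuous|exact: open_lt].
pose F (k : nat) : set B := if unpickle k is Some p
  then (fun y => c p + y) @` [set y : G | `|y| < r] else set0.
have F0 k : mu (F k) = 0%E.
  by rewrite /F; case: unpickle => [p|]; rewrite ?measure0// mu_shift.
have mF k : measurable (F k).
  rewrite /F; case: unpickle => [p|]//.
  rewrite (_ : _ @` _ = (fun y : B => - c p + y : B) @^-1` [set y : G | `|y| < r]).
    rewrite -[X in measurable X]setTI.
    exact: (measurable_shift (- c p)).
  apply/seteqP; split=> y /=; first by move=> [z zr <-]; rewrite addKr.
  by move=> yr; exists (- c p + y) => //; rewrite addNKr.
apply/eqP; rewrite eq_le measure_ge0 andbT.
apply: (@le_trans _ _ (\sum_(0 <= k <oo) mu (F k))%E); last first.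
  by rewrite eseries0.
apply: measure_sigma_subadditive => //.
move=> x _.
have hq i : {q : rat | `|x ord0 i - ratr q| < r}.
  apply: cid; have := @dense_rat R (ball (x ord0 i) r).
  case.
  - by exists (x ord0 i); apply: ballxx.
  - exact: ball_open.
  - by move=> z [zb [q _ qz]]; exists q; rewrite qz.
exists (pickle (\row_i sval (hq i))) => //; rewrite /F pickleK.
exists (- c (\row_i sval (hq i)) + x); last by rewrite addNKr.
rewrite /= addrC; apply/normr_rV_lt => // i; rewrite !mxE; exact: (svalP (hq i)).
Qed.

End Haar.

(** * Real-valued integrals: Cauchy-Schwarz and Fubini *)

Section IntegralFacts.
Context d (T : measurableType d) (R : realType) (mu : {measure set T -> \bar R}).
Local Notation intb f := (mu.-integrable setT (EFin \o f)).

Lemma integrable_measurable_fun (f : T -> R) : intb f -> measurable_fun setT f.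
Proof. by move=> /integrableP[/measurable_EFinP]. Qed.

Lemma le_integrableR (f g : T -> R) : measurable_fun setT f ->
  (forall x, `|f x| <= g x) -> intb g -> intb f.
Proof.
move=> mf fg; apply: le_integrable => //; first exact/measurable_EFinP.
by move=> x _ /=; rewrite lee_fin (le_trans (fg x))// ler_norm.
Qed.

Lemma integrableDR (f g : T -> R) : intb f -> intb g -> intb (fun x => f x + g x).
Proof. by move=> fi gi; rewrite (_ : _ \o _ = (EFin \o f) \+ (EFin \o g))%E//; exact: integrableD. Qed.

Lemma integrableNR (f : T -> R) : intb f -> intb (fun x => - f x).
Proof. by move=> fi; rewrite (_ : _ \o _ = -%E \o (EFin \o f))%E//; exact: integrableN. Qed.

Lemma integrableBR (f g : T -> R) : intb f -> intb g -> intb (fun x => f x - g x).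
Proof. by move=> fi gi; apply: integrableDR => //; exact: integrableNR. Qed.

Lemma integrableZR (k : R) (f : T -> R) : intb f -> intb (fun x => k * f x).
Proof. by move=> fi; rewrite (_ : _ \o _ = fun x => k%:E * (EFin \o f) x)%E//; exact: integrableZl. Qed.

Lemma integrable_normR (f : T -> R) : intb f -> intb (fun x => `|f x|).
Proof. by move=> fi; exact: integrable_norm. Qed.

Lemma Rintegral_fineK (f : T -> R) : intb f ->
  (\int[mu]_x f x)%:E = (\int[mu]_x (f x)%:E)%E.
Proof. by move=> fi; rewrite /Rintegral fineK//; exact: integrable_fin_num. Qed.

Lemma ge0_integrableR (f : T -> R) : measurable_fun setT f -> (forall x, 0 <= f x) ->
  (\int[mu]_x (f x)%:E < +oo)%E -> intb f.
Proof.
move=> mf f0 foo; apply/integrableP; split; first exact/measurable_EFinP.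
by under eq_integral do rewrite /= ger0_norm//.
Qed.

Lemma RintegralN (f : T -> R) : intb f -> \int[mu]_x (- f x) = - \int[mu]_x f x.
Proof.
move=> fi; rewrite -[RHS]mulN1r -RintegralZl//.
by apply: eq_Rintegral => x _; rewrite mulN1r.
Qed.

Lemma Rintegral0 : \int[mu]_x (0 : R) = 0.
Proof. by rewrite /Rintegral integral0. Qed.

Lemma integrable_sumR (I : Type) (s : seq I) (F : I -> T -> R) :
  (forall i, intb (F i)) -> intb (fun x => \sum_(i <- s) F i x).
Proof.
move=> iF; elim: s => [|j s IH].
  rewrite (_ : _ \o _ = cst 0%E) ?integrable0//.
  by apply/funext => x; rewrite /= big_nil.
rewrite (_ : _ \o _ = EFin \o (fun x => F j x + \sum_(j <- s) F j x)).
  exact: integrableDR.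
by apply/funext => x; rewrite /= big_cons.
Qed.

Lemma Rintegral_sum (I : Type) (s : seq I) (F : I -> T -> R) :
  (forall i, intb (F i)) ->
  \int[mu]_x (\sum_(i <- s) F i x) = \sum_(i <- s) \int[mu]_x F i x.
Proof.
move=> iF; elim: s => [|i s IH].
  under eq_Rintegral do rewrite big_nil.
  by rewrite big_nil Rintegral0.
under eq_Rintegral do rewrite big_cons.
rewrite big_cons -IH RintegralD//; exact: integrable_sumR.
Qed.

(* The quadratic polynomial lambda -> int (f - lambda g)^2 is nonnegative. *)
Lemma cauchy_schwarz_Rintegral (f g : T -> R) :
  measurable_fun setT f -> measurable_fun setT g ->
  intb (fun x => f x ^+ 2) -> intb (fun x => g x ^+ 2) ->
  intb (fun x => f x * g x) /\
  (\int[mu]_x (f x * g x)) ^+ 2 <= (\int[mu]_x (f x ^+ 2)) * (\int[mu]_x (g x ^+ 2)).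
Proof.
move=> mf mg f2 g2.
have fg : intb (fun x => f x * g x).
  apply: (@le_integrableR _ (fun x => f x ^+ 2 + g x ^+ 2)).
  - exact: measurable_funM.
  - move=> x; rewrite normrM -[f x ^+ 2]real_normK ?num_real// -[g x ^+ 2]real_normK ?num_real//.
    have := normr_ge0 (f x); have := normr_ge0 (g x); nra.
  - exact: integrableDR.
split=> //.
set a := \int[mu]_x (f x ^+ 2); set b := \int[mu]_x (f x * g x); set c := \int[mu]_x (g x ^+ 2).
have Q (l : R) : 0 <= a - 2 * l * b + l ^+ 2 * c.
  have -> : a - 2 * l * b + l ^+ 2 * c = \int[mu]_x ((f x - l * g x) ^+ 2).
    rewrite /a /b /c -!RintegralZl// -RintegralB//; last exact: integrableZR.
    rewrite -RintegralD//; last 2 first.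
    - by apply: integrableBR => //; exact: integrableZR.
    - exact: integrableZR.
    by apply: eq_Rintegral => x _; ring.
  by apply: Rintegral_ge0 => x _; exact: sqr_ge0.
have a0 : 0 <= a by apply: Rintegral_ge0 => x _; exact: sqr_ge0.
have c0 : 0 <= c by apply: Rintegral_ge0 => x _; exact: sqr_ge0.
have [c00|cn0] := eqVneq c 0.
  have [->|b0] := eqVneq b 0; first by rewrite expr0n mulr_ge0.
  have := Q ((a + 1) / (2 * b)); rewrite c00 mulr0 addr0.
  rewrite (_ : 2 * _ * b = a + 1); last by field.
  lra.
have := Q (b / c).
rewrite (_ : _ + _ = (a * c - b ^+ 2) / c); last by field.
by rewrite pmulr_lge0 ?invr_gt0 ?lt_def ?cn0// subr_ge0.
Qed.

End IntegralFacts.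

Section RFubini.
Context d1 d2 (T1 : measurableType d1) (T2 : measurableType d2) (R : realType).
Variables (m1 : {sigma_finite_measure set T1 -> \bar R})
  (m2 : {sigma_finite_measure set T2 -> \bar R}).
Variable F : T1 -> T2 -> R.
Hypothesis mF : measurable_fun setT (fun p : T1 * T2 => F p.1 p.2).

Lemma measurable_Rintegral_fubini : measurable_fun setT (fun x => \int[m2]_y F x y).
Proof.
have mE : measurable_fun setT (fun p : T1 * T2 => (F p.1 p.2)%:E).
  exact/measurable_EFinP.
rewrite /Rintegral.
rewrite (_ : (fun x => _) = (fun x => fine
   (\int[m2]_y ((fun p => (F p.1 p.2)%:E)^\+ (x, y)) -
    \int[m2]_y ((fun p => (F p.1 p.2)%:E)^\- (x, y)))%E)); last first.
  apply/funext => x; rewrite integralE; congr (fine (_ - _)).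
    by apply: eq_integral => y _; rewrite !funeposE.
  by apply: eq_integral => y _; rewrite !funenegE.
apply: measurableT_comp => //; apply: emeasurable_funB.
  by apply: measurable_fun_fubini_tonelli_F => //; exact: measurable_funepos.
by apply: measurable_fun_fubini_tonelli_F => //; exact: measurable_funeneg.
Qed.

Hypothesis iF1 : forall x, m2.-integrable setT (EFin \o F x).
Hypothesis iF2 : forall y, m1.-integrable setT (EFin \o F ^~ y).
Hypothesis iF : (\int[m1]_x \int[m2]_y `|F x y|%:E < +oo)%E.

Let iP : (m1 \x m2)%E.-integrable setT (fun p => (F p.1 p.2)%:E).
Proof.
by apply/integrable12ltyP => //; exact/measurable_EFinP.
Qed.

Lemma Rintegrable_fubini : m1.-integrable setT (EFin \o (fun x => \int[m2]_y F x y)).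
Proof.
have := integrable_fubini_F iP; congr (_.-integrable _ _).
by apply/funext => x /=; rewrite Rintegral_fineK.
Qed.

(** Since every section is integrable, the inner real integrals agree with the extended ones at
    every point, so Fubini's theorem transfers without exceptional sets. *)
Lemma Rintegral_fubini :
  \int[m1]_x \int[m2]_y F x y = \int[m2]_y \int[m1]_x F x y.
Proof.
have := Fubini iP => /=.
rewrite /Rintegral => H.
under eq_integral do rewrite (Rintegral_fineK (iF1 _)).
under [in RHS]eq_integral do rewrite (Rintegral_fineK (iF2 _)).
by rewrite H.
Qed.

End RFubini.

(** * Translation and reflection invariance of the integral *)

Section HaarIntegral.
Context {R : realType} {n : nat}.
Local Notation G := 'rV[R]_n.+1.
Local Notation B := (borel_rV R n.+1).
Variable mu : {sigma_finite_measure set B -> \bar R}.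
Hypothesis hmu : haar_measure mu.
Local Notation intb f := (mu.-integrable setT (EFin \o (f : B -> R))).
Local Notation measb f := (measurable_fun (setT : set B) (f : B -> R)).

Lemma integral_shift (x : G) (f : B -> \bar R) : measurable_fun setT f ->
  (\int[mu]_y f (x + y)%R = \int[mu]_y f y)%E.
Proof.
move=> mf; rewrite [LHS]integralE [RHS]integralE; congr (_ - _)%E.
  rewrite -(ge0_integral_shift hmu x (measurable_funepos mf))//.
  by apply: eq_integral => y _; rewrite !funeposE.
rewrite -(ge0_integral_shift hmu x (measurable_funeneg mf))//.
by apply: eq_integral => y _; rewrite !funenegE.
Qed.

Lemma measurable_comp_shift (x : G) (f : G -> R) : measb f -> measb (fun y => f (x + y)).
Proof. by move=> mf; exact: (measurableT_comp mf (measurable_shift x)). Qed.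

Lemma Rintegral_shift (x : G) (f : G -> R) : measb f ->
  \int[mu]_y f (x + y) = \int[mu]_y f y.
Proof.
by move=> mf; congr fine; rewrite (@integral_shift x (EFin \o f))//; exact/measurable_EFinP.
Qed.

Lemma integrable_shift (x : G) (f : G -> R) : intb f -> intb (fun y => f (x + y)).
Proof.
move=> fi; have mf := integrable_measurable_fun fi.
apply/integrableP; split; first by apply/measurable_EFinP; exact: (measurable_comp_shift x mf).
rewrite (@integral_shift x (fun y => `|f y|%:E))//; last first.
  by apply/measurable_EFinP; exact: measurableT_comp.
by case/integrableP : fi.
Qed.

Lemma mu_cube_gt0 (r : R) : 0 < r -> (0 < mu (cube r))%E.
Proof.
move=> r0; apply: lt_le_trans (mu_ball_gt0 hmu r0) _.
apply: le_measure; rewrite ?inE.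
- apply: open_measurable_rV.
  rewrite (_ : [set y | _] = (fun y : G => `|y|) @^-1` [set z | z < r])//.
  by apply: open_comp => [y _|]; [exact: norm_continuous|exact: open_lt].
- exact: cube_measurable.
- by move=> y /= /ltW.
Qed.

Lemma measurable_comp_opp (f : G -> R) : measb f -> measb (fun y => f (- y)).
Proof.
by move=> mf; apply: (measurableT_comp mf); apply: measurable_opprV; exact: measurable_id.
Qed.

(* Uniqueness of Haar measure specialised to the reflected measure: integrate
   f(t) g(t + s) over both variables in both orders. *)
Lemma ge0_integral_opp (f : G -> R) : measb f -> (forall y, 0 <= f y) ->
  (\int[mu]_y (f (- y))%:E = \int[mu]_y (f y)%:E)%E.
Proof.
move=> mf f0.
pose g : G -> R := \1_(cube 1).
have mg : measb g by apply: measurable_indic; exact: cube_measurable.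
have g0 y : 0 <= g y by rewrite /g indicE.
have mE (h : G -> R) : measb h -> measurable_fun setT (EFin \o (h : B -> R)).
  by move=> mh; exact/measurable_EFinP.
have Ig : (\int[mu]_y (g y)%:E = mu (cube 1))%E.
  by rewrite integral_indic ?setIT//; exact: cube_measurable.
have mfst : measurable_fun setT (fun p : B * B => p.1 : B) by exact: measurable_fst.
have msnd : measurable_fun setT (fun p : B * B => p.2 : B) by exact: measurable_snd.
have E1 : (\int[mu]_s \int[mu]_t (f t * g (t + s))%:E =
    \int[mu]_y (f y)%:E * mu (cube 1))%E.
  rewrite -(@fubini_tonelli _ _ B B R mu mu (fun p : B * B => (f p.1 * g (p.1 + p.2))%:E))/=; last 2 first.
  - apply/measurable_EFinP; apply: measurable_funM.
      exact: (measurableT_comp mf mfst).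
    by apply: (measurableT_comp mg); exact: measurable_addrV.
  - by move=> p; rewrite lee_fin mulr_ge0.
  rewrite -Ig -ge0_integralZr//; last 3 first.
  - exact: mE.
  - by move=> y _; rewrite lee_fin.
  - by apply: integral_ge0 => y _; rewrite lee_fin.
  apply: eq_integral => t _.
  under eq_integral do rewrite EFinM.
  rewrite ge0_integralZl_EFin//; last 2 first.
  - by move=> x _; rewrite lee_fin.
  - exact: (mE _ (measurable_comp_shift t mg)).
  congr (_ * _)%E.
  exact: (@integral_shift t (EFin \o g) (mE _ mg)).
(* Shifting t by -s makes s occur only in f (- s + t), whose integral in s is that of the reflected
   f. *)
have E2 : (\int[mu]_s \int[mu]_t (f t * g (t + s))%:E =
    \int[mu]_y (f (- y))%:E * mu (cube 1))%E.
  transitivity (\int[mu]_s \int[mu]_t (f (- s + t)%R * g t)%:E)%E.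
    apply: eq_integral => s _.
    rewrite -(@integral_shift (- s) (fun t => (f t * g (t + s))%:E)); last first.
      apply: mE; apply: measurable_funM => //.
      by apply: (measurableT_comp mg); exact: measurable_addrV.
    apply: eq_integral => t _; rewrite [X in g X]addrAC addNr add0r//.
  rewrite (@fubini_tonelli _ _ B B R mu mu (fun p : B * B => (f (- p.1 + p.2) * g p.2)%:E))/=; last 2 first.
  - apply/measurable_EFinP; apply: measurable_funM.
      apply: (measurableT_comp mf); apply: measurable_addrV => //.
      exact: measurable_opprV.
    exact: (measurableT_comp mg).
  - by move=> p; rewrite lee_fin mulr_ge0.
  rewrite -Ig -ge0_integralZl//; last 3 first.
  - exact: mE.
  - by move=> y _; rewrite lee_fin.
  - by apply: integral_ge0 => y _; rewrite lee_fin.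
  apply: eq_integral => t _.
  under eq_integral do rewrite EFinM.
  rewrite ge0_integralZr//; last 3 first.
  - apply: mE; apply: (measurableT_comp mf); apply: measurable_addrV.
      by apply: measurable_opprV; exact: measurable_id.
    exact: measurable_cst.
  - by move=> y _; rewrite lee_fin.
  - by rewrite lee_fin.
  congr (_ * _)%E.
  rewrite -(@integral_shift (- t) (fun y => (f (- y))%:E)); last first.
    by apply: mE; exact: measurable_comp_opp.
  by apply: eq_integral => y _; rewrite opprD opprK addrC.
have cg : (0 < mu (cube 1))%E by exact: mu_cube_gt0.
have cf : mu (cube 1) \is a fin_num.
  by rewrite ge0_fin_numE//; exact: (mu_cube_fin hmu).
have : (\int[mu]_y (f (- y))%:E * mu (cube 1) = \int[mu]_y (f y)%:E * mu (cube 1))%E.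
  by rewrite -E1 -E2.
move=> /(congr1 (fun z => z * ((fine (mu (cube 1)))^-1)%:E)%E).
rewrite -!muleA -{1 3}(fineK cf) -!EFinM divff; last first.
  by apply/eqP => h; move: cg; rewrite -(fineK cf) h ltxx.
by rewrite !mule1.
Qed.

End HaarIntegral.

(** * Convolution operators on real functions *)

Section RealConvolution.
Context {R : realType} {n : nat}.
Local Notation G := 'rV[R]_n.+1.
Local Notation B := (borel_rV R n.+1).
Variable mu : {sigma_finite_measure set B -> \bar R}.
Hypothesis hmu : haar_measure mu.
Local Notation intb f := (mu.-integrable setT (EFin \o (f : B -> R))).
Local Notation measb f := (measurable_fun (setT : set B) (f : B -> R)).

Lemma le_intb (f g : G -> R) : measb f -> (forall x, `|f x| <= g x) ->
  intb g -> intb f.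
Proof. exact: le_integrableR. Qed.

Lemma Rintegral_opp (f : G -> R) : intb f ->
  intb (fun y => f (- y)) /\ \int[mu]_y f (- y) = \int[mu]_y f y.
Proof.
move=> fi; have mf := integrable_measurable_fun fi.
have fo : intb (fun y => f (- y)).
  apply/integrableP; split.
    by apply/measurable_EFinP; exact: (measurable_comp_opp mf).
  rewrite (@ge0_integral_opp _ _ mu hmu (fun y => `|f y|))//; last first.
    exact: measurableT_comp.
  by case/integrableP : fi.
split=> //.
have E (h : G -> R) : intb h -> \int[mu]_y h y =
   \int[mu]_y `|h y| - \int[mu]_y (`|h y| - h y).
  move=> hi; rewrite -RintegralB//; last 2 first.
  - exact: integrable_normR.
  - by apply: integrableBR => //; exact: integrable_normR.
  by apply: eq_Rintegral => y _; ring.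
rewrite (E _ fo) (E _ fi); congr (_ - _); congr fine.
  rewrite (@ge0_integral_opp _ _ mu hmu (fun y => `|f y|))//.
  exact: measurableT_comp.
rewrite (@ge0_integral_opp _ _ mu hmu (fun y => `|f y| - f y))//; last first.
  by move=> y; rewrite subr_ge0 ler_norm.
by apply: measurable_funB => //; exact: measurableT_comp.
Qed.

(** A class inside L^1 and L^2 that is closed under products, differences, translations and
    autocorrelation. Convolvers are taken from it, which makes the integrability conditions of
    Fubini's theorem easy to meet. *)
Definition bsupp (f : G -> R) := [/\ measb f, exists M : R, forall y, `|f y| <= M
  & exists r : R, forall y, r < `|y| -> f y = 0].

Lemma bsupp_bound f : bsupp f -> exists M r : R, [/\ 0 <= M, 0 <= r,
  forall y, `|f y| <= M & forall y, r < `|y| -> f y = 0].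
Proof.
move=> [_ [M fM] [r fr]]; exists M, `|r|; split=> //.
  exact: le_trans (fM 0).
by move=> y ry; apply: fr; rewrite (le_lt_trans _ ry)// ler_norm.
Qed.

Lemma integrable_indic_cube (r : R) : intb (\1_(cube r)).
Proof.
apply: ge0_integrableR.
- by apply: measurable_indic; exact: cube_measurable.
- by move=> y; rewrite indicE.
- rewrite integral_indic ?setIT//; first exact: (mu_cube_fin hmu).
  exact: cube_measurable.
Qed.

Lemma bsupp_integrable f : bsupp f -> intb f.
Proof.
move=> bf; have [M [r [M0 r0 fM fr]]] := bsupp_bound bf.
apply: (@le_intb _ (fun y => M * \1_(cube r) y)).
- by case: bf.
- move=> y; rewrite indicE; have [yr|yr] := boolP (_ \in _).
    by rewrite mulr1.
  rewrite fr ?normr0 ?mulr0//; rewrite ltNge; apply/negP => h.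
  by move/negP: yr; apply; rewrite inE.
- by apply: integrableZR; exact: integrable_indic_cube.
Qed.

Lemma bsuppM f g : bsupp f -> bsupp g -> bsupp (fun y => f y * g y).
Proof.
move=> [mf [M fM] [r fr]] [mg [N gN] _]; split.
- exact: measurable_funM.
- by exists (M * N) => y; rewrite normrM ler_pM.
- by exists r => y /fr ->; rewrite mul0r.
Qed.

Lemma bsuppB f g : bsupp f -> bsupp g -> bsupp (fun y => f y - g y).
Proof.
move=> [mf [M fM] [r fr]] [mg [N gN] [s gs]]; split.
- exact: measurable_funB.
- by exists (M + N) => y; rewrite (le_trans (ler_normB _ _))// lerD.
- exists (Num.max r s) => y; rewrite gt_max => /andP[ry sy].
  by rewrite fr// gs// subr0.
Qed.

Lemma bsupp_opp f : bsupp f -> bsupp (fun y => f (- y)).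
Proof.
move=> [mf [M fM] [r fr]]; split.
- exact: measurable_comp_opp.
- by exists M.
- by exists r => y ry; rewrite fr// normrN.
Qed.

Lemma bsupp_shift x f : bsupp f -> bsupp (fun y => f (x + y)).
Proof.
move=> [mf [M fM] [r fr]]; split.
- exact: (measurable_comp_shift x mf).
- by exists M.
- exists (r + `|x|) => y ry; rewrite fr//.
  have := ler_normB (x + y) x; rewrite addrC addKr; lra.
Qed.

Definition sqi (f : G -> R) := measb f /\ intb (fun y => f y ^+ 2).

Definition nq (f : G -> R) : R := \int[mu]_y (f y ^+ 2).

Lemma nq_ge0 f : 0 <= nq f.
Proof. by apply: Rintegral_ge0 => y _; exact: sqr_ge0. Qed.

Lemma bsupp_sqi f : bsupp f -> sqi f.
Proof. by move=> bf; split; [case: bf|exact: bsupp_integrable (bsuppM bf bf)]. Qed.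

Lemma sqi_shift x f : sqi f -> sqi (fun y => f (x + y)).
Proof.
move=> [mf if2]; split; first exact: (measurable_comp_shift x mf).
exact: (integrable_shift hmu x if2).
Qed.

Lemma nq_shift x f : sqi f -> nq (fun y => f (x + y)) = nq f.
Proof.
by move=> [mf if2]; apply: (Rintegral_shift hmu x (f := fun y => f y ^+ 2));
  exact: measurable_funX.
Qed.

Lemma sqi_opp f : sqi f -> sqi (fun y => f (- y)).
Proof.
move=> [mf if2]; split; first exact: measurable_comp_opp.
exact: (Rintegral_opp if2).1.
Qed.

Lemma sqi_refl s f : sqi f -> sqi (fun t => f (- t + s)).
Proof.
move=> /(sqi_shift s)/sqi_opp; congr sqi.
by apply/funext => t; rewrite addrC.
Qed.

Lemma sqiD f g : sqi f -> sqi g -> sqi (fun y => f y + g y).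
Proof.
move=> [mf f2] [mg g2]; split; first exact: measurable_funD.
have [fg _] := cauchy_schwarz_Rintegral mf mg f2 g2.
apply: (@le_intb _ (fun x => f x ^+ 2 + g x ^+ 2 + 2 * (f x * g x))).
- by apply: measurable_funX; exact: measurable_funD.
- by move=> x; rewrite ger0_norm ?sqr_ge0//; lra.
- by apply: integrableDR; [exact: integrableDR|exact: integrableZR].
Qed.

Lemma sqiZ a f : sqi f -> sqi (fun y => a * f y).
Proof.
move=> [mf f2]; split; first exact: measurable_funM.
rewrite (_ : _ \o _ = EFin \o (fun y => a ^+ 2 * f y ^+ 2)).
  exact: integrableZR.
by apply/funext => y /=; rewrite exprMn.
Qed.

Lemma sqiN f : sqi f -> sqi (fun y => - f y).
Proof. by move=> /(sqiZ (-1)); congr sqi; apply/funext => y; rewrite mulN1r. Qed.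

Lemma sqiB f g : sqi f -> sqi g -> sqi (fun y => f y - g y).
Proof. by move=> sf sg; apply: sqiD => //; exact: sqiN. Qed.

Lemma sqi_mul f g : sqi f -> sqi g -> intb (fun y => f y * g y).
Proof. by move=> [mf f2] [mg g2]; have [] := cauchy_schwarz_Rintegral mf mg f2 g2. Qed.

Definition pair2 (f g : G -> R) : R := \int[mu]_y (f y * g y).

Lemma pair2_CS f g : sqi f -> sqi g -> pair2 f g ^+ 2 <= nq f * nq g.
Proof. by move=> [mf f2] [mg g2]; have [] := cauchy_schwarz_Rintegral mf mg f2 g2. Qed.

Definition cv (f xi : G -> R) : G -> R := fun s => \int[mu]_t (f t * xi (- t + s)).

Lemma cv_integrable f xi s : sqi f -> sqi xi -> intb (fun t => f t * xi (- t + s)).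
Proof. by move=> sf sx; apply: sqi_mul => //; exact: sqi_refl. Qed.

Lemma measurable_pair_cv d1 (T1 : measurableType d1) (f : T1 -> G) g :
  measb g -> measurable_fun setT (f : T1 -> B) ->
  measurable_fun setT (fun x => g (f x)).
Proof. by move=> mg mf; exact: (measurableT_comp mg mf). Qed.

Lemma measurable_sub_pair (xi : G -> R) : measb xi ->
  measurable_fun setT (fun p : B * B => xi (- p.2 + p.1)).
Proof.
move=> mx; apply: (measurable_pair_cv mx); apply: measurable_addrV => //.
by apply: measurable_opprV; exact: measurable_snd.
Qed.

Lemma measurable_int_param (F : G -> G -> R) :
  measurable_fun setT (fun p : B * B => F p.1 p.2) ->
  measb (fun s => \int[mu]_t F s t).
Proof. by move=> mF; exact: (@measurable_Rintegral_fubini _ _ B B R mu F mF). Qed.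

Lemma measurable_cv (f xi : G -> R) : measb f -> measb xi -> measb (cv f xi).
Proof.
move=> mf mx.
apply: (measurable_int_param (F := fun s t => f t * xi (- t + s))).
apply: measurable_funM; last exact: measurable_sub_pair.
exact: (measurableT_comp mf measurable_snd).
Qed.

Definition n1 (f : G -> R) : R := \int[mu]_y `|f y|.

Lemma tonelli_abs (F : G -> G -> R) :
  measurable_fun setT (fun p : B * B => F p.1 p.2) ->
  (\int[mu]_s \int[mu]_t `|F s t|%:E = \int[mu]_t \int[mu]_s `|F s t|%:E)%E.
Proof.
move=> mF; apply: (@fubini_tonelli _ _ B B R mu mu (fun p => `|F p.1 p.2|%:E)) => //.
by apply/measurable_EFinP; exact: measurableT_comp.
Qed.

(** Cauchy-Schwarz with |f xi| split as sqrt|f| times sqrt|f| |xi| bounds the square of the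
    convolution by [n1 f * W s], and [W] integrates to [n1 f * nq xi] by Tonelli's theorem and
    translation invariance. *)
Lemma young f xi : bsupp f -> sqi xi ->
  sqi (cv f xi) /\ nq (cv f xi) <= n1 f ^+ 2 * nq xi.
Proof.
move=> bf sx; have [mf _ _] := bf; have [mx ix] := sx.
have sf := bsupp_sqi bf.
have n10 : 0 <= n1 f by apply: Rintegral_ge0.
have m2 s : intb (fun t => `|f t| * xi (- t + s) ^+ 2).
  have [M [r [M0 r0 fM fr]]] := bsupp_bound bf.
  apply: (@le_intb _ (fun y => M * (xi (- y + s) ^+ 2))).
  - apply: measurable_funM; first exact: measurableT_comp.
    by apply: measurable_funX; case: (sqi_refl s sx).
  - by move=> t; rewrite normrM normr_id [X in _ * X]ger0_norm ?sqr_ge0// ler_wpM2r// sqr_ge0.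
  - by apply: integrableZR; case: (sqi_refl s sx).
pose W s := \int[mu]_t (`|f t| * xi (- t + s) ^+ 2).
have pw s : cv f xi s ^+ 2 <= n1 f * W s.
  have mr : measb (fun t => xi (- t + s)) by case: (sqi_refl s sx).
  have ms : measb (fun t => Num.sqrt `|f t|).
    apply: (measurableT_comp (f := @Num.sqrt R)) => //; last exact: measurableT_comp.
    by apply: continuous_measurable_fun; exact: sqrt_continuous.
  have [] := @cauchy_schwarz_Rintegral _ _ _ mu (fun t => Num.sqrt `|f t|)
    (fun t => Num.sqrt `|f t| * `|xi (- t + s)|).
  - exact: ms.
  - by apply: measurable_funM => //; exact: measurableT_comp.
  - rewrite (_ : _ \o _ = EFin \o (fun t => `|f t|)).
      by apply: integrable_normR; exact: bsupp_integrable.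
    by apply/funext => t /=; rewrite sqr_sqrtr.
  - rewrite (_ : _ \o _ = EFin \o (fun t => `|f t| * xi (- t + s) ^+ 2)); first exact: m2.
    by apply/funext => t /=; rewrite exprMn sqr_sqrtr// real_normK ?num_real.
  move=> _; under [X in _ <= X * _ -> _]eq_Rintegral do rewrite sqr_sqrtr//.
  under [X in _ <= _ * X -> _]eq_Rintegral do rewrite exprMn sqr_sqrtr// real_normK ?num_real//.
  apply: le_trans; rewrite -[X in X <= _]real_normK ?num_real// ler_sqr ?nnegrE//; last first.
    by apply: Rintegral_ge0 => t _; rewrite !mulr_ge0// sqrtr_ge0.
  apply: le_trans (le_normr_Rintegral _ _) _ => //; first exact: cv_integrable.
  rewrite le_eqVlt; apply/orP; left; apply/eqP; apply: eq_Rintegral => t _.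
  by rewrite normrM mulrA -expr2 sqr_sqrtr.
have mW : measb W.
  apply: (measurable_int_param (F := fun s t => `|f t| * xi (- t + s) ^+ 2)).
  apply: measurable_funM.
    by apply: measurableT_comp => //; exact: (measurableT_comp mf measurable_snd).
  by apply: measurable_funX; exact: measurable_sub_pair.
have IW : (\int[mu]_s (W s)%:E = (n1 f * nq xi)%:E)%E.
  under eq_integral do rewrite /W Rintegral_fineK//.
  transitivity (\int[mu]_s \int[mu]_t `|(`|f t| * xi (- t + s) ^+ 2)|%:E)%E.
    by apply: eq_integral => s _; apply: eq_integral => t _;
      rewrite [in RHS]ger0_norm// mulr_ge0// sqr_ge0.
  rewrite (tonelli_abs (F := fun s t => `|f t| * xi (- t + s) ^+ 2)); last first.
    apply: measurable_funM.
      by apply: measurableT_comp => //; exact: (measurableT_comp mf measurable_snd).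
    by apply: measurable_funX; exact: measurable_sub_pair.
  transitivity (\int[mu]_t (`|f t| * nq xi)%:E)%E.
    apply: eq_integral => t _.
    rewrite -(nq_shift (- t) sx) /nq -RintegralZl//; last by case: (sqi_shift (- t) sx).
    rewrite Rintegral_fineK//; last first.
      by apply: integrableZR; case: (sqi_shift (- t) sx).
    by apply: eq_integral => s _; rewrite ger0_norm// mulr_ge0// sqr_ge0.
  rewrite -Rintegral_fineK.
    by rewrite RintegralZr//; apply: integrable_normR; exact: bsupp_integrable.
  rewrite (_ : _ \o _ = EFin \o (fun t => nq xi * `|f t|)).
    by apply: integrableZR; apply: integrable_normR; exact: bsupp_integrable.
  by apply/funext => t /=; rewrite mulrC.
have W0 s : 0 <= W s by apply: Rintegral_ge0 => t _; rewrite mulr_ge0// sqr_ge0.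
have iW : intb W by apply: ge0_integrableR => //; rewrite IW ltry.
have iC : intb (fun s => cv f xi s ^+ 2).
  apply: (@le_intb _ (fun s => n1 f * W s)).
  - by apply: measurable_funX; exact: measurable_cv.
  - by move=> s; rewrite ger0_norm ?sqr_ge0.
  - exact: integrableZR.
split; first by split => //; exact: measurable_cv.
have : nq (cv f xi) <= \int[mu]_s (n1 f * W s).
  by apply: le_Rintegral => //; exact: integrableZR.
move=> /le_trans; apply; rewrite RintegralZl// expr2 -mulrA ler_wpM2l//.
by rewrite /Rintegral IW.
Qed.

Lemma ler_normM_sqi (a b : R) : `|a * b| <= a ^+ 2 + b ^+ 2.
Proof.
rewrite normrM -(real_normK (num_real a)) -(real_normK (num_real b)).
have := normr_ge0 a; have := normr_ge0 b; nra.
Qed.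

(** Fubini's theorem; absolute integrability comes from |u v| <= u^2 + v^2, whose right-hand side
    has an integral independent of the translation. It serves both to form adjoints and to pair
    lambda(a) with a coefficient function. *)
Lemma pair2_cv (phi a psi : G -> R) : sqi phi -> bsupp a -> sqi psi ->
  intb (fun t => a t * pair2 phi (fun s => psi (- t + s))) /\
  pair2 phi (cv a psi) = \int[mu]_t (a t * pair2 phi (fun s => psi (- t + s))).
Proof.
move=> sp ba ss; have [mp _] := sp; have [ms _] := ss; have [ma _ _] := ba.
pose F (s t : G) := phi s * (a t * psi (- t + s)).
have mF : measurable_fun setT (fun p : B * B => F p.1 p.2).
  apply: measurable_funM; first exact: (measurableT_comp mp measurable_fst).
  apply: measurable_funM; last exact: measurable_sub_pair.
  exact: (measurableT_comp ma measurable_snd).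
have mF' : measurable_fun setT (fun p : B * B => F p.2 p.1).
  exact: (measurableT_comp mF (@measurable_swap _ _ B B)).
have i1 s : intb (F s).
  by apply: integrableZR; apply: cv_integrable => //; exact: bsupp_sqi.
have FE t s : F s t = a t * (phi s * psi (- t + s)) by rewrite /F; ring.
have i2 t : intb (F ^~ t).
  rewrite (_ : _ \o _ = EFin \o (fun s => a t * (phi s * psi (- t + s)))).
    by apply: integrableZR; apply: sqi_mul => //; exact: sqi_shift.
  by apply/funext => s /=; rewrite FE.
have iF : (\int[mu]_t \int[mu]_s `|F s t|%:E < +oo)%E.
  apply: (@le_lt_trans _ _ (\int[mu]_t (`|a t| * (nq phi + nq psi))%:E)%E).
    have mA : measb (fun t => \int[mu]_s `|F s t|).
      by apply: (measurable_int_param (F := fun t s => `|F s t|)); exact: measurableT_comp.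
    apply: ge0_le_integral => //.
    - by move=> t _; apply: integral_ge0.
    - under eq_fun do rewrite -(Rintegral_fineK (integrable_normR (i2 _))).
      exact/measurable_EFinP.
    - by apply/measurable_EFinP; apply: measurable_funM => //; exact: measurableT_comp.
    move=> t _; rewrite -(Rintegral_fineK (integrable_normR (i2 t))) lee_fin.
    have st := sqi_shift (- t) ss.
    rewrite -(nq_shift (- t) ss) /nq -RintegralD//; last 2 first.
    - by case: sp.
    - by case: st.
    rewrite -RintegralZl//; last by apply: integrableDR; [case: sp|case: st].
    apply: le_Rintegral => //.
    - exact: integrable_normR.
    - by apply: integrableZR; apply: integrableDR; [case: sp|case: st].
    - move=> s _; rewrite FE normrM ler_wpM2l//; exact: ler_normM_sqi.
  rewrite -Rintegral_fineK ?ltry//.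
  rewrite (_ : _ \o _ = EFin \o (fun t => (nq phi + nq psi) * `|a t|)).
    by apply: integrableZR; apply: integrable_normR; exact: bsupp_integrable.
  by apply/funext => t /=; rewrite mulrC.
have aE t : a t * pair2 phi (fun s => psi (- t + s)) = \int[mu]_s F s t.
  rewrite /pair2 -RintegralZl//; last by apply: sqi_mul => //; exact: sqi_shift.
  by apply: eq_Rintegral => s _; rewrite FE.
split.
  rewrite (_ : _ \o _ = EFin \o (fun t => \int[mu]_s F s t)).
    exact: (@Rintegrable_fubini _ _ B B R mu mu (fun t s => F s t)).
  by apply/funext => t; rewrite /= aE.
under [RHS]eq_Rintegral do rewrite aE.
rewrite (@Rintegral_fubini _ _ B B R mu mu (fun t s => F s t))//.
apply: eq_Rintegral => s _; rewrite /F RintegralZl//.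
by apply: cv_integrable => //; exact: bsupp_sqi.
Qed.

Definition autocorr (f : G -> R) : G -> R := fun x => \int[mu]_t (f t * f (t + x)).

Lemma autocorr_bsupp (f : G -> R) : bsupp f -> bsupp (autocorr f).
Proof.
move=> bf; have [mf _ _] := bf; have [M [r [M0 r0 fM fr]]] := bsupp_bound bf.
split.
- apply: (measurable_int_param (F := fun x t => f t * f (t + x))).
  apply: measurable_funM; first exact: (measurableT_comp mf measurable_snd).
  apply: (measurable_pair_cv mf); apply: measurable_addrV.
    exact: measurable_snd.
  exact: measurable_fst.
- exists (M * n1 f) => x.
  have sx : intb (fun t => f t * f (t + x)).
    rewrite (_ : (fun t => _) = (fun t => f t * f (x + t))).
      by apply: bsupp_integrable; apply: bsuppM => //; exact: bsupp_shift.
    by apply/funext => t; rewrite addrC.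
  apply: le_trans (le_normr_Rintegral _ _) _ => //.
  rewrite /n1 -RintegralZl//; last by apply: integrable_normR; exact: bsupp_integrable.
  apply: le_Rintegral => //.
  + exact: integrable_normR.
  + by apply: integrableZR; apply: integrable_normR; exact: bsupp_integrable.
  + by move=> t _; rewrite normrM mulrC ler_wpM2r.
- exists (r + r) => x xr; rewrite /autocorr -[RHS](@Rintegral0 _ _ _ mu).
  apply: eq_Rintegral => t _.
  have [tr|tr] := ltP r `|t|; first by rewrite fr// mul0r.
  rewrite [X in _ * X]fr ?mulr0//.
  have := ler_normB (t + x) t; rewrite addrAC subrr add0r; lra.
Qed.

(** Convolution with the reflected function is the adjoint of [cv f]. Translating the inner variable
    by t and exchanging the integrals collects the two convolvers into one. *)
Lemma cv_corr (f xi : G -> R) (s : G) : bsupp f -> sqi xi ->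
  cv (fun t => f (- t)) (cv f xi) s = cv (autocorr f) xi s.
Proof.
move=> bf sx; have [mf _ _] := bf; have [mx _] := sx.
have [M [r [M0 r0 fM fr]]] := bsupp_bound bf.
have sh := (young bf sx).1.
have bo := bsupp_opp bf.
pose F (t x : G) := f t * (f (t + x) * xi (- x + s)).
have sxs := sqi_refl s sx.
have bft t : bsupp (fun x => f (t + x)) by exact: bsupp_shift.
have bxt (x : G) : bsupp (fun t => f t * f (t + x)).
  apply: bsuppM => //; have := bsupp_shift x bf; congr bsupp.
  by apply/funext => t; rewrite addrC.
have i1 t : intb (F t).
  by apply: integrableZR; apply: sqi_mul => //; exact: bsupp_sqi.
have FE t x : F t x = xi (- x + s) * (f t * f (t + x)) by rewrite /F; ring.
have i2 x : intb (F ^~ x).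
  rewrite (_ : _ \o _ = EFin \o (fun t => xi (- x + s) * (f t * f (t + x)))).
    by apply: integrableZR; exact: bsupp_integrable.
  by apply/funext => t /=; rewrite FE.
have mF : measurable_fun setT (fun p : B * B => F p.1 p.2).
  apply: measurable_funM; first exact: (measurableT_comp mf measurable_fst).
  apply: measurable_funM.
    apply: (measurable_pair_cv mf); apply: measurable_addrV.
      exact: measurable_fst.
    exact: measurable_snd.
  have [mxs _] := sxs.
  exact: (measurableT_comp mxs measurable_snd).
have iF : (\int[mu]_t \int[mu]_x `|F t x|%:E < +oo)%E.
  apply: (@le_lt_trans _ _ (\int[mu]_t (`|f t| * (nq f + nq xi))%:E)%E).
    have mA : measb (fun t => \int[mu]_s `|F t s|).
      by apply: (measurable_int_param (F := fun t s => `|F t s|)); exact: measurableT_comp.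
    apply: ge0_le_integral => //.
    - by move=> t _; apply: integral_ge0.
    - under eq_fun do rewrite -(Rintegral_fineK (integrable_normR (i1 _))).
      exact/measurable_EFinP.
    - by apply/measurable_EFinP; apply: measurable_funM => //; exact: measurableT_comp.
    move=> t _; rewrite -(Rintegral_fineK (integrable_normR (i1 t))) lee_fin.
    have st := bsupp_sqi (bft t).
    have nx : nq (fun x => xi (- x + s)) = nq xi.
      rewrite -[RHS](nq_shift s sx) /nq.
      have [_ /Rintegral_opp[_ <-]] := sqi_shift s sx.
      by apply: eq_Rintegral => y _; rewrite addrC.
    rewrite -nx -(nq_shift t (bsupp_sqi bf)) /nq -RintegralD//; last 2 first.
    - by case: st.
    - by case: sxs.
    rewrite -RintegralZl//; last by apply: integrableDR; [case: st|case: sxs].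
    apply: le_Rintegral => //.
    - exact: integrable_normR.
    - by apply: integrableZR; apply: integrableDR; [case: st|case: sxs].
    - move=> x _; rewrite /F normrM ler_wpM2l//; exact: ler_normM_sqi.
  rewrite -Rintegral_fineK ?ltry//.
  rewrite (_ : _ \o _ = EFin \o (fun t => (nq f + nq xi) * `|f t|)).
    by apply: integrableZR; apply: integrable_normR; exact: bsupp_integrable.
  by apply/funext => t /=; rewrite mulrC.
transitivity (\int[mu]_t \int[mu]_x F t x).
  rewrite /cv -(Rintegral_opp (cv_integrable s (bsupp_sqi bo) sh)).2.
  apply: eq_Rintegral => t _; rewrite !opprK RintegralZl//; last first.
    by apply: sqi_mul => //; exact: bsupp_sqi.
  congr (_ * _); rewrite /cv.
  rewrite -(Rintegral_shift hmu t); last first.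
    by have [] := sqi_refl (t + s) sx; move=> mr _; exact: measurable_funM.
  by apply: eq_Rintegral => x _; congr (_ * xi _); rewrite opprD addrACA addNr add0r.
rewrite (@Rintegral_fubini _ _ B B R mu mu F)//.
apply: eq_Rintegral => x _; rewrite /autocorr mulrC -RintegralZl//; last exact: bsupp_integrable.
by apply: eq_Rintegral => t _; rewrite FE.
Qed.

(* The C*-identity turns the operator norm of f into that of its
   autocorrelation, which Young's inequality bounds by an L^1 norm. *)
Lemma nq_cv_autocorr (f xi : G -> R) : bsupp f -> sqi xi ->
  nq (cv f xi) <= n1 (autocorr f) * nq xi.
Proof.
move=> bf sx; have sh := (young bf sx).1; have bo := bsupp_opp bf.
have [mx _] := sx; have [mh _] := sh.
have bK := autocorr_bsupp bf.
have -> : nq (cv f xi) = pair2 xi (cv (autocorr f) xi).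
  transitivity (pair2 xi (cv (fun t => f (- t)) (cv f xi))); last first.
    by apply: eq_Rintegral => s _; rewrite cv_corr.
  have -> : nq (cv f xi) = pair2 (cv f xi) (cv f xi).
    by apply: eq_Rintegral => s _; rewrite expr2.
  rewrite (pair2_cv sh bf sx).2 (pair2_cv sx bo sh).2.
  rewrite -(Rintegral_opp (pair2_cv sx bo sh).1).2.
  apply: eq_Rintegral => t _; rewrite !opprK; congr (_ * _).
  rewrite /pair2 -(Rintegral_shift hmu t); last first.
    by apply: measurable_funM => //; exact: (measurable_comp_shift (- t) mx).
  by apply: eq_Rintegral => s _; rewrite addKr mulrC.
have [iK ->] := pair2_cv sx bK sx.
apply: le_trans (ler_norm _) _; apply: le_trans (le_normr_Rintegral _ _) _ => //.
have iK1 := integrable_normR (bsupp_integrable bK).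
rewrite /n1 -RintegralZr//; apply: le_Rintegral => //.
- exact: integrable_normR.
- rewrite (_ : _ \o _ = EFin \o (fun t => nq xi * `|autocorr f t|)).
    exact: integrableZR.
  by apply/funext => t /=; rewrite mulrC.
move=> t _; rewrite normrM ler_wpM2l//.
rewrite -ler_sqr ?nnegrE ?nq_ge0// real_normK ?num_real//.
apply: le_trans (pair2_CS sx (sqi_shift (- t) sx)) _.
by rewrite nq_shift// expr2.
Qed.

End RealConvolution.

(** * Norm limits in the reduced C*-algebra *)

Section L2Limit.
Context d (T : measurableType d) (R : realType) (mu : {measure set T -> \bar R}).
Local Notation intb f := (mu.-integrable setT (EFin \o f)).

(** A limit superior is measurable and defined at every point, and [fine] sends its infinite values
    to 0. It is the limit wherever [g] converges, which under the hypotheses below is almost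
    everywhere. *)
Definition l2lim (g : nat -> T -> R) : T -> R :=
  fun x => fine (limn_esup (fun k => (g k x)%:E)).

Lemma measurable_l2lim (g : nat -> T -> R) :
  (forall k, measurable_fun setT (g k)) -> measurable_fun setT (l2lim g).
Proof.
move=> mg; apply: measurableT_comp => //.
by apply: measurable_fun_limn_esup => k; exact/measurable_EFinP.
Qed.

Lemma l2limE (g : nat -> T -> R) x : cvgn (g ^~ x) -> l2lim g x = limn (g ^~ x).
Proof.
move=> cg; rewrite /l2lim is_cvg_limn_esupE; first by rewrite EFin_lim.
by apply: (cvgP (limn (g ^~ x))%:E); apply: cvg_EFin => //; exact: nearW.
Qed.

Lemma geo_sum_le (m : nat) : \sum_(i < m) (6 / 7 : R) ^+ i <= 7.
Proof.
suff -> : \sum_(i < m) (6 / 7 : R) ^+ i = 7 * (1 - (6 / 7) ^+ m).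
  have : 0 <= (6 / 7 : R) ^+ m by rewrite exprn_ge0//; lra.
  lra.
elim: m => [|m IH]; first by rewrite big_ord0 expr0; ring.
by rewrite big_ord_recr /= IH exprS; field.
Qed.

Lemma nneseries_le (u : nat -> \bar R) (M : \bar R) : (forall i, (0 <= u i)%E) ->
  (forall m, (\sum_(i < m) u i <= M)%E) -> (\sum_(i <oo) u i <= M)%E.
Proof.
move=> u0 uM; apply: lime_le; first by apply: is_cvg_nneseries.
by apply: nearW => m; rewrite big_mkord.
Qed.

Variables (g : nat -> T -> R) (C N : R).
Hypothesis mg : forall k, measurable_fun setT (g k).
Hypothesis C0 : 0 <= C.
Hypothesis N0 : 0 <= N.
Hypothesis gd : forall k,
  (\int[mu]_x ((g k.+1 x - g k x) ^+ 2)%:E <= (C * (3 / 4) ^+ k * N)%:E)%E.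

Let dd k x := g k.+1 x - g k x.

(** Cauchy-Schwarz for the telescoping sum with weights (7/8)^i, whose sum is at most 8. The ratio
    8/7 keeps (8/7)(3/4) = 6/7 below 1, so that the weighted sum stays integrable. *)
Let step k j x : (g (k + j)%N x - g k x) ^+ 2 <=
  8 * \sum_(i < j) (8 / 7) ^+ i * dd (k + i) x ^+ 2.
Proof.
elim: j k => [|j IH] k; first by rewrite addn0 subrr big_ord0 expr0n mulr0.
rewrite big_ord_recl /= expr0 mul1r addn0.
under eq_bigr do rewrite /bump /= add1n exprS -mulrA addnS -addSn.
rewrite -mulr_sumr addnS -addSn.
have := IH k.+1; rewrite /dd.
set S := \sum_(_ < _) _; set a := g _ x; set b := g k.+1 x; set c := g k x => h.
(* This square is 7 times the defect in (p + q)^2 <= 8 q^2 + (8/7) p^2 with p = a - b and q = b -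
   c. *)
have : 0 <= (7 * (b - c) - (a - b)) ^+ 2 by exact: sqr_ge0.
nra.
Qed.

Let W k x : \bar R := (\sum_(i <oo) ((8 / 7) ^+ i * dd (k + i)%N x ^+ 2)%:E)%E.

Let w0 k i x : 0 <= (8 / 7) ^+ i * dd (k + i)%N x ^+ 2.
Proof. by rewrite mulr_ge0 ?sqr_ge0// exprn_ge0//; lra. Qed.

Let mw k i : measurable_fun setT (fun x => ((8 / 7) ^+ i * dd (k + i)%N x ^+ 2)%:E).
Proof.
apply/measurable_EFinP; apply: measurable_funM => //.
by apply: measurable_funX; exact: measurable_funB.
Qed.

Let mW k : measurable_fun setT (W k).
Proof. by apply: ge0_emeasurable_sum => // i x _; rewrite lee_fin. Qed.

Let W0 k x : (0 <= W k x)%E.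
Proof. by apply: nneseries_ge0 => i _ _; rewrite lee_fin. Qed.

Let IW k : (\int[mu]_x W k x <= (7 * C * (3 / 4) ^+ k * N)%:E)%E.
Proof.
rewrite integral_nneseries//; last by move=> i x _; rewrite lee_fin.
apply: nneseries_le => [i|m]; first by apply: integral_ge0 => x _; rewrite lee_fin.
apply: (@le_trans _ _ (\sum_(i < m) (C * (3 / 4) ^+ k * N * (6 / 7) ^+ i)%:E)%E).
  apply: lee_sum => i _; under eq_integral do rewrite EFinM.
  rewrite ge0_integralZl_EFin//; last 2 first.
  - by move=> x _; rewrite lee_fin sqr_ge0.
  - by apply/measurable_EFinP; apply: measurable_funX; exact: measurable_funB.
  apply: (@le_trans _ _ (((8 / 7) ^+ i)%:E * (C * (3 / 4) ^+ (k + i) * N)%:E)%E).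
    by apply: lee_wpmul2l; [rewrite lee_fin exprn_ge0//; lra|exact: gd].
  rewrite -EFinM lee_fin exprD.
  rewrite (_ : 6 / 7 = (8 / 7) * (3 / 4) :> R); last by field.
  by rewrite [X in _ <= _ * X]exprMn le_eqVlt; apply/orP; left; apply/eqP; ring.
rewrite sumEFin lee_fin -mulr_sumr.
have := geo_sum_le m; have : 0 <= C * (3 / 4) ^+ k * N.
  by rewrite !mulr_ge0// exprn_ge0//; lra.
set S := \sum_(_ < _) _; set K := C * _ * _ => K0 S7.
rewrite (_ : 7 * C * (3 / 4) ^+ k * N = K * 7); last by rewrite /K; ring.
by rewrite ler_wpM2l.
Qed.

Let Wsum k j x : ((\sum_(i < j) (8 / 7) ^+ i * dd (k + i) x ^+ 2)%:E <= W k x)%E.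
Proof.
rewrite -sumEFin -(big_mkord xpredT (fun i => ((8 / 7) ^+ i * dd (k + i) x ^+ 2)%:E)).
by apply: nneseries_lim_ge => i _ _; rewrite lee_fin.
Qed.

Let cvg_g x : (W 0 x < +oo)%E -> cvgn (g ^~ x).
Proof.
move=> Woo.
have sd : cvgn (series (dd ^~ x)).
  apply: normed_cvg; apply: nondecreasing_is_cvgn.
    apply/nondecreasing_seqP => k.
    by rewrite /normed_series_of /series /= big_nat_recr//= lerDl.
  (* Each |d_i| is at most (7/8)^i + (8/7)^i d_i^2; the first parts sum to at most 8, well below 7 *
     8, and the second to at most [W 0 x]. *)
  exists (7 * 8 + fine (W 0 x)) => _ [m _ <-].
  rewrite /normed_series_of /series /= big_mkord.
  apply: (@le_trans _ _ (\sum_(i < m) ((7 / 8) ^+ i + (8 / 7) ^+ i * dd (0 + i)%N x ^+ 2))).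
    apply: ler_sum => i _; rewrite add0n.
    have e0 : 0 < (7 / 8 : R) ^+ i by rewrite exprn_gt0//; lra.
    have -> : (8 / 7 : R) ^+ i = ((7 / 8) ^+ i)^-1 by rewrite -exprVn; congr (_ ^+ _); field.
    rewrite -[X in _ + _ * X]real_normK ?num_real//.
    set e := (7 / 8) ^+ i in e0 *; set D := `|dd i x|.
    have D0 : 0 <= D by exact: normr_ge0.
    rewrite -subr_ge0 (_ : _ - D = ((e - D / 2) ^+ 2 + 3 / 4 * D ^+ 2) / e); last first.
      by field; rewrite gt_eqF.
    by rewrite divr_ge0 ?(ltW e0)// addr_ge0 ?sqr_ge0// mulr_ge0 ?sqr_ge0//; lra.
  rewrite big_split lerD//=.
    have -> : \sum_(i < m) (7 / 8 : R) ^+ i = 8 * (1 - (7 / 8) ^+ m).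
      elim: m => [|m IH]; first by rewrite big_ord0 expr0; ring.
      by rewrite big_ord_recr /= IH exprS; field.
    have : 0 <= (7 / 8 : R) ^+ m by rewrite exprn_ge0//; lra.
    lra.
  rewrite -lee_fin fineK; first exact: Wsum.
  by rewrite ge0_fin_numE.
have -> : g ^~ x = fun k => series (dd ^~ x) k + g 0%N x.
  apply/funext => k; rewrite /series /= telescope_sumr//.
  by rewrite subrK.
by apply: is_cvgD => //; exact: is_cvg_cst.
Qed.

Lemma l2lim_cvg_ae : {ae mu, forall x, cvgn (g ^~ x)}.
Proof.
have iW : mu.-integrable setT (W 0).
  apply/integrableP; split => //.
  under eq_integral do rewrite gee0_abs//.
  by apply: le_lt_trans (IW 0) _; exact: ltry.
apply: filterS (integrable_ae measurableT iW) => x /(_ I) fx.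
by apply: cvg_g; rewrite ltey_eq fx.
Qed.

(** The constant 56 is 8 from [step] times 7 from the geometric series of ratio 6/7. The pointwise
    inequality passes to the limit where [g] converges and is void where [W k x] is infinite. *)
Lemma l2lim_dist k : intb (fun x => (l2lim g x - g k x) ^+ 2) /\
  \int[mu]_x ((l2lim g x - g k x) ^+ 2) <= 56 * C * (3 / 4) ^+ k * N.
Proof.
have ml := measurable_l2lim mg.
have mlg : measurable_fun setT (fun x => (l2lim g x - g k x) ^+ 2).
  by apply: measurable_funX; exact: measurable_funB.
have b : (\int[mu]_x ((l2lim g x - g k x) ^+ 2)%:E <= (56 * C * (3 / 4) ^+ k * N)%:E)%E.
  apply: (@le_trans _ _ (\int[mu]_x (8%:E * W k x))%E); last first.
    rewrite ge0_integralZl_EFin//.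
    rewrite (_ : 56 * C * (3 / 4) ^+ k * N = 8 * (7 * C * (3 / 4) ^+ k * N)); last by ring.
    rewrite EFinM; apply: lee_wpmul2l; [by rewrite lee_fin|exact: IW].
  apply: ae_ge0_le_integral => //.
  - by move=> x _; rewrite lee_fin sqr_ge0.
  - exact/measurable_EFinP.
  - by move=> x _; apply: mule_ge0.
  - exact: measurable_funeM.
  apply: filterS l2lim_cvg_ae => x cx _.
  have [->|Wf] := eqVneq (W k x) +oo%E; first by rewrite gt0_muley ?leey// lte_fin.
  have {}Wf : W k x \is a fin_num by rewrite ge0_fin_numE// ltey.
  rewrite -(fineK Wf) -EFinM lee_fin l2limE//.
  have cc : (fun m => (g m x - g k x) ^+ 2) @ \oo --> (limn (g ^~ x) - g k x) ^+ 2.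
    apply: (@cvg_comp _ _ _ (fun m => g m x - g k x) (fun z => z ^+ 2)); last first.
      exact: exprn_continuous.
    by apply: cvgB => //; exact: cvg_cst.
  apply: (@cvgr_to_le _ _ _ _ _ _ _ cc).
  near=> m.
  have km : (k <= m)%N by near: m; exact: nbhs_infty_ge.
  rewrite -(subnKC km); apply: le_trans (step _ _ _) _.
  rewrite ler_pM2l// -lee_fin fineK//; exact: Wsum.
have il : intb (fun x => (l2lim g x - g k x) ^+ 2).
  apply: ge0_integrableR => //; first by move=> x; exact: sqr_ge0.
  exact: le_lt_trans b (ltry _).
by split=> //; rewrite -lee_fin Rintegral_fineK.
Unshelve. all: by end_near.
Qed.

End L2Limit.

Local Notation cRe := complex.Re.
Local Notation cIm := complex.Im.

Section ComplexParts.
Context {R : realType}.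
Implicit Types x y : R[i].

Lemma ReM_conj x y : cRe (x * y^*) = cRe x * cRe y + cIm x * cIm y.
Proof. by case: x y => a b [c d] /=; rewrite mulrN opprK. Qed.

Lemma ImM_conj x y : cIm (x * y^*) = cIm x * cRe y - cRe x * cIm y.
Proof. by case: x y => a b [c d] /=; rewrite mulrN addrC. Qed.

Lemma Re_norm x : cRe `|x| = Num.sqrt (cRe x ^+ 2 + cIm x ^+ 2).
Proof. by rewrite normc_def. Qed.

Lemma ReM_real (a : R) x : cRe (a%:C%C * x) = a * cRe x.
Proof. by case: x => c d /=; rewrite mul0r subr0. Qed.

Lemma ImM_real (a : R) x : cIm (a%:C%C * x) = a * cIm x.
Proof. by case: x => c d /=; rewrite mul0r addr0. Qed.

Lemma ReM x y : cRe (x * y) = cRe x * cRe y - cIm x * cIm y.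
Proof. by case: x y => a b [c d]. Qed.

Lemma ImM x y : cIm (x * y) = cRe x * cIm y + cIm x * cRe y.
Proof. by case: x y => a b [c d]. Qed.

Lemma ReD x y : cRe (x + y) = cRe x + cRe y.
Proof. by case: x y => a b [c d]. Qed.

Lemma ImD x y : cIm (x + y) = cIm x + cIm y.
Proof. by case: x y => a b [c d]. Qed.

Lemma ReB x y : cRe (x - y) = cRe x - cRe y.
Proof. by case: x y => a b [c d]. Qed.

Lemma ImB x y : cIm (x - y) = cIm x - cIm y.
Proof. by case: x y => a b [c d]. Qed.

Lemma complex_eq x y : cRe x = cRe y -> cIm x = cIm y -> x = y.
Proof. by case: x y => a b [c d] /= -> ->. Qed.

End ComplexParts.

Section ComplexL2.
Context {R : realType} {n : nat}.
Local Notation G := 'rV[R]_n.+1.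
Local Notation B := (borel_rV R n.+1).
Local Notation C := R[i].
Variable mu : {sigma_finite_measure set B -> \bar R}.
Hypothesis hmu : haar_measure mu.
Local Notation intb f := (mu.-integrable setT (EFin \o (f : B -> R))).
Local Notation measb f := (measurable_fun (setT : set B) (f : B -> R)).
Local Notation L2 := (Lp mu 2%:E).
Local Notation norm2 := (CLnorm mu 2%:E).
Implicit Types xi eta : G -> C.

Definition rp xi : G -> R := fun x => cRe (xi x).
Definition ip xi : G -> R := fun x => cIm (xi x).

Lemma norm2_int xi :
  norm2 xi = sqrte (\int[mu]_x ((rp xi x ^+ 2 + ip xi x ^+ 2)%:E))%E.
Proof.
rewrite /CLnorm unlock poweR12_sqrt; last by apply: integral_ge0 => x _; exact: poweR_ge0.
congr sqrte; apply: eq_integral => x _.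
rewrite abse_EFin poweR_EFin Re_norm ger0_norm ?sqrtr_ge0//.
by rewrite powR_mulrn ?sqrtr_ge0// sqr_sqrtr// addr_ge0 ?sqr_ge0.
Qed.

Lemma L2P xi : L2 xi <-> sqi mu (rp xi) /\ sqi mu (ip xi).
Proof.
split=> [[[mr mi]]|[[mr r2] [mi i2]]].
  rewrite norm2_int => h.
  have m2 : measb (fun x => rp xi x ^+ 2 + ip xi x ^+ 2).
    by apply: measurable_funD; apply: measurable_funX.
  have i2 : intb (fun x => rp xi x ^+ 2 + ip xi x ^+ 2).
    apply: ge0_integrableR => //; first by move=> x; rewrite addr_ge0 ?sqr_ge0.
    by rewrite ltNge leye_eq; apply/negP => /eqP e; move: h; rewrite e.
  split; split => //.
    apply: (@le_intb _ _ _ _ (fun x => rp xi x ^+ 2 + ip xi x ^+ 2)) => //.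
      exact: measurable_funX.
    by move=> x; rewrite ger0_norm ?sqr_ge0// lerDl sqr_ge0.
  apply: (@le_intb _ _ _ _ (fun x => rp xi x ^+ 2 + ip xi x ^+ 2)) => //.
    exact: measurable_funX.
  by move=> x; rewrite ger0_norm ?sqr_ge0// lerDr sqr_ge0.
split; first by split.
rewrite norm2_int -Rintegral_fineK ?ltry//.
exact: integrableDR.
Qed.

Definition cnq xi : R := nq mu (rp xi) + nq mu (ip xi).

Lemma cnq_ge0 xi : 0 <= cnq xi.
Proof. by rewrite addr_ge0 ?nq_ge0. Qed.

Lemma norm2E xi : L2 xi -> norm2 xi = (Num.sqrt (cnq xi))%:E.
Proof.
move=> /L2P[[_ r2] [_ i2]]; rewrite norm2_int -Rintegral_fineK; last exact: integrableDR.
by rewrite RintegralD.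
Qed.

Lemma L2_shift x xi : L2 xi -> L2 (fun s => xi (x + s)).
Proof.
move=> /L2P[r i]; apply/L2P; split.
  exact: (sqi_shift hmu x r).
exact: (sqi_shift hmu x i).
Qed.

Lemma Re_inner xi eta : L2 xi -> L2 eta ->
  cRe (inner mu xi eta) = pair2 mu (rp xi) (rp eta) + pair2 mu (ip xi) (ip eta).
Proof.
move=> /L2P[xr xi'] /L2P[er ei]; rewrite /inner /Cintegral /= /pair2 -RintegralD//.
- by apply: eq_Rintegral => x _; rewrite ReM_conj.
- exact: sqi_mul.
- exact: sqi_mul.
Qed.

Lemma Im_inner xi eta : L2 xi -> L2 eta ->
  cIm (inner mu xi eta) = pair2 mu (ip xi) (rp eta) - pair2 mu (rp xi) (ip eta).
Proof.
move=> /L2P[xr xi'] /L2P[er ei]; rewrite /inner /Cintegral /= /pair2 -RintegralB//.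
- by apply: eq_Rintegral => x _; rewrite ImM_conj.
- exact: sqi_mul.
- exact: sqi_mul.
Qed.

Definition cplx (f : G -> R) : G -> C := fun x => (f x)%:C%C.

(** A real convolver acts on real and imaginary parts separately, which reduces the analysis of
    complex functions to [cv] on real ones. *)
Lemma rp_conv (f : G -> R) xi s :
  rp (convolution mu (cplx f) xi) s = cv mu f (rp xi) s.
Proof. by apply: eq_Rintegral => t _; rewrite ReM_real. Qed.

Lemma ip_conv (f : G -> R) xi s :
  ip (convolution mu (cplx f) xi) s = cv mu f (ip xi) s.
Proof. by apply: eq_Rintegral => t _; rewrite ImM_real. Qed.

Lemma bsupp_L1 (f : G -> R) : bsupp f -> Lp mu 1%:E (cplx f).
Proof.
move=> bf; have [mf _ _] := bf; split.
  by split; [exact: mf|exact: measurable_cst].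
rewrite /CLnorm Lnorm1.
under eq_integral => x _.
  rewrite abse_EFin Re_norm /= expr0n addr0 sqrtr_sqr normr_id; over.
rewrite -(Rintegral_fineK (integrable_normR (bsupp_integrable hmu bf))).
exact: ltry.
Qed.

Lemma L2_conv (f : G -> R) xi : bsupp f -> L2 xi -> L2 (convolution mu (cplx f) xi).
Proof.
move=> bf /L2P[r i]; apply/L2P.
rewrite (_ : rp _ = cv mu f (rp xi)); last by apply/funext => s; rewrite rp_conv.
rewrite (_ : ip _ = cv mu f (ip xi)); last by apply/funext => s; rewrite ip_conv.
by split; [exact: (young hmu bf r).1|exact: (young hmu bf i).1].
Qed.

Lemma pair2C f g : pair2 mu f g = pair2 mu g f.
Proof. by apply: eq_Rintegral => x _; rewrite mulrC. Qed.

(** It shows that the pairing with lambda(f) depends on [xi] and [eta] only through their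
    coefficient function; [inner_pf_cvg] carries this over to the limit operator. *)
Lemma inner_conv (f : G -> R) xi eta : bsupp f -> L2 xi -> L2 eta ->
  cRe (inner mu (convolution mu (cplx f) xi) eta) =
    \int[mu]_t (f t * cRe (coefficient mu xi eta t)) /\
  cIm (inner mu (convolution mu (cplx f) xi) eta) =
    \int[mu]_t (f t * cIm (coefficient mu xi eta t)).
Proof.
move=> bf hx he; have hc := L2_conv bf hx; have [xr xim] := (L2P _).1 hx.
have [er ei] := (L2P _).1 he.
have [rr1 rr2] := pair2_cv hmu er bf xr; have [ii1 ii2] := pair2_cv hmu ei bf xim.
have [ri1 ri2] := pair2_cv hmu er bf xim; have [ir1 ir2] := pair2_cv hmu ei bf xr.
have Er : rp (convolution mu (cplx f) xi) = cv mu f (rp xi).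
  by apply/funext => s; rewrite rp_conv.
have Ei : ip (convolution mu (cplx f) xi) = cv mu f (ip xi).
  by apply/funext => s; rewrite ip_conv.
rewrite (Re_inner hc he).
rewrite (Im_inner hc he).
rewrite Er Ei.
rewrite (pair2C (cv mu f (rp xi)) (rp eta)) rr2.
rewrite (pair2C (cv mu f (ip xi)) (ip eta)) ii2.
rewrite (pair2C (cv mu f (ip xi)) (rp eta)) ri2.
rewrite (pair2C (cv mu f (rp xi)) (ip eta)) ir2.
split; [rewrite -(RintegralD measurableT rr1 ii1)|rewrite -(RintegralB measurableT ri1 ir1)];
  apply: eq_Rintegral => t _; rewrite /coefficient.
  rewrite (Re_inner (L2_shift (- t) hx) he).
  by rewrite mulrDr; congr (_ * _ + _ * _); rewrite pair2C.
rewrite (Im_inner (L2_shift (- t) hx) he).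
by rewrite mulrBr; congr (_ * _ - _ * _); rewrite pair2C.
Qed.

Lemma inner_bound xi eta : L2 xi -> L2 eta ->
  `|cRe (inner mu xi eta)| <= 2 * (Num.sqrt (cnq xi) * Num.sqrt (cnq eta)) /\
  `|cIm (inner mu xi eta)| <= 2 * (Num.sqrt (cnq xi) * Num.sqrt (cnq eta)).
Proof.
move=> hx he; have [xr xim] := (L2P _).1 hx; have [er ei] := (L2P _).1 he.
have P f g : sqi mu f -> sqi mu g -> nq mu f <= cnq xi -> nq mu g <= cnq eta ->
    `|pair2 mu f g| <= Num.sqrt (cnq xi) * Num.sqrt (cnq eta).
  move=> sf sg lf lg; rewrite -sqrtrM ?cnq_ge0//.
  rewrite -sqrtr_sqr ler_wsqrtr//; apply: le_trans (pair2_CS sf sg) _.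
  by rewrite ler_pM// nq_ge0.
rewrite (Re_inner hx he) (Im_inner hx he).
have a : nq mu (rp xi) <= cnq xi by rewrite lerDl nq_ge0.
have b : nq mu (ip xi) <= cnq xi by rewrite lerDr nq_ge0.
have c : nq mu (rp eta) <= cnq eta by rewrite lerDl nq_ge0.
have d : nq mu (ip eta) <= cnq eta by rewrite lerDr nq_ge0.
split.
  apply: le_trans (ler_normD _ _) _; rewrite mulr_natl mulr2n.
  by rewrite lerD ?P.
apply: le_trans (ler_normB _ _) _; rewrite mulr_natl mulr2n.
by rewrite lerD ?P.
Qed.

End ComplexL2.

Lemma cvgn_comb {R : realType} (a b : R) (U V W : nat -> R) :
  cvgn U -> cvgn V -> cvgn W ->
  (fun k => a * U k + b * V k + W k) @ \oo --> a * limn U + b * limn V + limn W.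
Proof. by move=> cU cV cW; apply: cvgD => //; apply: cvgD; apply: cvgM => //; exact: cvg_cst. Qed.

Lemma ae_imp4 d (T : measurableType d) (R : realType) (mu : {measure set T -> \bar R})
  (P1 P2 P3 P4 Q : T -> Prop) :
  (forall x, P1 x -> P2 x -> P3 x -> P4 x -> Q x) ->
  {ae mu, forall x, P1 x} -> {ae mu, forall x, P2 x} -> {ae mu, forall x, P3 x} ->
  {ae mu, forall x, P4 x} -> {ae mu, forall x, Q x}.
Proof.
move=> h h1 h2 h3 h4; apply: filterS2 (filterI h1 h2) (filterI h3 h4).
by move=> x [p1 p2] [p3 p4]; exact: h.
Qed.

Lemma eq_cvg_tail {R : realType} (u v : nat -> R) (a b : R) (k0 : nat) :
  u @ \oo --> a -> v @ \oo --> b -> (forall k, (k0 <= k)%N -> u k = v k) -> a = b.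
Proof.
move=> ua vb uv; apply: (cvg_unique _ ua) => //; apply: cvg_trans vb.
by apply: near_eq_cvg; exists k0 => // k /= kk; rewrite uv.
Qed.

Section EuclideanNorm.
Context {R : realType} {n : nat}.
Local Notation G := 'rV[R]_n.+1.

Definition qf (y : G) : R := \sum_(i < n.+1) y ord0 i ^+ 2 - 1.

Lemma qfE (y : G) : euclidean_norm y ^+ 2 - 1 = qf y.
Proof. by rewrite /euclidean_norm sqr_sqrtr// sumr_ge0// => i _; exact: sqr_ge0. Qed.

Lemma continuous_qf : continuous (qf : G -> R).
Proof.
suff H (y : G) : (fun y : G => \sum_(i < n.+1) y ord0 i ^+ 2) @ y --> \sum_(i < n.+1) y ord0 i ^+ 2.
  move=> y; exact: (cvgB (H y) (@cst_continuous _ _ (1 : R) y)).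
elim: (index_enum _) => [|i s IH].
  rewrite (_ : (fun y : G => _) = (fun=> 0)); first by rewrite big_nil; exact: (@cst_continuous G R 0 y).
  by apply/funext => z; rewrite big_nil.
have c : {for y, continuous (fun z : G => z ord0 i)} by exact: coord_continuous.
have FF := nbhs_filter y; have H := cvgD (cvgM c c) IH.
rewrite (_ : (fun y : G => _) = (fun z : G => z ord0 i * z ord0 i + \sum_(j <- s) z ord0 j ^+ 2)).
  by rewrite big_cons expr2; exact: H.
by apply/funext => z; rewrite big_cons expr2.
Qed.

(** On a compact set |qf| attains its minimum, which is positive off the sphere; half of it makes
    the inequality strict. The gap separates the support of a function vanishing near the sphere
    from those of late [f k]. *)
Lemma compact_gap (A : set G) : compact A -> A `&` @unit_sphere R n.+1 = set0 ->
  exists2 e : R, 0 < e & forall y, A y -> e < `|qf y|.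
Proof.
move=> cA AE; have [A0|/set0P A0] := eqVneq A set0.
  by exists 1 => // y; rewrite A0.
have cn : continuous (fun y : G => `|qf y|).
  move=> y; apply: (@continuous_comp _ _ _ (qf : G -> R) (fun z : R => `|z|)).
    exact: continuous_qf.
  exact: (@norm_continuous _ R).
have [|c /set_mem Ac cmin] := @compact_EVT_min _ _ (fun y : G => `|qf y|) _ A0 cA.
  exact: continuous_subspaceT.
have qc : 0 < `|qf c|.
  rewrite normr_gt0; apply/eqP => q0.
  have : (A `&` @unit_sphere R n.+1) c.
    split=> //; rewrite /unit_sphere /=.
    have := qfE c; rewrite q0 => /eqP; rewrite subr_eq0 sqrf_eq1 => /orP[/eqP//|/eqP h].
    by have := sqrtr_ge0 (\sum_(i < n.+1) c 0 i ^+ 2); rewrite -/(euclidean_norm c) h; lra.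
  by rewrite AE.
exists (`|qf c| / 2); first by rewrite divr_gt0.
move=> y Ay; apply: lt_le_trans (cmin y _); last exact: mem_set.
lra.
Qed.

End EuclideanNorm.

(** * The limit operator and its pairing with coefficient functions *)

Section Pseudofunction.
Context {R : realType} {n : nat}.
Local Notation G := 'rV[R]_n.+1.
Local Notation B := (borel_rV R n.+1).
Local Notation C := R[i].
Variable mu : {sigma_finite_measure set B -> \bar R}.
Hypothesis hmu : haar_measure mu.
Local Notation L2 := (Lp mu 2%:E).
Local Notation norm2 := (CLnorm mu 2%:E).
Variables (f : nat -> G -> R) (K : R).
Hypothesis bf : forall k, bsupp (f k).
Hypothesis fK : forall k,
  n1 mu (autocorr mu (fun y => f k.+1 y - f k y)) <= K * (3 / 4) ^+ k.

Let K0 : 0 <= K.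
Proof. by have := fK 0; rewrite expr0 mulr1; apply: le_trans; apply: Rintegral_ge0. Qed.

Definition pf_real (xi : G -> R) : G -> R :=
  @l2lim _ B R (fun k => cv mu (f k) xi).

Definition pf (xi : G -> C) : G -> C :=
  fun s => Complex (pf_real (rp xi) s) (pf_real (ip xi) s).

Lemma cvBl (g h : G -> R) (xi : G -> R) s : bsupp g -> bsupp h -> sqi mu xi ->
  cv mu (fun y => g y - h y) xi s = cv mu g xi s - cv mu h xi s.
Proof.
move=> bg bh sx; rewrite /cv -RintegralB//; last 2 first.
- by apply: (cv_integrable hmu s _ sx); exact: bsupp_sqi.
- by apply: (cv_integrable hmu s _ sx); exact: bsupp_sqi.
by apply: eq_Rintegral => t _; rewrite mulrBl.
Qed.

Lemma cvDr (g : G -> R) (xi eta : G -> R) a b s : bsupp g -> sqi mu xi -> sqi mu eta ->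
  cv mu g (fun y => a * xi y + b * eta y) s = a * cv mu g xi s + b * cv mu g eta s.
Proof.
move=> bg sx se.
have ix := cv_integrable hmu s (bsupp_sqi hmu bg) sx.
have ie := cv_integrable hmu s (bsupp_sqi hmu bg) se.
rewrite /cv -(RintegralZl a measurableT ix) -(RintegralZl b measurableT ie).
rewrite -RintegralD//; last 2 first.
- exact: (integrableZR a ix).
- exact: (integrableZR b ie).
by apply: eq_Rintegral => t _; ring.
Qed.

Lemma pf_step (xi : G -> R) k : sqi mu xi ->
  (\int[mu]_x ((cv mu (f k.+1) xi x - cv mu (f k) xi x) ^+ 2)%:E
     <= (K * (3 / 4) ^+ k * nq mu xi)%:E)%E.
Proof.
move=> sx; have bd := bsuppB (bf k.+1) (bf k).
have [[md id] _] := young hmu bd sx.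
under eq_integral do rewrite -cvBl//.
rewrite -(Rintegral_fineK id) lee_fin.
by apply: le_trans (nq_cv_autocorr hmu bd sx) _; rewrite ler_wpM2r ?nq_ge0.
Qed.

Let mcv (xi : G -> R) : sqi mu xi -> forall k, measurable_fun (setT : set B) (cv mu (f k) xi : B -> R).
Proof. by move=> sx k; have [[]] := young hmu (bf k) sx. Qed.

Lemma pf_dist (xi : G -> R) k : sqi mu xi ->
  sqi mu (fun x => pf_real xi x - cv mu (f k) xi x) /\
  nq mu (fun x => pf_real xi x - cv mu (f k) xi x) <= 56 * K * (3 / 4) ^+ k * nq mu xi.
Proof.
move=> sx.
have [i d] := l2lim_dist (mcv sx) K0 (nq_ge0 mu xi) (fun k => pf_step k sx) k.
split=> //; split=> //; apply: measurable_funB; last exact: mcv.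
exact: (measurable_l2lim (mcv sx)).
Qed.

Lemma pf_cvg_ae (xi : G -> R) : sqi mu xi ->
  {ae mu, forall x : B, cvgn (fun k => cv mu (f k) xi x)}.
Proof.
by move=> sx; exact: (l2lim_cvg_ae (mcv sx) K0 (nq_ge0 mu xi) (fun k => pf_step k sx)).
Qed.

Lemma pf_sqi (xi : G -> R) : sqi mu xi -> sqi mu (pf_real xi).
Proof.
move=> sx; have [s0 _] := pf_dist 0 sx; have [s1 _] := young hmu (bf 0) sx.
have := sqiD s0 s1; congr (sqi mu _).
by apply/funext => x; rewrite subrK.
Qed.

Lemma pf_L2 (xi : G -> C) : L2 xi -> L2 (pf xi).
Proof. by move=> /L2P[r i]; apply/L2P; split; exact: pf_sqi. Qed.

Lemma pf_conv_dist (xi : G -> C) k : L2 xi ->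
  L2 (fun x => pf xi x - convolution mu (cplx (f k)) xi x) /\
  cnq mu (fun x => pf xi x - convolution mu (cplx (f k)) xi x)
    <= 56 * K * (3 / 4) ^+ k * cnq mu xi.
Proof.
move=> /[dup] hx /L2P[r i].
have Er : rp (fun x => pf xi x - convolution mu (cplx (f k)) xi x) =
    fun x => pf_real (rp xi) x - cv mu (f k) (rp xi) x.
  by apply/funext => x; rewrite /rp ReB -rp_conv.
have Ei : ip (fun x => pf xi x - convolution mu (cplx (f k)) xi x) =
    fun x => pf_real (ip xi) x - cv mu (f k) (ip xi) x.
  by apply/funext => x; rewrite /ip ImB -ip_conv.
have [sr br] := pf_dist k r; have [si bi] := pf_dist k i.
split; first by apply/L2P; rewrite Er Ei.
by rewrite /cnq Er Ei mulrDr lerD.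
Qed.

Lemma ratio_cvg0 (e : R) : 0 < e -> exists k, 56 * K * (3 / 4) ^+ k <= e.
Proof.
move=> e0.
have : (fun k => 56 * K * (3 / 4) ^+ k) @ \oo --> 56 * K * 0.
  apply: cvgM; first exact: cvg_cst.
  by apply: cvg_expr; rewrite ger0_norm; lra.
rewrite mulr0 => /cvgr0Pnorm_le /(_ _ e0)[k _ /(_ k (leqnn _))].
by move=> h; exists k; apply: le_trans h; exact: ler_norm.
Qed.

Lemma pf_bounded : exists2 M : R, 0 <= M &
  forall xi, L2 xi -> cnq mu (pf xi) <= M ^+ 2 * cnq mu xi.
Proof.
(* From a^2 <= 2 (a - b)^2 + 2 b^2, with a the limit and b the term of index 0: [pf_dist] bounds the
   difference and Young's inequality the term. *)
pose M2 := 2 * (56 * K) + 2 * n1 mu (f 0) ^+ 2.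
have M20 : 0 <= M2 by rewrite /M2; have := sqr_ge0 (n1 mu (f 0)); have := K0; lra.
exists (Num.sqrt M2); first exact: sqrtr_ge0.
have P (xi : G -> R) : sqi mu xi -> nq mu (pf_real xi) <= M2 * nq mu xi.
  move=> sx; have [s0 d0] := pf_dist 0 sx; have [s1 d1] := young hmu (bf 0) sx.
  have [_ i0] := s0; have [_ i1] := s1; have [_ ip] := pf_sqi sx.
  apply: (@le_trans _ _ (2 * nq mu (fun x => pf_real xi x - cv mu (f 0) xi x) +
       2 * nq mu (cv mu (f 0) xi))).
    rewrite /nq -(RintegralZl 2 measurableT i0) -(RintegralZl 2 measurableT i1).
    rewrite -RintegralD//; last 2 first.
    - exact: (integrableZR 2 i0).
    - exact: (integrableZR 2 i1).
    apply: le_Rintegral => //.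
      by apply: integrableDR; exact: integrableZR.
    move=> x _; set a := pf_real xi x; set b := cv _ _ _ _.
    have := sqr_ge0 (a - 2 * b); nra.
  have nn := nq_ge0 mu xi.
  move: d0 d1; rewrite expr0 mulr1 /M2 => d0 d1.
  set u := nq mu (fun x => _) in d0 *; set v := nq mu (cv _ _ _) in d1 *.
  have : 2 * u <= 2 * (56 * K * nq mu xi) by rewrite ler_pM2l.
  have : 2 * v <= 2 * (n1 mu (f 0) ^+ 2 * nq mu xi) by rewrite ler_pM2l.
  lra.
move=> xi /L2P[r i]; rewrite sqr_sqrtr// /cnq mulrDr.
by rewrite lerD//; exact: P.
Qed.

Lemma norm2_le (xi eta : G -> C) (M : R) : 0 <= M -> L2 xi -> L2 eta ->
  cnq mu xi <= M ^+ 2 * cnq mu eta -> (norm2 xi <= M%:E * norm2 eta)%E.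
Proof.
move=> M0 hx he h; rewrite (norm2E hx) (norm2E he) -EFinM lee_fin.
rewrite -[X in X * _](ger0_norm M0) -sqrtr_sqr -sqrtrM ?sqr_ge0//.
by rewrite ler_wsqrtr.
Qed.

Lemma pf_realE (xi : G -> R) (x : G) : cvgn (fun k => cv mu (f k) xi x) ->
  pf_real xi x = limn (fun k => cv mu (f k) xi x).
Proof. exact: l2limE. Qed.

Lemma pf_real_comb (u v w : G -> R) (a b : R) (x : G) :
  sqi mu u -> sqi mu v -> sqi mu w ->
  cvgn (fun k => cv mu (f k) u x) -> cvgn (fun k => cv mu (f k) v x) ->
  cvgn (fun k => cv mu (f k) w x) ->
  pf_real (fun y => a * u y + b * v y + w y) x =
    a * pf_real u x + b * pf_real v x + pf_real w x.
Proof.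
move=> su sv sw cu cv' cw.
have suv : sqi mu (fun y => a * u y + b * v y) by apply: sqiD; exact: sqiZ.
have E k : cv mu (f k) (fun y => a * u y + b * v y + w y) x =
    a * cv mu (f k) u x + b * cv mu (f k) v x + cv mu (f k) w x.
  rewrite -(cvDr a b x (bf k) su sv).
  rewrite -[in RHS](mul1r (cv mu (f k) w x)) -[in RHS](mul1r (cv mu (f k) (fun y => _) x)).
  rewrite -(cvDr 1 1 x (bf k) suv sw).
  by congr (cv mu (f k) _ x); apply/funext => y; rewrite !mul1r.
have cE : (fun k => cv mu (f k) (fun y => a * u y + b * v y + w y) x) @ \oo -->
    a * limn (fun k => cv mu (f k) u x) + b * limn (fun k => cv mu (f k) v x)
      + limn (fun k => cv mu (f k) w x).
  rewrite (_ : (fun k => cv mu (f k) _ x) = fun k => a * cv mu (f k) u x +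
      b * cv mu (f k) v x + cv mu (f k) w x); last exact/funext.
  exact: (cvgn_comb cu cv' cw).
rewrite (pf_realE (cvgP _ cE)) (pf_realE cu) (pf_realE cv') (pf_realE cw).
exact: (cvg_lim _ cE).
Qed.

(** A limit superior is not additive, so linearity is proved where the four real sequences attached
    to [xi] and [eta] converge, which is almost everywhere. A complex scalar mixes real and
    imaginary parts, hence the combinations of three sequences. *)
Lemma pf_bounded_operator : bounded_operator mu pf.
Proof.
split; first exact: pf_L2.
- move=> a xi eta hx he; have [xr xim] := (L2P _ _).1 hx; have [er ei] := (L2P _ _).1 he.
  apply: (ae_imp4 _ (pf_cvg_ae xr) (pf_cvg_ae xim) (pf_cvg_ae er) (pf_cvg_ae ei)).
  move=> x cxr cxi cer cei.
  apply: complex_eq.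
    rewrite ReD ReM /pf /=.
    rewrite (_ : rp _ = fun y => cRe a * rp xi y + (- cIm a) * ip xi y + rp eta y).
      by rewrite (pf_real_comb (cRe a) (- cIm a) xr xim er cxr cxi cer) mulNr.
    by apply/funext => y; rewrite /rp ReD ReM mulNr.
  rewrite ImD ImM /pf /=.
  rewrite (_ : ip _ = fun y => cRe a * ip xi y + cIm a * rp xi y + ip eta y).
    by rewrite (pf_real_comb (cRe a) (cIm a) xim xr ei cxi cxr cei).
  by apply/funext => y; rewrite /ip ImD ImM.
- have [M M0 h] := pf_bounded; exists M => xi hx.
  by apply: norm2_le => //; [exact: pf_L2|exact: h].
Qed.

Lemma pf_Cstar : reduced_group_Cstar_algebra mu pf.
Proof.
split; first exact: pf_bounded_operator.
move=> e e0; have [k ke] := ratio_cvg0 (exprn_gt0 2 e0).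
exists (convolution mu (cplx (f k))).
  by exists (cplx (f k)) => //; exact: bsupp_L1.
move=> xi hx; have [hd d] := pf_conv_dist k hx.
apply: norm2_le => //; first exact: ltW.
by apply: le_trans d _; rewrite ler_wpM2r ?cnq_ge0.
Qed.

Lemma pf_VN : group_von_Neumann_algebra mu pf.
Proof.
split; first exact: pf_bounded_operator.
move=> m xi eta h e e0; exists pf; first exact: pf_Cstar.
by move=> j; rewrite subrr normr0.
Qed.

Lemma pair2Bl (a b c : G -> R) : sqi mu a -> sqi mu b -> sqi mu c ->
  pair2 mu (fun x => a x - b x) c = pair2 mu a c - pair2 mu b c.
Proof.
move=> sa sb sc; rewrite /pair2 -(RintegralB measurableT (sqi_mul sa sc) (sqi_mul sb sc)).
by apply: eq_Rintegral => x _; rewrite mulrBl.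
Qed.

Lemma innerBl (xi zeta eta : G -> C) : L2 xi -> L2 zeta -> L2 eta ->
  cRe (inner mu (fun x => xi x - zeta x) eta) = cRe (inner mu xi eta) - cRe (inner mu zeta eta) /\
  cIm (inner mu (fun x => xi x - zeta x) eta) = cIm (inner mu xi eta) - cIm (inner mu zeta eta).
Proof.
move=> hx hz he; have [xr xim] := (L2P _ _).1 hx; have [er ei] := (L2P _ _).1 he.
have [zr zi] := (L2P _ _).1 hz.
have Er : rp (fun x => xi x - zeta x) = fun x => rp xi x - rp zeta x.
  by apply/funext => x; rewrite /rp ReB.
have Ei : ip (fun x => xi x - zeta x) = fun x => ip xi x - ip zeta x.
  by apply/funext => x; rewrite /ip ImB.
have hd : L2 (fun x => xi x - zeta x).
  by apply/L2P; rewrite Er Ei; split; exact: sqiB.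
rewrite (Re_inner hd he) (Re_inner hx he) (Re_inner hz he).
rewrite (Im_inner hd he) (Im_inner hx he) (Im_inner hz he).
rewrite Er Ei !pair2Bl//; split; ring.
Qed.

Lemma inner_pf_cvg (xi eta : G -> C) : L2 xi -> L2 eta ->
  (fun k => \int[mu]_t (f k t * cRe (coefficient mu xi eta t))) @ \oo
    --> cRe (inner mu (pf xi) eta) /\
  (fun k => \int[mu]_t (f k t * cIm (coefficient mu xi eta t))) @ \oo
    --> cIm (inner mu (pf xi) eta).
Proof.
move=> hx he.
pose b k := 2 * (Num.sqrt (56 * K * (3 / 4) ^+ k * cnq mu xi) * Num.sqrt (cnq mu eta)).
have b0 : b @ \oo --> 0.
  have -> : 0 = 2 * (Num.sqrt (56 * K * 0 * cnq mu xi) * Num.sqrt (cnq mu eta)) :> R.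
    by rewrite mulr0 mul0r sqrtr0 mul0r mulr0.
  apply: cvgM; first exact: cvg_cst.
  apply: cvgM; last exact: cvg_cst.
  apply: (@cvg_comp _ _ _ (fun k => 56 * K * (3 / 4) ^+ k * cnq mu xi) Num.sqrt); last first.
    exact: sqrt_continuous.
  apply: cvgM; last exact: cvg_cst.
  apply: cvgM; first exact: cvg_cst.
  by apply: cvg_expr; rewrite ger0_norm; lra.
have S (u : nat -> R) (l : R) : (forall k, `|l - u k| <= b k) -> u @ \oo --> l.
  move=> h; apply/cvgrPdist_le => e e0.
  have /cvgr0Pnorm_le/(_ _ e0) := b0; apply: filterS => k bk.
  by apply: le_trans (h k) _; apply: le_trans bk; exact: ler_norm.
have Q k : `|cRe (inner mu (pf xi) eta) - \int[mu]_t (f k t * cRe (coefficient mu xi eta t))| <= b k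
  /\ `|cIm (inner mu (pf xi) eta) - \int[mu]_t (f k t * cIm (coefficient mu xi eta t))| <= b k.
  have hc := L2_conv hmu (bf k) hx.
  have [<- <-] := inner_conv hmu (bf k) hx he.
  have [<- <-] := innerBl (pf_L2 hx) hc he.
  have [hd d] := pf_conv_dist k hx.
  have [i1 i2] := inner_bound hd he.
  have d' : 2 * (Num.sqrt (cnq mu (fun x => pf xi x - convolution mu (cplx (f k)) xi x)) *
     Num.sqrt (cnq mu eta)) <= b k.
    by rewrite ler_pM2l// ler_wpM2r ?sqrtr_ge0// ler_wsqrtr.
  by split; [exact: le_trans i1 d'|exact: le_trans i2 d'].
split; apply: S => k; [exact: (Q k).1|exact: (Q k).2].
Qed.

Hypothesis f_supp : forall e : R, 0 < e -> exists k0, forall k, (k0 <= k)%N ->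
  forall y, f k y != 0 -> `|qf y| <= e.

(** The pairing is a limit of integrals of f_k u, so it can be computed from any representation of
    any function that agrees with u on the supports of late f_k. This replaces u by u - v,
    represented with product of norms below e, and [pf_bounded] concludes. *)
Lemma pf_annihilates_J : annihilator mu (ideal_J mu (@unit_sphere R n.+1)) pf.
Proof.
split; first exact: pf_VN.
move=> xi eta hx he [_ uJ].
have [M M0 hM] := pf_bounded.
suff S (e : R) : 0 < e -> `|cRe (inner mu (pf xi) eta)| <= 2 * M * e /\
     `|cIm (inner mu (pf xi) eta)| <= 2 * M * e.
  have Z (z : R) : (forall e, 0 < e -> `|z| <= 2 * M * e) -> z = 0.
    move=> h; apply/eqP; rewrite -normr_le0; apply/ler_addgt0Pr => d d0; rewrite add0r.
    apply: le_trans (h (d / (2 * M + 1)) _) _.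
      by rewrite divr_gt0// ltr_wpDl// mulr_ge0.
    rewrite mulrA ler_pdivrMr ?ltr_wpDl ?mulr_ge0//.
    by rewrite mulrC ler_pM2l// lerDl.
  by apply: complex_eq; apply: Z => e e0; have [] := S e e0.
move=> e0; have [v [_ cv' vE vn]] := uJ e e0.
have [eta' eta'0 vgap] := compact_gap cv' vE.
have [k0 hk0] := f_supp eta'0.
have fv k t : (k0 <= k)%N -> f k t != 0 -> v t = 0.
  move=> kk ft; apply/eqP/negPn/negP => vt.
  have /vgap : closed_support v t by apply: subset_closure.
  by rewrite ltNge (hk0 k kk t ft).
have [z [xi' [et' [hx' he' uE ->]]] zlt] := ereal_inf_lt vn.
have [c1 c2] := inner_pf_cvg hx he; have [c1' c2'] := inner_pf_cvg hx' he'.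
have E1 : cRe (inner mu (pf xi) eta) = cRe (inner mu (pf xi') et').
  apply: (eq_cvg_tail c1 c1' (k0 := k0)) => k kk; apply: eq_Rintegral => t _.
  have [->|ft] := eqVneq (f k t) 0; first by rewrite !mul0r.
  by rewrite -uE (fv k t kk ft) subr0.
have E2 : cIm (inner mu (pf xi) eta) = cIm (inner mu (pf xi') et').
  apply: (eq_cvg_tail c2 c2' (k0 := k0)) => k kk; apply: eq_Rintegral => t _.
  have [->|ft] := eqVneq (f k t) 0; first by rewrite !mul0r.
  by rewrite -uE (fv k t kk ft) subr0.
have [i1 i2] := inner_bound (pf_L2 hx') he'.
move: zlt; rewrite (norm2E hx') (norm2E he') -EFinM lte_fin => zlt.
have b : 2 * (Num.sqrt (cnq mu (pf xi')) * Num.sqrt (cnq mu et')) <= 2 * M * e.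
  rewrite -[leRHS]mulrA ler_pM2l//.
  apply: (@le_trans _ _ (M * (Num.sqrt (cnq mu xi') * Num.sqrt (cnq mu et')))); last first.
    by rewrite ler_wpM2l// ltW.
  rewrite mulrA ler_wpM2r ?sqrtr_ge0//.
  rewrite -[X in X * _](ger0_norm M0) -sqrtr_sqr -sqrtrM ?sqr_ge0//.
  by rewrite ler_wsqrtr// hM.
by rewrite E1 E2; split; [exact: le_trans i1 b|exact: le_trans i2 b].
Qed.

End Pseudofunction.

Lemma continuous_addc (R : realType) (n : nat) (g : 'rV[R]_n.+1 -> R) (c : R) :
  continuous g -> continuous (fun y => g y + c).
Proof.
move=> cg y; apply: (@continuousD _ _ _ g (fun=> c)); first exact: cg.
exact: cst_continuous.
Qed.

(** * The pairing with |y|^2 - 1 *)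

Section QuadraticCoefficient.
Context {R : realType} {n : nat}.
Local Notation G := 'rV[R]_n.+1.
Local Notation B := (borel_rV R n.+1).
Variable mu : {sigma_finite_measure set B -> \bar R}.
Hypothesis hmu : haar_measure mu.
Local Notation intb f := (mu.-integrable setT (EFin \o (f : B -> R))).
Local Notation measb f := (measurable_fun (setT : set B) (f : B -> R)).

Lemma bsupp_indic_cube (r : R) : bsupp (\1_(cube r) : G -> R).
Proof.
split.
- by apply: measurable_indic; exact: cube_measurable.
- by exists 1 => y; rewrite indicE; case: (_ \in _); rewrite ?normr1 ?normr0.
- exists r => y ry; rewrite indicE memNset//= => h.
  by move: ry; rewrite ltNge h.
Qed.

Lemma bsupp_cutM (g : G -> R) (r : R) : continuous g -> bsupp (fun y => g y * \1_(cube r) y).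
Proof.
move=> cg; have [mi _ [s si]] := bsupp_indic_cube r.
have [M gM] : exists M : R, forall y, cube r y -> `|g y| <= M.
  have := @cube_compact R n r => cc.
  have [c0|/set0P c0] := eqVneq (cube r : set G) set0; first by exists 0 => y; rewrite c0.
  have [|c _ cmax] := @compact_EVT_max _ _ (fun y : G => `|g y|) _ c0 cc.
    apply: continuous_subspaceT => y.
    apply: (@continuous_comp _ _ _ (g : G -> R) (fun z : R => `|z|)); first exact: cg.
    exact: (@norm_continuous _ R).
  by exists (`|g c|) => y cy; apply: cmax; exact: mem_set.
split.
- by apply: measurable_funM => //; exact: continuous_measurable_rV.
- exists `|M| => y; rewrite indicE; have [yr|yr] := boolP (_ \in _).
    rewrite mulr1; apply: le_trans (ler_norm _); apply: gM; exact: set_mem.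
  by rewrite mulr0 normr0.
- by exists s => y sy; rewrite si// mulr0.
Qed.

(** Correlating [ssq] + alpha with the indicator of the unit cube gives A (ssq x) + Q + A alpha, as
    the terms linear in s integrate to 0 by reflection. The cutoff of [xi] at 3 is invisible for |x|
    <= 2 and |s| <= 1. *)
Lemma quadratic_coefficient : exists (xi eta : G -> R) (A : R),
  [/\ bsupp xi, bsupp eta, 0 < A &
    forall x, `|x| <= 2 -> pair2 mu (fun s => xi (- x + s)) eta = A * qf x].
Proof.
pose eta : G -> R := \1_(cube 1).
have etaE (s : G) : eta s = (`|s| <= 1)%R%:R.
  rewrite /eta indicE; congr (nat_of_bool _)%:R.
  by apply/idP/idP => [/set_mem//|h]; exact/mem_set.
have be : bsupp eta by exact: bsupp_indic_cube.
have ie : intb eta by exact: (bsupp_integrable hmu).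
pose A := \int[mu]_s eta s.
have A0 : 0 < A.
  rewrite /A /Rintegral integral_indic ?setIT//; last exact: cube_measurable.
  by rewrite fine_gt0// (mu_cube_gt0 hmu)//= (mu_cube_fin hmu).
have bi i : bsupp (fun s : G => s ord0 i * eta s).
  by apply: bsupp_cutM => y; exact: coord_continuous.
pose ssq (s : G) : R := \sum_(i < n.+1) s ord0 i ^+ 2.
have cq : continuous ssq.
  move=> y; rewrite (_ : ssq = fun s : G => qf s + 1); last first.
    by apply/funext => s; rewrite /qf subrK.
  exact: (continuous_addc (@continuous_qf R n)).
have bq : bsupp (fun s : G => ssq s * eta s) by exact: bsupp_cutM.
pose Q := \int[mu]_s (ssq s * eta s).
have z i : \int[mu]_s (s ord0 i * eta s) = 0.
  have := (Rintegral_opp hmu (bsupp_integrable hmu (bi i))).2.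
  rewrite (_ : (fun y : B => _) = (fun y : B => - ((y : G) ord0 i * eta y))); last first.
    apply/funext => y; rewrite mxE mulNr; congr (- (_ * _)).
    by rewrite !etaE normrN.
  rewrite RintegralN; last exact: (bsupp_integrable hmu).
  lra.
(* Chosen so that Q + A alpha = - A. *)
pose alpha := - 1 - Q / A.
pose xi : G -> R := fun y => (ssq y + alpha) * \1_(cube 3) y.
have bx : bsupp xi.
  by apply: bsupp_cutM; exact: continuous_addc.
exists xi, eta, A; split=> // x x2.
transitivity (\int[mu]_s ((ssq s * eta s) + (ssq x + alpha) * eta s
    + \sum_(i < n.+1) (- 2 * x ord0 i) * (s ord0 i * eta s))).
  apply: eq_Rintegral => s _.
  rewrite !etaE; have [s1|s1] := boolP (`|s : G| <= 1)%R; last first.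
    by rewrite !mulr0 !add0r big1// => i _; rewrite !mulr0.
  rewrite !mulr1 /xi indicE mem_set ?mulr1; last first.
    rewrite /cube /=; apply: le_trans (ler_normD _ _) _; rewrite normrN.
    by move: x2 s1; lra.
  under eq_bigr do rewrite mulr1.
  have -> : ssq (- x + s) = ssq s + ssq x + \sum_i -2 * x ord0 i * s ord0 i.
    rewrite /ssq -big_split -big_split /=; apply: eq_bigr => i _.
    by rewrite !mxE; ring.
  ring.
rewrite RintegralD//; last 2 first.
- apply: integrableDR; first exact: (bsupp_integrable hmu).
  exact: integrableZR.
- have := @integrable_sum _ _ _ mu setT measurableT _ (index_enum 'I_n.+1) xpredT
    (fun i s => (- 2 * x ord0 i * (s ord0 i * eta s))%:E).
  rewrite (_ : (fun t => _) = (EFin \o (fun s : B => \sum_(i < n.+1) - 2 * x ord0 i * (s ord0 i * eta s)))).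
    apply => i _; apply: integrableZR; exact: (bsupp_integrable hmu).
  by apply/funext => s; rewrite /= sumEFin.
rewrite RintegralD//; last 2 first.
- exact: (bsupp_integrable hmu).
- exact: integrableZR.
rewrite Rintegral_sum; last first.
  by move=> i; apply: integrableZR; exact: (bsupp_integrable hmu).
rewrite big1 ?addr0; last first.
  by move=> i _; rewrite RintegralZl// ?z ?mulr0//; exact: (bsupp_integrable hmu).
rewrite RintegralZl// -/A -/Q /alpha /qf -/(ssq x).
field; lra.
Qed.

End QuadraticCoefficient.

(** * Failure of reduced synthesis from a suitable sequence *)

Section NotSynthesis.
Context {R : realType} {n : nat}.
Local Notation G := 'rV[R]_n.+1.
Local Notation B := (borel_rV R n.+1).
Variable mu : {sigma_finite_measure set B -> \bar R}.
Hypothesis hmu : haar_measure mu.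
Variables (f : nat -> G -> R) (K : R).
Hypothesis bf : forall k, bsupp (f k).
Hypothesis fK : forall k,
  n1 mu (autocorr mu (fun y => f k.+1 y - f k y)) <= K * (3 / 4) ^+ k.
Hypothesis f_supp : forall e : R, 0 < e -> exists k0, forall k, (k0 <= k)%N ->
  forall y, f k y != 0 -> `|qf y| <= e.
Hypothesis f_cube : forall k y, f k y != 0 -> `|y| <= 2.
Variables (c : R) (k0 : nat).
Hypothesis c0 : 0 < c.
Hypothesis f_neg : forall k, (k0 <= k)%N -> \int[mu]_y (f k y * qf y) <= - c.

Lemma not_annihilates_I : ~ annihilator mu (ideal_I mu (@unit_sphere R n.+1)) (pf mu f).
Proof.
move=> [_ h].
have [xi [eta [A [bx be A0 uE]]]] := quadratic_coefficient hmu.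
have hx : Lp mu 2%:E (cplx xi).
  by apply/L2P; split; [exact: (bsupp_sqi hmu bx)|];
    apply: (bsupp_sqi hmu); split; [exact: measurable_cst|exists 0 => y; rewrite normr0|exists 0].
have he : Lp mu 2%:E (cplx eta).
  by apply/L2P; split; [exact: (bsupp_sqi hmu be)|];
    apply: (bsupp_sqi hmu); split; [exact: measurable_cst|exists 0 => y; rewrite normr0|exists 0].
have rE x : cRe (coefficient mu (cplx xi) (cplx eta) x) = pair2 mu (fun s => xi (- x + s)) eta.
  rewrite /coefficient (Re_inner (L2_shift hmu (- x) hx) he).
  rewrite [X in _ + X](_ : _ = 0) ?addr0//.
  by rewrite -[RHS](@Rintegral0 _ _ _ mu); apply: eq_Rintegral => y _; rewrite /ip /= mulr0.
have iE x : cIm (coefficient mu (cplx xi) (cplx eta) x) = 0.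
  rewrite /coefficient (Im_inner (L2_shift hmu (- x) hx) he).
  rewrite [X in X - _](_ : _ = 0) ?[X in _ - X](_ : _ = 0) ?subr0//.
    by rewrite -[RHS](@Rintegral0 _ _ _ mu); apply: eq_Rintegral => y _; rewrite /ip /= mulr0.
  by rewrite -[RHS](@Rintegral0 _ _ _ mu); apply: eq_Rintegral => y _; rewrite /ip /= mul0r.
have hI : ideal_I mu (@unit_sphere R n.+1) (coefficient mu (cplx xi) (cplx eta)).
  split; first by exists (cplx xi), (cplx eta).
  move=> s; rewrite /unit_sphere /= => s1; apply: complex_eq; rewrite ?iE// rE.
  have q0 : qf s = 0 by rewrite -qfE s1 expr1n subrr.
  rewrite uE ?q0 ?mulr0//.
  apply/normr_rV_le => // i.
  have : s ord0 i ^+ 2 <= 1.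
    have <- : \sum_(i < n.+1) s ord0 i ^+ 2 = 1.
      by move: q0; rewrite /qf => /eqP; rewrite subr_eq0 => /eqP.
    by rewrite (bigD1 i)//= lerDl sumr_ge0// => j _; exact: sqr_ge0.
  rewrite -[X in X <= _ -> _]real_normK ?num_real//.
  by have := normr_ge0 (s ord0 i); nra.
have [c1 _] := inner_pf_cvg hmu bf fK hx he.
rewrite (h _ _ hx he hI) /= in c1.
have /cvgrPdist_lt/(_ (A * c)) := c1; rewrite mulr_gt0// => /(_ isT)[k1 _ hk].
have := hk (k0 + k1)%N (leq_addl _ _); rewrite sub0r normrN.
set k := (k0 + k1)%N.
have -> : \int[mu]_t (f k t * cRe (coefficient mu (cplx xi) (cplx eta) t)) =
    A * \int[mu]_t (f k t * qf t).
  rewrite -RintegralZl//; last first.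
    have cq := @continuous_qf R n.
    have := bsupp_integrable hmu (bsuppM (bf k) (bsupp_cutM 2 cq)).
    congr (_.-integrable _ _); apply/funext => t /=; congr EFin.
    have [->|ft] := eqVneq (f k t) 0; first by rewrite !mul0r.
    by rewrite indicE mem_set ?mulr1//; exact: f_cube ft.
  apply: eq_Rintegral => t _; rewrite rE.
  have [->|ft] := eqVneq (f k t) 0; first by rewrite !mul0r mulr0.
  by rewrite uE; [ring|exact: f_cube ft].
have := f_neg (leq_addr k1 k0); rewrite -/k => fn.
rewrite normrM (gtr0_norm A0) ltr_pM2l// => lt.
have := ler_norm (- \int[mu]_t (f k t * qf t)); rewrite normrN; lra.
Qed.

Theorem not_synthesis : ~ reduced_spectral_synthesis mu (@unit_sphere R n.+1).
Proof.
move=> h.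
have : (reduced_group_Cstar_algebra mu `&` annihilator mu (ideal_I mu (@unit_sphere R n.+1))) (pf mu f).
  rewrite [X in X _]h; split; first exact: (pf_Cstar hmu bf fK).
  exact: (pf_annihilates_J hmu bf fK f_supp).
by move=> [_]; exact: not_annihilates_I.
Qed.

End NotSynthesis.

(** * Volumes of cubes and shells *)

Section Volumes.
Context {R : realType} {n : nat}.
Local Notation G := 'rV[R]_n.+1.
Local Notation B := (borel_rV R n.+1).
Variable mu : {sigma_finite_measure set B -> \bar R}.
Hypothesis hmu : haar_measure mu.

Definition vol (A : set G) : R := fine (mu A).

Lemma vol_fin (A : set G) (r : R) : measurable (A : set B) -> A `<=` cube r ->
  mu A = (vol A)%:E.
Proof.
move=> mA Ar; rewrite /vol fineK// ge0_fin_numE//.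
apply: le_lt_trans (mu_cube_fin hmu r); apply: le_measure; rewrite ?inE//.
exact: cube_measurable.
Qed.

Lemma measurable_image_shift (x : G) (A : set G) : measurable (A : set B) ->
  measurable (((fun y => x + y) @` A) : set B).
Proof.
move=> mA; rewrite (_ : _ @` _ = (fun y : B => - x + y : B) @^-1` A).
  by rewrite -[X in measurable X]setTI; exact: (measurable_shift (- x)).
apply/seteqP; split=> y /=; first by move=> [z zr <-]; rewrite addKr.
by move=> yr; exists (- x + y) => //; rewrite addNKr.
Qed.

(** Invariance gives all translates the measure of [A], and disjointness adds them up. This is the
    source of the volume bounds for small cubes and thin shells. *)
Lemma packing (I : finType) (v : I -> G) (A : set G) (r : R) :
  measurable (A : set B) ->
  (forall i j y z, A y -> A z -> v i + y = v j + z -> i = j) ->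
  (forall i y, A y -> `|v i + y| <= r) -> A `<=` cube r ->
  #|I|%:R * vol A <= vol (cube r).
Proof.
move=> mA dis sub Ar.
pose F (k : 'I_#|I|) : set B := (fun y => v (enum_val k) + y) @` A.
have tF : trivIset setT F.
  move=> i j _ _ [_ [[y Ay <-] [z Az /esym yz]]].
  by apply: enum_val_inj; exact: (dis _ _ y z).
have mF k : measurable (F k) by exact: measurable_image_shift.
have mvi k : mu (F k) = mu A by case: hmu => _ h _ _ _; exact: h.
have : (mu (\big[setU/set0]_(k < #|I|) F k) <= mu (cube r))%E.
  apply: le_measure; rewrite ?inE.
  - by apply: bigsetU_measurable => k _.
  - exact: cube_measurable.
  - apply: (big_ind (fun S => S `<=` cube r)) => //.
      by move=> S T hS hT y [/hS|/hT].
    by move=> k _ _ [y Ay <-]; exact: sub.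
rewrite measure_bigsetU_ord// (vol_fin (@cube_measurable R n r) (@subset_refl _ _)).
rewrite (eq_bigr (fun=> (vol A)%:E)); last first.
  by move=> k _; transitivity (mu A); [exact: mvi|exact: (vol_fin mA Ar)].
by rewrite sumEFin lee_fin sumr_const card_ord mulr_natl.
Qed.

Lemma vol_ge0 A : 0 <= vol A.
Proof. by apply: fine_ge0; exact: measure_ge0. Qed.

Lemma vol_le (A D : set G) (r : R) : measurable (A : set B) -> measurable (D : set B) ->
  A `<=` D -> D `<=` cube r -> vol A <= vol D.
Proof.
move=> mA mD AD Dr; rewrite -lee_fin -(vol_fin mA (subset_trans AD Dr)) -(vol_fin mD Dr).
by apply: le_measure; rewrite ?inE.
Qed.

Definition ev (i : 'I_n.+1) : G := delta_mx ord0 i.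

Lemma ev_coord i j (t : R) : (t *: ev i) ord0 j = if j == i then t else 0.
Proof. by rewrite !mxE eqxx /=; case: eqVneq => _; rewrite ?mulr1 ?mulr0. Qed.

Lemma coord_shift i (t : R) (y : G) j :
  (t *: ev i + y) ord0 j = (if j == i then t else 0) + y ord0 j.
Proof. by rewrite mxE ev_coord. Qed.

Lemma qf_shift i (t : R) (y : G) : qf (t *: ev i + y) = qf y + 2 * t * y ord0 i + t ^+ 2.
Proof.
rewrite /qf (bigD1 i)//= [in RHS](bigD1 i)//= coord_shift eqxx.
rewrite (eq_bigr (fun j => y ord0 j ^+ 2)); last first.
  by move=> j ji; rewrite coord_shift (negbTE ji) add0r.
ring.
Qed.

Lemma archi_inv (r : R) : 0 < r <= 1 -> exists N : nat, N%:R * r <= 1 /\ 1 <= 2 * (N%:R * r).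
Proof.
move=> /andP[r0 r1]; have i0 : 0 <= r^-1 by rewrite invr_ge0 ltW.
have /andP[h1 h2] := truncn_itv i0; exists (Num.truncn r^-1).
have a : (Num.truncn r^-1)%:R * r <= 1 by rewrite -ler_pdivlMr// div1r.
split=> //.
have b : 1 < (Num.truncn r^-1)%:R * r + r.
  by move: h2; rewrite -natr1 -[X in X < _]div1r ltr_pdivrMr// mulrDl mul1r.
have c : r <= (Num.truncn r^-1)%:R * r.
  rewrite ler_peMl// ?(ltW r0)// ler1n truncn_gt0.
  by rewrite invf_ge1.
lra.
Qed.

(** This is where the dimension enters. For r <= 1, translates by multiples of 3 r, N of them in
    each of the n + 1 >= 4 directions with N about 1/r, are disjoint and fit in the cube of radius
    4, so the volume is at most a constant times N^-4. For r > 1 the factor r^4 exceeds 1 and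
    monotonicity suffices. *)
Lemma cube_vol (hn : (3 <= n)%N) : exists C : R, forall r : R, 0 < r <= 8 -> vol (cube r) <= C * r ^+ 4.
Proof.
exists (16 * vol (cube 8)) => r /andP[r0 r8].
have v8 := vol_ge0 (cube 8).
have [r1|r1] := leP r 1; last first.
  apply: (@le_trans _ _ (vol (cube 8))).
    apply: (vol_le (r := 8)); [exact: cube_measurable|exact: cube_measurable| |by []].
    by move=> y /= yr; exact: le_trans yr r8.
  have : 1 <= r ^+ 4 by rewrite exprn_ege1// ltW.
  nra.
have [N [N1 N2]] := archi_inv (introT andP (conj r0 r1)).
pose v (k : {ffun 'I_n.+1 -> 'I_N}) : G := \row_i (3 * r * (k i)%:R).
have := @packing _ v (cube r) 4 (cube_measurable r).
rewrite card_ffun !card_ord => P.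
have {P} : (N ^ n.+1)%:R * vol (cube r) <= vol (cube 4).
  apply: P.
  - move=> i j y z yr zr e; apply/ffunP => a.
    have := congr1 (fun w : G => w ord0 a) e; rewrite !mxE => ea.
    have ya := le_trans (coord_le_normr y a) yr; have za := le_trans (coord_le_normr z a) zr.
    apply/val_inj; apply/eqP; rewrite eqn_leq; apply/andP.
    have Q (p q : nat) (u w : R) : 3 * r * p%:R + u = 3 * r * q%:R + w ->
        `|u| <= r -> `|w| <= r -> (p <= q)%N.
      move=> h /ler_normlP[u1 u2] /ler_normlP[w1 w2]; rewrite leqNgt; apply/negP => qp.
      have : q%:R + 1 <= p%:R :> R by rewrite natr1 ler_nat.
      move: h u1 u2 w1 w2; set P := p%:R; set S := q%:R => h u1 u2 w1 w2 ps.
      have : 3 * r * (S + 1) <= 3 * r * P by rewrite ler_pM2l// mulr_gt0.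
      lra.
    by split; [exact: Q ea ya za|exact: Q (esym ea) za ya].
  - move=> i y yr; apply/normr_rV_le => // a; rewrite !mxE.
    have ya := le_trans (coord_le_normr y a) yr.
    apply: le_trans (ler_normD _ _) _.
    have ik : (i a)%:R <= N%:R :> R by rewrite ler_nat ltnW.
    have i0 : 0 <= (i a)%:R :> R by rewrite ler0n.
    rewrite ger0_norm; last by rewrite !mulr_ge0// ltW.
    have : (i a)%:R * r <= N%:R * r by rewrite ler_wpM2r// ltW.
    lra.
  - by move=> y /= yr; apply: le_trans yr _; lra.
move=> P.
have N0 : (0 < N)%N by case: N N1 N2 {v P} => // _; rewrite mul0r mulr0; lra.
have P4 : (N ^ 4)%:R * vol (cube r) <= vol (cube 8).
  apply: (@le_trans _ _ (vol (cube 4))); last first.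
    apply: (vol_le (r := 8)); [exact: cube_measurable|exact: cube_measurable| |by []].
    by move=> y /= yr; apply: le_trans yr _; lra.
  apply: le_trans P; rewrite ler_wpM2r ?vol_ge0// ler_nat leq_pexp2l//.
have : 1 <= (2 * (N%:R * r)) ^+ 4 by rewrite exprn_ege1.
rewrite !exprMn => h.
have vr := vol_ge0 (cube r).
rewrite natrX in P4.
have r4 : 0 < r ^+ 4 by rewrite exprn_gt0.
set V := vol (cube r) in vr P4 *; set W := vol (cube 8) in v8 P4 *.
set N4 := N%:R ^+ 4 in h P4 *; set rr := r ^+ 4 in r4 h *.
have : V <= 2 ^+ 4 * (N4 * rr) * V by rewrite ler_peMl.
have : rr * (N4 * V) <= rr * W by rewrite ler_pM2l.
by rewrite (_ : 2 ^+ 4 = 16 :> R); [nra|ring].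
Qed.

(** The condition y_o >= 1/2 makes qf grow at rate at least 1 in the direction e_o, which separates
    the translates used in [shell_vol]. *)
Definition shell (d : R) : set G :=
  [set y | `|qf y| <= d /\ 1 / 2 <= y ord0 ord0 /\ `|y| <= 2].

Lemma shell_measurable d : measurable (shell d : set B).
Proof.
have cq := @continuous_qf R n.
have c1 : closed [set y : G | `|qf y| <= d].
  rewrite (_ : [set y | _] = (fun y : G => `|qf y|) @^-1` [set z | z <= d])//.
  apply: closed_comp => [y _|]; last exact: closed_le.
  apply: (@continuous_comp _ _ _ (qf : G -> R) (fun z : R => `|z|)); first exact: cq.
  exact: (@norm_continuous _ R).
have c2 : closed [set y : G | 1 / 2 <= y ord0 ord0].
  rewrite (_ : [set y | _] = (fun y : G => y ord0 ord0) @^-1` [set z | 1 / 2 <= z])//.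
  by apply: closed_comp => [y _|]; [exact: coord_continuous|exact: closed_ge].
have -> : shell d = [set y | `|qf y| <= d] `&` ([set y : G | 1 / 2 <= y ord0 ord0] `&` cube 2).
  by apply/seteqP; split.
apply: measurableI; first exact: closed_measurable_rV.
apply: measurableI; first exact: closed_measurable_rV.
exact: cube_measurable.
Qed.

(* The translates of the shell by 3 k d e_o, k <= 1/d, are disjoint and stay in a
   fixed cube. *)
Lemma shell_vol : exists2 C : R, 0 <= C & forall d : R, 0 < d <= 1 -> vol (shell d) <= C * d.
Proof.
exists (2 * vol (cube 8)); first by rewrite mulr_ge0// vol_ge0.
move=> d /andP[d0 d1].
have [N [N1 N2]] := archi_inv (introT andP (conj d0 d1)).
pose v (k : 'I_N) : G := (3 * d * k%:R) *: ev ord0.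
have := @packing _ v (shell d) 8 (shell_measurable d); rewrite card_ord => P.
have {P} P : N%:R * vol (shell d) <= vol (cube 8).
  apply: P.
  - move=> i j y z [qy [yo y2]] [qz [zo z2]] e.
    apply/val_inj; apply/eqP; rewrite eqn_leq; apply/andP.
    have Q (p q : nat) (u w : G) : `|qf u| <= d -> 1 / 2 <= u ord0 ord0 -> `|qf w| <= d ->
        (3 * d * p%:R) *: ev ord0 + u = (3 * d * q%:R) *: ev ord0 + w -> (p <= q)%N.
      move=> /ler_normlP[u1 u2] uo /ler_normlP[w1 w2] h; rewrite leqNgt; apply/negP => qp.
      have : q%:R + 1 <= p%:R :> R by rewrite natr1 ler_nat.
      set P := p%:R in h *; set S := q%:R in h * => ps.
      have wE : w = (3 * d * (P - S)) *: ev ord0 + u.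
        rewrite mulrBr scalerBl addrAC h addrAC subrr add0r//.
      have := qf_shift ord0 (3 * d * (P - S)) u; rewrite -wE => qw.
      set t := 3 * d * (P - S) in qw.
      have : 3 * d * 1 <= t by rewrite /t ler_pM2l ?mulr_gt0//; lra.
      rewrite mulr1 => t3.
      (* As u_o >= 1/2, moving by t raises qf by at least t >= 3 d, while two points of the shell
         differ in qf by at most 2 d. *)
      have : t <= 2 * t * u ord0 ord0 by nra.
      have := sqr_ge0 t; lra.
    by split; [exact: Q qy yo qz e|exact: Q qz zo qy (esym e)].
  - move=> i y [_ [_ y2]]; apply/normr_rV_le => // a.
    rewrite coord_shift; have ya := le_trans (coord_le_normr y a) y2.
    apply: le_trans (ler_normD _ _) _.
    have ik : (i : nat)%:R <= N%:R :> R by rewrite ler_nat ltnW.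
    have i0 : 0 <= (i : nat)%:R :> R by rewrite ler0n.
    have : (i : nat)%:R * d <= N%:R * d by rewrite ler_wpM2r// ltW.
    have : 0 <= (i : nat)%:R * d by rewrite mulr_ge0// ltW.
    case: ifP => _; last by rewrite normr0; lra.
    rewrite (_ : 3 * d * (i : nat)%:R = 3 * ((i : nat)%:R * d)); last by ring.
    by move=> h0 h1; rewrite ger0_norm ?mulr_ge0//; lra.
  - by move=> y [_ [_ y2]]; rewrite /cube /=; lra.
have vr := vol_ge0 (shell d).
set V := vol (shell d) in vr P *; set W := vol (cube 8) in P *.
have : V <= 2 * (N%:R * d) * V by rewrite ler_peMl.
have : d * (N%:R * V) <= d * W by rewrite ler_pM2l.
nra.
Qed.

End Volumes.

(** * One-dimensional profiles *)

Section LambdaDerivatives.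
Context {R : realType}.
Implicit Types f g : R -> R.

Lemma deq f (x a b : R) : is_derive x 1 f a -> a = b -> is_derive x 1 f b.
Proof. by move=> fa <-. Qed.

Lemma dMf f g (x a b : R) : is_derive x 1 f a -> is_derive x 1 g b ->
  is_derive x 1 (fun t => f t * g t) (a * g x + f x * b).
Proof.
move=> fa gb.
have H : is_derive x 1 (f * g) (f x *: b + g x *: a) by exact: is_deriveM.
apply: (is_derive_eq H).
by rewrite /GRing.scale /= addrC (mulrC a).
Qed.

Lemma dDf f g (x a b : R) : is_derive x 1 f a -> is_derive x 1 g b ->
  is_derive x 1 (fun t => f t + g t) (a + b).
Proof. by move=> fa gb; exact: (is_deriveD fa gb). Qed.

Lemma dcomp g f (x a b : R) : is_derive x 1 g b -> is_derive (g x) 1 f a ->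
  is_derive x 1 (fun t => f (g t)) (a * b).
Proof. by move=> gb fa; exact: (is_derive1_comp fa gb). Qed.

Lemma dcst (c x : R) : is_derive x 1 (fun _ : R => c) 0.
Proof. exact: is_derive_cst. Qed.

Lemma did (x : R) : is_derive x 1 (fun t : R => t) 1.
Proof. exact: is_derive_id. Qed.

Lemma dZf f (c x a : R) : is_derive x 1 f a -> is_derive x 1 (fun t => c * f t) (c * a).
Proof. by move=> fa; apply: (deq (dMf (dcst c x) fa)); rewrite mul0r add0r. Qed.

Lemma dsum (I : Type) (s : seq I) (F : I -> R -> R) (a : I -> R) (x : R) :
  (forall i, is_derive x 1 (F i) (a i)) ->
  is_derive x 1 (fun t => \sum_(i <- s) F i t) (\sum_(i <- s) a i).
Proof.
move=> h; elim: s => [|i s IH].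
  rewrite big_nil (_ : (fun t => _) = (fun=> 0)); first exact: dcst.
  by apply/funext => t; rewrite big_nil.
rewrite big_cons (_ : (fun t => _) = (fun t => F i t + \sum_(i <- s) F i t)); first exact: dDf.
by apply/funext => t; rewrite big_cons.
Qed.

Lemma is_derive_continuous f (x a : R) : is_derive x 1 f a -> {for x, continuous f}.
Proof. by move=> [h _]; apply: differentiable_continuous; exact/derivable1_diffP. Qed.

End LambdaDerivatives.

Section Splines.
Context {R : realType}.

Definition rl (t : R) : R := Num.max t 0.

Lemma rl_ge0 t : 0 <= rl t. Proof. by rewrite le_max lexx orbT. Qed.

Lemma rl_pos t : 0 <= t -> rl t = t. Proof. by move=> t0; rewrite /rl max_l. Qed.

Lemma rl_neg t : t <= 0 -> rl t = 0. Proof. by move=> t0; rewrite /rl max_r. Qed.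

Lemma rl_le t (M : R) : 0 <= M -> t <= M -> rl t <= M.
Proof. by move=> M0 tM; rewrite /rl ge_max tM. Qed.

Lemma rlE t : rl t = (t + `|t|) / 2.
Proof.
have [t0|t0] := leP 0 t; first by rewrite rl_pos// ger0_norm//; lra.
by rewrite rl_neg ?(ltW t0)// ltr0_norm//; lra.
Qed.

Lemma continuous_rl : continuous rl.
Proof.
move=> t; rewrite (_ : rl = fun t => (t + `|t|) / 2); last by apply/funext => u; exact: rlE.
apply: cvgM; last exact: cvg_cst.
by apply: cvgD; [exact: cvg_id|apply: cvg_norm; exact: cvg_id].
Qed.

Lemma continuous_rlX k : continuous (fun t => rl t ^+ k).
Proof.
move=> t; apply: (@continuous_comp _ _ _ rl (fun z => z ^+ k)); last exact: exprn_continuous.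
exact: continuous_rl.
Qed.

(** Away from 0 the function is locally 0 or a power; at 0 Caratheodory's criterion applies with the
    slope function [rl z ^+ k.+1]. *)
Lemma is_derive_rlX k (x : R) :
  is_derive x 1 (fun t => rl t ^+ k.+2) (k.+2%:R * rl x ^+ k.+1).
Proof.
have [x0|x0|->] := ltgtP x 0.
- rewrite (rl_neg (ltW x0)) expr0n mulr0.
  apply: (@near_eq_is_derive _ _ _ (cst 0)).
  near=> t; rewrite rl_neg ?expr0n//; apply: ltW; near: t; exact: lt_nbhsl.
- rewrite (rl_pos (ltW x0)).
  apply: (@near_eq_is_derive _ _ _ (fun t : R => t ^+ k.+2)).
    near=> t; rewrite rl_pos//; apply: ltW; near: t; exact: lt_nbhsr.
  have H : is_derive x 1 ((id : R -> R) ^+ k.+2) ((k.+2%:R * x ^+ k.+1) *: 1).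
    exact: (@is_deriveX _ _ (id : R -> R) k.+2 x 1 1 _).
  have -> : (fun t : R => t ^+ k.+2) = (id : R -> R) ^+ k.+2.
    by apply/funext => t; rewrite fctE.
  by apply: (deq H); rewrite /GRing.scale /= mulr1.
- apply/is_derive1_caratheodory; exists (fun z => rl z ^+ k.+1); split.
  + move=> z; rewrite (rl_neg (lexx 0)) expr0n !subr0 exprSr.
    by have [z0|z0] := leP 0 z; [rewrite (rl_pos z0)|rewrite (rl_neg (ltW z0)) expr0n /= !mul0r].
  + exact: continuous_rlX.
  + by rewrite (rl_neg (lexx 0)) expr0n mulr0.
Unshelve. all: by end_near. Qed.

(** The symmetric weights at the nodes -3, ..., 3 whose moments of orders 0, 2 and 6 vanish and
    whose fourth moment is 144. The vanishing sixth moment removes from [spl 6], right of the nodes,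
    a constant that would scale like e^2 and spoil the cancellation between scales. *)
Definition spc (j : nat) : R := nth 0 [:: -1; 12; -39; 56; -39; 12; -1] j.

(* Normalised so that the derivative of spl p.+1 is spl p; the coefficients make
   spl 6 equal to 3 s^2 beyond the last node, hence spl 2 approximate 6 delta'. *)
Definition spl (p : nat) (s : R) : R :=
  \sum_(j < 7) spc j / (p`!)%:R * rl (s + 3 - (j : nat)%:R) ^+ p.

Lemma is_derive_spl p (s : R) : is_derive s 1 (spl p.+2) (spl p.+1 s).
Proof.
apply: dsum => j.
have H1 : is_derive s 1 (fun s : R => s + 3 - (j : nat)%:R) (1 + 0 + 0).
  exact: (dDf (dDf (did s) (dcst _ s)) (dcst _ s)).
have H2 : is_derive s 1 (fun t : R => rl (t + 3 - (j : nat)%:R) ^+ p.+2)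
    (p.+2%:R * rl (s + 3 - (j : nat)%:R) ^+ p.+1 * (1 + 0 + 0)).
  exact: (dcomp H1 (is_derive_rlX p (s + 3 - (j : nat)%:R))).
apply: (deq (dZf (spc j / (p.+2)`!%:R) H2)).
rewrite !addr0 mulr1 mulrA; congr (_ * _).
rewrite [X in X%:R^-1]factS natrM.
have a0 : (p.+1)`!%:R != 0 :> R by rewrite pnatr_eq0 -lt0n fact_gt0.
have b0 : p.+2%:R != 0 :> R by rewrite pnatr_eq0.
by move: (p.+2%:R) ((p.+1)`!%:R) a0 b0 => u v a0 b0; field; rewrite a0 b0.
Qed.

Lemma spl_left p (s : R) : s <= -3 -> spl p.+1 s = 0.
Proof.
move=> s3; apply: big1 => j _; rewrite rl_neg ?expr0n ?mulr0//.
have : 0 <= (j : nat)%:R :> R by []. lra.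
Qed.

Lemma spl_rightE p (s : R) : 3 <= s ->
  spl p s = (- (s + 3) ^+ p + 12 * (s + 2) ^+ p - 39 * (s + 1) ^+ p + 56 * s ^+ p
    - 39 * (s - 1) ^+ p + 12 * (s - 2) ^+ p - (s - 3) ^+ p) / (p`!)%:R.
Proof.
move=> s3; have f0 : (p`!)%:R != 0 :> R by rewrite pnatr_eq0 -lt0n fact_gt0.
rewrite /spl (eq_bigr (fun j : 'I_7 => spc j / (p`!)%:R * (s + 3 - (j : nat)%:R) ^+ p)); last first.
  move=> j _; rewrite rl_pos//.
  have : (j : nat)%:R <= 6%:R :> R by rewrite ler_nat -ltnS.
  lra.
rewrite !big_ord_recl big_ord0 /spc /=.
rewrite (_ : s + 3 - 0%:R = s + 3); last by rewrite subr0.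
rewrite (_ : s + 3 - 1%:R = s + 2); last by ring.
rewrite (_ : s + 3 - 2%:R = s + 1); last by ring.
rewrite (_ : s + 3 - 3%:R = s); last by ring.
rewrite (_ : s + 3 - 4%:R = s - 1); last by ring.
rewrite (_ : s + 3 - 5%:R = s - 2); last by ring.
rewrite (_ : s + 3 - 6%:R = s - 3); last by ring.
by field.
Qed.

Lemma spl_right (s : R) : 3 <= s -> [/\ spl 6 s = 3 * s ^+ 2, spl 5 s = 6 * s,
  spl 4 s = 6, spl 3 s = 0 & spl 2 s = 0].
Proof.
by move=> s3; split; rewrite spl_rightE// /factorial /=; field.
Qed.

(** The range s <= 6 is what the half scale requires: |t| < 3 e gives t / (e / 2) < 6. *)
Lemma spl_bound : exists2 M : R, 0 <= M & forall p (s : R), (p <= 6)%N -> s <= 6 -> `|spl p s| <= M.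
Proof.
exists (\sum_(j < 7) 56 * 9 ^+ 6); first by apply: sumr_ge0.
move=> p s p6 s6; apply: le_trans (ler_norm_sum _ _ _) _; apply: ler_sum => j _.
rewrite normrM ler_pM//.
  rewrite normrM -[leRHS]mulr1 ler_pM//.
    by case: j => [[|[|[|[|[|[|[|j]]]]]]] //= _]; rewrite /spc /= ler_norml; apply/andP; split; lra.
  by rewrite normfV ger0_norm// invf_le1 ?ler1n ?ltr0n ?fact_gt0.
rewrite ger0_norm ?exprn_ge0 ?rl_ge0//.
apply: (@le_trans _ _ (9 ^+ p)).
  apply: lerXn2r; rewrite ?nnegrE ?rl_ge0//.
  by apply: rl_le => //; have : 0 <= (j : nat)%:R :> R by []; lra.
by rewrite ler_eXn2l//; lra.
Qed.

(* The factor is e^(p - 4), also for p < 4; it makes sc e p the derivative of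
   sc e p.+1, and sc e 2 an approximation of 6 delta' at scale e. *)
Definition sc (e : R) (p : nat) (s : R) : R := e ^+ p / e ^+ 4 * spl p (s / e).

Lemma is_derive_sc (e : R) p (s : R) : e != 0 -> is_derive s 1 (sc e p.+2) (sc e p.+1 s).
Proof.
move=> e0.
have H1 : is_derive s 1 (fun t => t / e) (1 * e^-1 + s * 0) by exact: (dMf (did s) (dcst _ s)).
apply: (deq (dZf (e ^+ p.+2 / e ^+ 4) (dcomp H1 (is_derive_spl p (s / e))))).
by rewrite /sc mulr0 addr0 mul1r exprS; field.
Qed.

Definition dsc (e : R) (p : nat) (s : R) : R := sc e p s - sc (e / 2) p s.

Lemma is_derive_dsc (e : R) p (s : R) : e != 0 -> is_derive s 1 (dsc e p.+2) (dsc e p.+1 s).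
Proof.
move=> e0; have e20 : e / 2 != 0 by rewrite mulf_neq0// invr_eq0.
rewrite /dsc (_ : (fun s => _) = fun s => sc e p.+2 s + -1 * sc (e / 2) p.+2 s).
  by apply: (deq (dDf (is_derive_sc p s e0) (dZf (-1) (is_derive_sc p s e20)))); rewrite mulN1r.
by apply/funext => t; rewrite mulN1r.
Qed.

Lemma sc_out (e s : R) : 0 < e -> 3 * e <= `|s| -> sc e 2 s = 0.
Proof.
move=> e0; rewrite /sc; have [s0|s0] := leP 0 s => h.
  rewrite ger0_norm// in h.
  have h1 : 3 <= s / e by rewrite ler_pdivlMr.
  by have [_ _ _ _ ->] := spl_right h1; rewrite mulr0.
rewrite ltr0_norm// in h.
by rewrite spl_left ?mulr0// ler_pdivrMr//; lra.
Qed.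

(** Right of 3 e the profile of scale e is 0, 0, 6, 6 s, 3 s^2 for p = 2, ..., 6, whatever e is, so
    the two scales cancel; on the left both vanish. Thus the difference keeps its compact support
    through four antiderivatives. *)
Lemma dsc_out (e : R) p (s : R) : 0 < e -> (2 <= p <= 6)%N -> 3 * e <= `|s| -> dsc e p s = 0.
Proof.
move=> e0 p26 h; rewrite /dsc /sc.
have en : e != 0 by rewrite gt_eqF.
have i0 : 0 < e^-1 by rewrite invr_gt0.
have [s0|s0] := leP 0 s.
  rewrite ger0_norm// in h.
  have h1 : 3 <= s / e by rewrite ler_pdivlMr.
  have h2 : 3 <= s / (e / 2) by rewrite ler_pdivlMr; lra.
  have [a6 a5 a4 a3 a2] := spl_right h1; have [b6 b5 b4 b3 b2] := spl_right h2.
  by case: p p26 => [|[|[|[|[|[|[|p]]]]]]]// _;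
    rewrite ?a6 ?b6 ?a5 ?b5 ?a4 ?b4 ?a3 ?b3 ?a2 ?b2; field.
rewrite ltr0_norm// in h.
have h1 : s / e <= -3 by rewrite ler_pdivrMr//; lra.
have h2 : s / (e / 2) <= -3 by rewrite ler_pdivrMr//; lra.
by case: p p26 => [//|p] _; rewrite !spl_left// !mulr0 subrr.
Qed.

(** The factor 5 is 1 + 4: the half scale contributes 2^(4 - p), which is at most 4 for p >= 2. *)
Lemma dsc_bound : exists2 M : R, 0 <= M & forall (e : R) p (s : R), 0 < e -> (2 <= p <= 6)%N ->
  `|dsc e p s| <= M * (e ^+ p / e ^+ 4).
Proof.
have [M M0 hM] := spl_bound; exists (5 * M); first by rewrite mulr_ge0.
move=> e p s e0 p26.
have en : e != 0 by rewrite gt_eqF.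
have q0 : 0 <= e ^+ p / e ^+ 4 by rewrite divr_ge0// exprn_ge0// ltW.
have [h|h] := leP (3 * e) `|s|; first by rewrite dsc_out// normr0 mulr_ge0// mulr_ge0.
have [_ /ltr_normlP] := (I, h); move=> [h1 h2].
have a1 : s / e <= 6 by rewrite ler_pdivrMr//; lra.
have a2 : s / (e / 2) <= 6 by rewrite ler_pdivrMr//; lra.
have p6 : (p <= 6)%N by case/andP : p26.
apply: le_trans (ler_normB _ _) _.
have -> : 5 * M * (e ^+ p / e ^+ 4) = e ^+ p / e ^+ 4 * M + 4 * (e ^+ p / e ^+ 4) * M by ring.
have q1 : 0 <= (e / 2) ^+ p / (e / 2) ^+ 4 by rewrite divr_ge0// exprn_ge0// divr_ge0// ltW.
rewrite /sc; apply: lerD.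
  by rewrite normrM (ger0_norm q0) ler_wpM2l// hM.
rewrite normrM (ger0_norm q1) ler_pM// ?hM//.
have -> : (e / 2) ^+ p / (e / 2) ^+ 4 = 16 / 2 ^+ p * (e ^+ p / e ^+ 4).
  have t0 : (2 : R) ^+ p != 0 by rewrite expf_neq0.
  by rewrite !expr_div_n; field; rewrite t0 en.
rewrite ler_wpM2r//.
by case: p p26 {p6 q0 q1} => [|[|[|[|[|[|[|p]]]]]]]// _; rewrite ler_pdivrMr; lra.
Qed.

Lemma spl_continuous p : continuous (spl p.+2).
Proof. by move=> s; exact: is_derive_continuous (is_derive_spl p s). Qed.

End Splines.

Lemma Rintegral_lim0 d (T : measurableType d) (R : realType) (mu : {measure set T -> \bar R})
  (h : nat -> T -> R) (g F : T -> R) :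
  (forall k, measurable_fun setT (h k)) -> measurable_fun setT g ->
  (forall y, h ^~ y @ \oo --> g y) -> mu.-integrable setT (EFin \o F) ->
  (forall k y, `|h k y| <= F y) ->
  (forall k, mu.-integrable setT (EFin \o h k)) -> mu.-integrable setT (EFin \o g) ->
  (forall k, \int[mu]_y h k y = 0) -> \int[mu]_y g y = 0.
Proof.
move=> mh mg hg iF hF ih ig h0.
have [] := @dominated_convergence _ T R mu setT measurableT
  (fun k y => (h k y)%:E) (fun y => (g y)%:E) (EFin \o F).
- by move=> k; exact/measurable_EFinP.
- exact/measurable_EFinP.
- by apply/aeW => y _; apply: cvg_EFin; [exact: nearW|exact: hg].
- exact: iF.
- by apply/aeW => y k _; rewrite lee_fin.
move=> _ _ D.
have E : (fun k => \int[mu]_y (h k y)%:E)%E = fun=> 0%E.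
  by apply/funext => k; rewrite -Rintegral_fineK// h0.
move: D; rewrite E => D.
have Z := cvg_unique (@ereal_hausdorff R) D (cvg_cst (0 : \bar R)).
by rewrite /Rintegral Z.
Qed.

(** * Integration by parts along rotations *)

Section DirectionalDerivatives.
Context {R : realType} {n : nat}.
Local Notation G := 'rV[R]_n.+1.
Local Notation B := (borel_rV R n.+1).
Implicit Types (f g : G -> R) (y x : G) (i : 'I_n.+1).

(** Partial derivatives are one-variable derivatives along the axis through [y], so that the chain
    rule and the mean value theorem on the line apply directly. *)
Definition pdv i g y (d : R) : Prop := is_derive (0 : R) 1 (fun t => g (t *: ev i + y)) d.

Lemma ev_norm i : `|ev i : G| <= 1.
Proof.
apply/normr_rV_le => // j; rewrite !mxE eqxx /=.
by case: (j == i); rewrite ?normr1 ?normr0.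
Qed.

Lemma pdv_line i g (g' : G -> R) y (s : R) : (forall z, pdv i g z (g' z)) ->
  is_derive s 1 (fun t => g (t *: ev i + y)) (g' (s *: ev i + y)).
Proof.
move=> h.
have H1 : is_derive s 1 (fun t : R => t - s) (1 + 0) by exact: (dDf (did s) (dcst _ s)).
have H2 : is_derive (s - s) 1 (fun t : R => g (t *: ev i + (s *: ev i + y))) (g' (s *: ev i + y)).
  by rewrite subrr; exact: h.
have := dcomp H1 H2; rewrite addr0 mulr1 => H.
rewrite (_ : (fun t : R => g (t *: ev i + y)) = fun t : R => g ((t - s) *: ev i + (s *: ev i + y))) //.
by apply/funext => t; rewrite addrA -scalerDl subrK.
Qed.

Lemma pdvM i f g y a b : pdv i f y a -> pdv i g y b -> pdv i (fun z => f z * g z) y (a * g y + f y * b).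
Proof. by move=> fa gb; have := dMf fa gb; rewrite scale0r add0r. Qed.

Lemma pdvD i f g y a b : pdv i f y a -> pdv i g y b -> pdv i (fun z => f z + g z) y (a + b).
Proof. exact: dDf. Qed.

Lemma pdv_cst i c y : pdv i (fun=> c) y 0.
Proof. exact: dcst. Qed.

Lemma pdv_comp i g (phi : R -> R) y a b : pdv i g y a -> is_derive (g y) 1 phi b ->
  pdv i (fun z => phi (g z)) y (b * a).
Proof. by move=> ga pb; apply: (dcomp ga); rewrite scale0r add0r. Qed.

Lemma pdv_coord i j y : pdv i (fun z => z ord0 j) y (j == i)%:R.
Proof.
rewrite /pdv (_ : (fun t : R => _) = fun t : R => (j == i)%:R * t + y ord0 j); last first.
  by apply/funext => t; rewrite coord_shift; case: eqP; rewrite ?mul1r ?mul0r.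
apply: (deq (dDf (dZf _ (did 0)) (dcst (y ord0 j) 0))).
by rewrite mulr1 addr0.
Qed.

Lemma pdv_shift i g x y a : pdv i g (x + y) a -> pdv i (fun z => g (x + z)) y a.
Proof.
rewrite /pdv; congr is_derive; apply/funext => t; congr g.
by rewrite addrCA.
Qed.

Lemma pdv_qf i y : pdv i (qf : G -> R) y (2 * y ord0 i).
Proof.
rewrite /pdv (_ : (fun t : R => _) = fun t : R => (2 * y ord0 i) * t + (t * t + qf y)); last first.
  by apply/funext => t; rewrite qf_shift; ring.
apply: (deq (dDf (dZf _ (did 0)) (dDf (dMf (did 0) (did 0)) (dcst (qf y) 0)))).
by rewrite !mul0r !mulr1 !addr0 mulr0 addr0.
Qed.

Lemma pdv_near0 i g y : (\forall t \near (0 : R), g (t *: ev i + y) = 0) -> pdv i g y 0.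
Proof.
move=> h; apply: (@near_eq_is_derive _ _ _ (fun _ : R => 0)).
by apply: filterS h => t ->.
Qed.

Lemma pdv_uniq i g y a b : pdv i g y a -> pdv i g y b -> a = b.
Proof. by move=> [_ <-] [_ <-]. Qed.

Lemma line_continuous i y : continuous (fun t : R => t *: ev i + y : G).
Proof.
move=> t; apply: cvgD; last exact: cvg_cst.
by apply: cvgZr_tmp; exact: cvg_id.
Qed.

Lemma bsuppZ (c : R) g : bsupp g -> bsupp (fun y => c * g y).
Proof.
move=> [mg [M gM] [r gr]]; split.
- by apply: measurable_funM => //; exact: measurable_cst.
- by exists (`|c| * M) => y; rewrite normrM ler_wpM2l.
- by exists r => y /gr ->; rewrite mulr0.
Qed.

Variable mu : {sigma_finite_measure set B -> \bar R}.
Hypothesis hmu : haar_measure mu.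

(* Translation invariance makes the difference quotients integrate to 0. *)
Lemma Rintegral_pdv i g (g' : G -> R) : (forall y, pdv i g y (g' y)) -> bsupp g -> bsupp g' ->
  \int[mu]_y g' y = 0.
Proof.
move=> hg bg bg'.
have [N [r' [N0 r'0 gN gr']]] := bsupp_bound bg.
have [M [r [M0 r0 gM gr]]] := bsupp_bound bg'.
have [mg _ _] := bg; have [mg' _ _] := bg'.
pose t k : R := k.+1%:R^-1.
have t0 k : 0 < t k by rewrite invr_gt0.
have t1 k : t k <= 1 by rewrite invf_le1// ler1n.
have tc : t @ \oo --> (0 : R) by exact: cvg_harmonic.
pose h k y := (t k)^-1 * (g (t k *: ev i + y) - g y).
have bh k : bsupp (h k).
  by apply: bsuppZ; apply: bsuppB => //; exact: bsupp_shift.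
have Ih k : \int[mu]_y h k y = 0.
  have ig := bsupp_integrable hmu bg; have igs := integrable_shift hmu (t k *: ev i) ig.
  rewrite RintegralZl//; last exact: integrableBR.
  by rewrite RintegralB// (Rintegral_shift hmu)// subrr mulr0.
(* Domination: the mean value theorem bounds the quotients by the bound M of g', and the steps t k
   <= 1 keep them supported in the cube of radius r' + 1. *)
have hb k y : `|h k y| <= M * \1_(cube (r' + 1)) y.
  have tev : `|t k *: ev i| <= 1.
    rewrite normrZ gtr0_norm//; apply: le_trans (t1 k).
    by rewrite ler_piMr ?ev_norm// ltW.
  have [y1|y1] := leP `|y| (r' + 1); last first.
    rewrite /h gr' ?gr' ?subrr ?mulr0 ?normr0 ?mulr_ge0//; last first.
      have := ler_normB (t k *: ev i + y) (t k *: ev i); rewrite addrAC subrr add0r; lra.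
    lra.
  rewrite indicE mem_set//= mulr1 /h.
  have [|cc _] := @MVT R (fun s => g (s *: ev i + y)) (fun s => g' (s *: ev i + y)) 0 (t k) (t0 k)
    (fun s _ => pdv_line y s hg).
    apply: continuous_subspaceT => s; exact: is_derive_continuous (pdv_line y s hg).
  rewrite scale0r add0r subr0 => ->.
  by rewrite mulrCA mulVf ?mulr1// gt_eqF.
have hc y : h ^~ y @ \oo --> g' y.
  have /is_derive1_caratheodory[phi [pE pc p0]] := hg y.
  rewrite -p0 (_ : h ^~ y = phi \o t).
    exact: (cvg_comp _ _ tc pc).
  apply/funext => k; rewrite /h /=; have := pE (t k); rewrite scale0r add0r => ->.
  by rewrite subr0 mulrCA mulVf ?mulr1// gt_eqF.
apply: (@Rintegral_lim0 _ B R mu h g' (fun y => M * \1_(cube (r' + 1)) y)) => //.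
- by move=> k; case: (bh k).
- exact: (integrableZR M (integrable_indic_cube hmu (r' + 1))).
- by move=> k; exact: bsupp_integrable.
- exact: bsupp_integrable.
Qed.

End DirectionalDerivatives.

Section Symbols.
Context {R : realType}.

(* Polynomials in y_o, y_j, 1/(y_o - lam y_j), x_o and lam: a class that is stable
   under the derivations d/dy_o and d/dy_j and whose members are bounded on the
   region of integration independently of x. *)
Inductive sym : Type :=
| Cst of R | Yo | Yj | Ei | Xo | Lam | Add of sym & sym | Mul of sym & sym.

Fixpoint sval_ (s : sym) (yo yj e xo lam : R) : R :=
  match s with
  | Cst c => c | Yo => yo | Yj => yj | Ei => e | Xo => xo | Lam => lam
  | Add a b => sval_ a yo yj e xo lam + sval_ b yo yj e xo lam
  | Mul a b => sval_ a yo yj e xo lam * sval_ b yo yj e xo lam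
  end.

Fixpoint Do (s : sym) : sym :=
  match s with
  | Yo => Cst 1 | Ei => Mul (Cst (-1)) (Mul Ei Ei)
  | Add a b => Add (Do a) (Do b)
  | Mul a b => Add (Mul (Do a) b) (Mul a (Do b))
  | _ => Cst 0
  end.

Fixpoint Dj (s : sym) : sym :=
  match s with
  | Yj => Cst 1 | Ei => Mul Lam (Mul Ei Ei)
  | Add a b => Add (Dj a) (Dj b)
  | Mul a b => Add (Mul (Dj a) b) (Mul a (Dj b))
  | _ => Cst 0
  end.

Lemma sval_bound (s : sym) : exists2 C : R, 0 <= C & forall yo yj e xo lam,
  `|yo| <= 2 -> `|yj| <= 2 -> `|e| <= 2 -> `|xo| <= 2 -> `|lam| <= 2 ->
  `|sval_ s yo yj e xo lam| <= C.
Proof.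
elim: s => [c|||||| a [Ca Ca0 ha] b [Cb Cb0 hb]|a [Ca Ca0 ha] b [Cb Cb0 hb]].
- by exists `|c|.
- by exists 2.
- by exists 2.
- by exists 2.
- by exists 2.
- by exists 2.
- exists (Ca + Cb); first exact: addr_ge0.
  by move=> *; rewrite (le_trans (ler_normD _ _))// lerD ?ha ?hb.
- exists (Ca * Cb); first exact: mulr_ge0.
  by move=> *; rewrite /= normrM ler_pM ?ha ?hb.
Qed.

End Symbols.
Arguments sym : clear implicits.

(* x / (x^2 + 1/k) -> 1/x pointwise, including x = 0 where 0^-1 = 0. *)
Lemma measurable_invr (R : realType) : measurable_fun setT (fun t : R => t^-1).
Proof.
pose h (k : nat) (t : R) := t * (t * t + k.+1%:R^-1)^-1.
have pos k t : 0 < t * t + k.+1%:R^-1 :> R.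
  by rewrite ltr_wpDl ?invr_gt0// -expr2 sqr_ge0.
apply: (@measurable_fun_cvg _ _ _ _ h).
  move=> k; apply: continuous_measurable_fun => t.
  apply: cvgM; first exact: cvg_id.
  apply: cvgV; first by rewrite gt_eqF.
  by apply: cvgD; [apply: cvgM; exact: cvg_id|exact: cvg_cst].
move=> t _; have [->|t0] := eqVneq t 0.
  rewrite invr0 (_ : h ^~ 0 = fun=> 0); first exact: cvg_cst.
  by apply/funext => k; rewrite /h mul0r.
rewrite (_ : t^-1 = t * (t * t + 0)^-1); last by field.
apply: cvgM; first exact: cvg_cst.
apply: cvgV; first by rewrite addr0 mulf_neq0.
by apply: cvgD; [exact: cvg_cst|exact: cvg_harmonic].
Qed.

Section ByParts.
Context {R : realType} {n : nat}.
Local Notation G := 'rV[R]_n.+1.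
Local Notation B := (borel_rV R n.+1).
Local Notation o := (ord0 : 'I_n.+1).
Implicit Types (f g : G -> R) (x y : G) (i j : 'I_n.+1).

Definition C1 f (fd : 'I_n.+1 -> G -> R) : Prop :=
  [/\ forall i y, pdv i f y (fd i y), continuous f & forall i, continuous (fd i)].

Lemma continuousM_rV f g : continuous f -> continuous g -> continuous (fun y => f y * g y).
Proof. by move=> cf cg y; apply: (@continuousM _ _ f g); [exact: cf|exact: cg]. Qed.

Lemma continuousD_rV f g : continuous f -> continuous g -> continuous (fun y => f y + g y).
Proof. by move=> cf cg y; apply: (@continuousD _ _ _ f g); [exact: cf|exact: cg]. Qed.

Lemma continuous_comp_rV f (phi : R -> R) : continuous f -> continuous phi ->
  continuous (fun y => phi (f y)).
Proof. by move=> cf cp y; apply: (@continuous_comp _ _ _ f phi); [exact: cf|exact: cp]. Qed.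

Lemma continuous_cst_rV (c : R) : continuous (fun _ : G => c).
Proof. exact: cst_continuous. Qed.

Lemma continuous_shift_rV x f : continuous f -> continuous (fun y => f (x + y)).
Proof.
move=> cf y; apply: (@continuous_comp _ _ _ (fun y : G => x + y) f); last exact: cf.
apply: (@continuousD _ _ _ (fun=> x) (fun y : G => y)); first exact: cst_continuous.
exact: cvg_id.
Qed.

Lemma line_near (P : set G) i (y : G) : (\forall z \near y, P z) ->
  \forall t \near (0 : R), P (t *: ev i + y).
Proof.
move=> nn; have c0 : (fun t : R => t *: ev i + y : G) @ (0 : R) --> y.
  by have := @line_continuous _ _ i y 0; rewrite /continuous_at scale0r add0r.
exact: (c0 P nn).
Qed.

Lemma C1M f fd g gd : C1 f fd -> C1 g gd ->
  C1 (fun y => f y * g y) (fun i y => fd i y * g y + f y * gd i y).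
Proof.
move=> [fp cf cfd] [gp cg cgd]; split.
- by move=> i y; exact: pdvM.
- exact: continuousM_rV.
- by move=> i; apply: continuousD_rV; exact: continuousM_rV.
Qed.

Lemma C1_comp f fd (phi phi' : R -> R) : C1 f fd ->
  (forall t : R, is_derive t 1 phi (phi' t)) -> continuous phi' ->
  C1 (fun y => phi (f y)) (fun i y => phi' (f y) * fd i y).
Proof.
move=> [fp cf cfd] pp cp; split.
- by move=> i y; exact: pdv_comp.
- apply: continuous_comp_rV => //; move=> t; exact: is_derive_continuous (pp t).
- by move=> i; apply: continuousM_rV => //; exact: continuous_comp_rV.
Qed.

Lemma C1_shift x f fd : C1 f fd -> C1 (fun y => f (x + y)) (fun i y => fd i (x + y)).
Proof.
move=> [fp cf cfd]; split.
- by move=> i y; apply: pdv_shift; exact: fp.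
- exact: continuous_shift_rV.
- by move=> i; exact: continuous_shift_rV.
Qed.

Lemma C1_coord j : C1 (fun y => y ord0 j) (fun i _ => (j == i)%:R).
Proof.
split; first by move=> i y; exact: pdv_coord.
- exact: coord_continuous.
- by move=> i; exact: continuous_cst_rV.
Qed.

Lemma C1_qf : C1 (qf : G -> R) (fun i y => 2 * y ord0 i).
Proof.
split; first by move=> i y; exact: pdv_qf.
- exact: continuous_qf.
- by move=> i; apply: continuousM_rV; [exact: continuous_cst_rV|exact: coord_continuous].
Qed.

Lemma continuous_bounded_cube f (r : R) : continuous f ->
  exists2 M : R, 0 <= M & forall y, `|y| <= r -> `|f y| <= M.
Proof.
move=> cf; have [_ [M fM] _] := bsupp_cutM r cf; exists `|M| => // y yr.
have := fM y; rewrite indicE mem_set ?mulr1//= => /le_trans; apply; exact: ler_norm.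
Qed.

Variables (x : G) (j : 'I_n.+1) (lam : R).
Hypothesis jo : j != o.
Hypothesis lam2 : `|lam| <= 2.
Hypothesis xo2 : `|x ord0 o| <= 2.

(** The coefficient by which integration by parts divides; it is used with lam = x_o / x_j, and the
    symbol [Ei] is its inverse. *)
Definition mm (y : G) : R := y ord0 o - lam * y ord0 j.

Definition val (s : sym R) (y : G) : R :=
  sval_ s (y ord0 o) (y ord0 j) (mm y)^-1 (x ord0 o) lam.

Lemma continuous_mm : continuous (mm : G -> R).
Proof.
move=> y; rewrite (_ : mm = fun y => y ord0 o + (- lam) * y ord0 j); last first.
  by apply/funext => z; rewrite /mm mulNr.
apply: continuousD_rV; first exact: coord_continuous.
apply: continuousM_rV; [exact: continuous_cst_rV|exact: coord_continuous].
Qed.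

Lemma pdv_mm i y : pdv i mm y ((o == i)%:R + (- lam) * (j == i)%:R).
Proof.
rewrite (_ : mm = fun y => y ord0 o + (- lam) * y ord0 j); last first.
  by apply/funext => z; rewrite /mm mulNr.
apply: pdvD; first exact: pdv_coord.
rewrite -[X in pdv _ _ _ X]add0r -[X in pdv _ _ _ (X + _)](mul0r (y ord0 j)).
apply: (pdvM (f := fun=> - lam)); [exact: pdv_cst|exact: pdv_coord].
Qed.

Lemma pdv_invmm i y : mm y != 0 ->
  pdv i (fun z => (mm z)^-1) y (- (mm y)^-1 ^+ 2 * ((o == i)%:R + (- lam) * (j == i)%:R)).
Proof.
move=> m0; have h := pdv_mm i y.
have H : is_derive (mm y) 1 (fun t : R => t^-1) (- (mm y)^-1 ^+ 2).
  have := @is_deriveV R id (mm y) 1 1 m0 (is_derive_id _ _).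
  by rewrite /= /GRing.scale /= mulr1 exprVn.
exact: (pdv_comp h H).
Qed.

Lemma pdv_val (s : sym R) y : mm y != 0 ->
  pdv o (val s) y (val (Do s) y) /\ pdv j (val s) y (val (Dj s) y).
Proof.
move=> m0; have jo' : (o == j) = false by rewrite eq_sym (negbTE jo).
elim: s => [c||||||a [ao aj] b [bo bj]|a [ao aj] b [bo bj]]; split.
- exact: pdv_cst.
- exact: pdv_cst.
- by have := pdv_coord o o y; rewrite eqxx.
- by have := pdv_coord j o y; rewrite jo'.
- by have := pdv_coord o j y; rewrite (negbTE jo).
- by have := pdv_coord j j y; rewrite eqxx.
- have := pdv_invmm o m0; rewrite eqxx (negbTE jo) mulr0 addr0 mulr1.
  by rewrite /val /= mulN1r expr2.
- have := pdv_invmm j m0; rewrite eqxx jo' add0r mulr1 mulrNN mulrC.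
  by rewrite /val /= expr2.
- exact: pdv_cst.
- exact: pdv_cst.
- exact: pdv_cst.
- exact: pdv_cst.
- exact: pdvD.
- exact: pdvD.
- exact: pdvM.
- exact: pdvM.
Qed.

Lemma measurable_val (s : sym R) : measurable_fun (setT : set B) (val s : B -> R).
Proof.
elim: s => [c||||||a ma b mb|a ma b mb].
- exact: measurable_cst.
- exact: coord_measurable_rV.
- exact: coord_measurable_rV.
- apply: (measurableT_comp (f := fun t : R => t^-1)).
    exact: measurable_invr.
  by apply: continuous_measurable_rV; exact: continuous_mm.
- exact: measurable_cst.
- exact: measurable_cst.
- exact: measurable_funD.
- exact: measurable_funM.
Qed.

Definition region (y : G) : Prop := 1 / 2 <= `|mm y| /\ `|y| <= 2.

Lemma val_bound (s : sym R) : exists2 C : R, 0 <= C & forall y, region y -> `|val s y| <= C.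
Proof.
have [C C0 hC] := sval_bound s; exists C => // y [m1 y2]; apply: hC => //.
- exact: le_trans (coord_le_normr _ _) y2.
- exact: le_trans (coord_le_normr _ _) y2.
- rewrite normfV -[leRHS]invrK lef_pV2 ?posrE; lra.
Qed.

Lemma not_region_near y : ~ region y -> \forall z \near y, ~ region z.
Proof.
have cl : closed region.
  rewrite (_ : region = [set y | 1 / 2 <= `|mm y|] `&` cube 2); last by apply/seteqP; split.
  apply: closedI.
    rewrite (_ : [set y | _] = (fun y : G => `|mm y|) @^-1` [set z | 1 / 2 <= z])//.
    apply: closed_comp => [z _|]; last exact: closed_ge.
    apply: (@continuous_comp _ _ _ (mm : G -> R) (fun z : R => `|z|)); first exact: continuous_mm.
    exact: (@norm_continuous _ R).
  exact: compact_closed (@cube_compact R n 2).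
by move=> ny; have := closed_openC cl; rewrite openE => /(_ y ny).
Qed.

Variable mu : {sigma_finite_measure set B -> \bar R}.
Hypothesis hmu : haar_measure mu.

Lemma C1_outside f fd : C1 f fd -> (forall y, f y != 0 -> region y) ->
  forall i y, fd i y != 0 -> region y.
Proof.
move=> [fp cf cfd] fr i y; apply: contra_neqP => ny.
apply: (pdv_uniq (fp i y)); apply: pdv_near0.
have nn := not_region_near ny.
apply: filterS (line_near i nn) => t nr.
by apply/eqP; apply: contra_notT nr => /fr.
Qed.

(** At a zero of [mm] the product rule has no derivative of the symbol to work with, but such a
    point lies outside the closed region, so f vanishes in a neighbourhood and both terms are 0. *)
Lemma pdv_C1_val f fd (s : sym R) i (d : G -> R) : C1 f fd -> (forall y, f y != 0 -> region y) ->
  (forall y, mm y != 0 -> pdv i (val s) y (d y)) ->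
  forall y, pdv i (fun z => f z * val s z) y (fd i y * val s y + f y * d y).
Proof.
move=> Cf fr hd y; have [fp cf cfd] := Cf.
have [m0|m0] := eqVneq (mm y) 0; last by apply: pdvM; [exact: fp|exact: hd].
have ny : ~ region y by rewrite /region m0 normr0 => -[]; lra.
have -> : fd i y = 0.
  by apply/eqP; apply: contra_notT ny; exact: (C1_outside Cf fr).
have -> : f y = 0 by apply/eqP; apply: contra_notT ny; exact: fr.
rewrite !mul0r addr0; apply: pdv_near0.
have nn := not_region_near ny.
apply: filterS (line_near i nn) => t nr.
have -> : f (t *: ev i + y) = 0 by apply/eqP; apply: contra_notT nr => /fr.
by rewrite mul0r.
Qed.

Lemma bsupp_region f (s : sym R) : continuous f -> (forall y, f y != 0 -> region y) ->
  bsupp (fun y => f y * val s y).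
Proof.
move=> cf fr; have [M M0 fM] := continuous_bounded_cube 2 cf.
have [C C0 hC] := val_bound s; split.
- by apply: measurable_funM; [exact: continuous_measurable_rV|exact: measurable_val].
- exists (M * C) => y; have [->|f0] := eqVneq (f y) 0; first by rewrite mul0r normr0 mulr_ge0.
  have ry := fr y f0; rewrite normrM ler_pM//; last exact: hC.
  by apply: fM; case: ry.
- exists 2 => y y2; have [->|f0] := eqVneq (f y) 0; first by rewrite mul0r.
  by have [_] := fr y f0; rewrite leNgt y2.
Qed.

(* The rotation field y_o d_j - y_j d_o is divergence free. *)
Lemma Rintegral_rotation f fd (s : sym R) : C1 f fd -> (forall y, f y != 0 -> region y) ->
  \int[mu]_y ((y ord0 o * fd j y - y ord0 j * fd o y) * val s y
    + f y * (y ord0 o * val (Dj s) y - y ord0 j * val (Do s) y)) = 0.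
Proof.
move=> Cf fr; have [fp cf cfd] := Cf.
pose f1 i y := y ord0 i * f y.
(* The coefficient y_k does not involve the variable of differentiation, so each half of the field
   yields an exact partial derivative. *)
have C1i (k i : 'I_n.+1) : k != i -> forall (d : G -> R) (s' : sym R),
    (forall y, mm y != 0 -> pdv i (val s) y (d y)) -> (forall y, d y = val s' y) ->
    bsupp (fun y => (y ord0 k * fd i y) * val s y + (y ord0 k * f y) * val s' y) /\
    \int[mu]_y ((y ord0 k * fd i y) * val s y + (y ord0 k * f y) * val s' y) = 0.
  move=> ki d s' hd ds.
  have Ck := C1M (C1_coord k) Cf.
  have rk y : y ord0 k * f y != 0 -> region y.
    by rewrite mulf_eq0 negb_or => /andP[_ /fr].
  have rk' y : y ord0 k * fd i y != 0 -> region y.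
    by rewrite mulf_eq0 negb_or => /andP[_]; exact: (C1_outside Cf fr).
  have P := pdv_C1_val Ck rk hd.
  have b1 : bsupp (fun y => (y ord0 k * fd i y) * val s y).
    by apply: bsupp_region => //; apply: continuousM_rV => //; exact: coord_continuous.
  have b2 : bsupp (fun y => (y ord0 k * f y) * val s' y).
    by apply: bsupp_region => //; apply: continuousM_rV => //; exact: coord_continuous.
  have b3 : bsupp (fun y => (y ord0 k * f y) * val s y).
    by apply: bsupp_region => //; apply: continuousM_rV => //; exact: coord_continuous.
  have b4 : bsupp (fun y => (y ord0 k * fd i y) * val s y + (y ord0 k * f y) * val s' y).
    have := bsuppB b1 (bsuppZ (-1) b2); congr bsupp.
    by apply/funext => y; rewrite mulN1r opprK.
  split=> //.
  apply: (@Rintegral_pdv _ _ mu hmu i (fun y => (y ord0 k * f y) * val s y)) => //.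
  move=> y; have := P y; rewrite (negbTE ki) mul0r add0r ds.
  done.
have [b1 I1] := C1i o j (negbT (etrans (eq_sym _ _) (negbTE jo))) _ (Dj s)
  (fun y m0 => (pdv_val s m0).2) (fun=> erefl).
have [b2 I2] := C1i j o jo _ (Do s) (fun y m0 => (pdv_val s m0).1) (fun=> erefl).
rewrite -[RHS](subrr 0) -{1}I1 -{1}I2 -RintegralB//; last 2 first.
- exact: bsupp_integrable.
- exact: bsupp_integrable.
by apply: eq_Rintegral => y _; ring.
Qed.

End ByParts.

(** * The kernel under iterated integration by parts *)

Section Kernel.
Context {R : realType} {n : nat}.
Local Notation G := 'rV[R]_n.+1.
Local Notation B := (borel_rV R n.+1).
Local Notation o := (ord0 : 'I_n.+1).
Variable mu : {sigma_finite_measure set B -> \bar R}.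
Hypothesis hmu : haar_measure mu.
Variable c : R.
Hypothesis c12 : 1 / 2 <= c.

Lemma continuous_sum_fun (I : Type) (s : seq I) (F : I -> R -> R) :
  (forall i, continuous (F i)) -> continuous (fun t => \sum_(i <- s) F i t).
Proof.
move=> cF; elim: s => [|i s IH] t.
  rewrite (_ : (fun t => _) = fun=> 0); first exact: cst_continuous.
  by apply/funext => u; rewrite big_nil.
rewrite (_ : (fun t => _) = fun t => F i t + \sum_(i <- s) F i t).
  by apply: cvgD; [exact: cF|exact: IH].
by apply/funext => u; rewrite big_cons.
Qed.

Lemma dsc_continuous (e : R) p : continuous (dsc e p.+1).
Proof.
have cs : continuous (spl p.+1 : R -> R).
  apply: continuous_sum_fun => i s.
  apply: cvgM; first exact: cvg_cst.
  apply: (@continuous_comp _ _ _ (fun s : R => s + 3 - (i : nat)%:R) (fun z => rl z ^+ p.+1)).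
    by apply: cvgB; [apply: cvgD; [exact: cvg_id|exact: cvg_cst]|exact: cvg_cst].
  exact: continuous_rlX.
have ck (a : R) : continuous (sc a p.+1).
  move=> s; apply: cvgM; first exact: cvg_cst.
  apply: (@continuous_comp _ _ _ (fun s : R => s / a) (spl p.+1)); last exact: cs.
  by apply: cvgM; [exact: cvg_id|exact: cvg_cst].
by move=> s; apply: cvgB; exact: ck.
Qed.

Definition ramp (y : G) : R := rl (y ord0 o - c).

(** [k] counts the powers of the two ramps still available and [p] is the level of antiderivative of
    the shifted profile; the symbol in [ker_int] collects the remaining coefficient. The
    autocorrelation starts at (k, p) = (5, 2), and four steps lead to (1, 6). *)
Definition ker_fun (x : G) (e : R) k p (y : G) : R :=
  dsc e 2 (qf y) * (dsc e p (qf (x + y)) * (ramp y ^+ k * ramp (x + y) ^+ k)).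

Definition ker_int (x : G) (j : 'I_n.+1) (e : R) k p (s : sym R) : R :=
  \int[mu]_y (ker_fun x e k p y * val x j (x ord0 o / x ord0 j) s y).

(** The last clause keeps the support of the integrand where [mm] has size at least 1/2, so that
    dividing by it is harmless. *)
Definition admissible (x : G) (j : 'I_n.+1) (e : R) : Prop :=
  [/\ 0 < e /\ 3 * e <= 1, j != o /\ x ord0 j != 0, `|x ord0 o| <= 2,
      `|x ord0 o / x ord0 j| <= 2 & forall y : G, `|qf y| < 3 * e -> c < y ord0 o ->
      `|qf (x + y)| < 3 * e -> c < (x + y) ord0 o -> region j (x ord0 o / x ord0 j) y].

Lemma ramp_gt0 y : ramp y != 0 -> c < y ord0 o.
Proof.
by rewrite /ramp; apply: contra_neqT; rewrite -leNgt => h; rewrite rl_neg// subr_le0.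
Qed.

Lemma dsc_supp (e : R) p (t : R) : 0 < e -> (2 <= p <= 6)%N -> dsc e p t != 0 -> `|t| < 3 * e.
Proof. by move=> e0 p26; apply: contra_neqT; rewrite -leNgt => h; exact: dsc_out. Qed.

Lemma ker_fun_supp x e k p y : 0 < e -> (2 <= p <= 6)%N -> ker_fun x e k.+1 p y != 0 ->
  [/\ `|qf y| < 3 * e, c < y ord0 o, `|qf (x + y)| < 3 * e & c < (x + y) ord0 o].
Proof.
move=> e0 p26; rewrite /ker_fun !mulf_eq0 !negb_or !expf_eq0 /= => /and4P[a b d f].
split; [exact: dsc_supp a|exact: ramp_gt0|exact: dsc_supp b|exact: ramp_gt0].
Qed.

Lemma C1_ramp k : C1 (fun y => ramp y ^+ k.+2)
  (fun i y => k.+2%:R * ramp y ^+ k.+1 * (o == i)%:R).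
Proof.
apply: (@C1_comp _ _ _ _ (fun t : R => rl (t - c) ^+ k.+2) (fun t : R => k.+2%:R * rl (t - c) ^+ k.+1)
  (C1_coord o)).
  move=> t; have H1 : is_derive t 1 (fun t : R => t - c) (1 + 0) by exact: (dDf (did t) (dcst _ t)).
  by have := dcomp H1 (is_derive_rlX k (t - c)); rewrite addr0 mulr1.
move=> t; apply: cvgM; first exact: cvg_cst.
apply: (@continuous_comp _ _ _ (fun s : R => s - c) (fun z => rl z ^+ k.+1)).
  by apply: cvgB; [exact: cvg_id|exact: cvg_cst].
exact: continuous_rlX.
Qed.

Lemma C1_dsc e p : e != 0 ->
  C1 (fun y : G => dsc e p.+2 (qf y)) (fun i y => dsc e p.+1 (qf y) * (2 * y ord0 i)).
Proof.
move=> e0; apply: (C1_comp C1_qf); first by move=> t; exact: is_derive_dsc.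
exact: dsc_continuous.
Qed.

Lemma continuous_ramp : continuous ramp.
Proof.
move=> y; apply: (@continuous_comp _ _ _ (fun y : G => y ord0 o - c) rl); last exact: continuous_rl.
by apply: continuousD_rV; [exact: coord_continuous|exact: continuous_cst_rV].
Qed.

Lemma ker_fun_continuous x e k p : continuous (ker_fun x e k p.+1).
Proof.
have cr : continuous (fun y => ramp y ^+ k).
  apply: (@continuous_comp_rV _ _ _ (fun t : R => t ^+ k) continuous_ramp).
  exact: exprn_continuous.
have cd q : continuous (fun y : G => dsc e q.+1 (qf y)).
  exact: (@continuous_comp_rV _ _ _ (dsc e q.+1) (@continuous_qf R n) (@dsc_continuous e q)).
apply: continuousM_rV; first exact: cd.
apply: continuousM_rV; first exact: (continuous_shift_rV (f := fun y : G => dsc e p.+1 (qf y))).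
apply: continuousM_rV => //; exact: (continuous_shift_rV (f := fun y : G => ramp y ^+ k)).
Qed.

Definition sXo : sym R := Add (Add Yo Xo) (Cst (- c)).
Definition sYo : sym R := Add Yo (Cst (- c)).

(** The rotation field applied to the k-th powers of both ramps times [Ei] and [s], with the powers
    k - 1 taken out. The ramps depend on y_o alone, whence the factor -k y_j; [sYo] and [sXo] stand
    for the ramps without positive part, which is correct next to a positive power of each. *)
Definition next_sym k (s : sym R) : sym R :=
  Add (Mul (Mul (Cst (- k%:R)) Yj) (Mul (Add sYo sXo) (Mul Ei s)))
    (Mul (Mul sYo sXo) (Add (Mul Yo (Dj (Mul Ei s))) (Mul (Cst (-1)) (Mul Yj (Do (Mul Ei s)))))).

Lemma rlX_mul k (t : R) : rl t ^+ k.+1 * rl t = rl t ^+ k.+1 * t.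
Proof.
have [t0|t0] := leP 0 t; first by rewrite (rl_pos t0).
by rewrite (rl_neg (ltW t0)) expr0n /= !mul0r.
Qed.

(* The rotation field y_o d_j - y_j d_o annihilates qf y and sends qf (x + y) to
   2 x_j (y_o - (x_o / x_j) y_j), so it can be used to integrate by parts. *)
Lemma ker_int_step x j e k p s : admissible x j e -> (3 <= p.+2 <= 6)%N ->
  2 * x ord0 j * ker_int x j e k.+2 p.+1 s = - ker_int x j e k.+1 p.+2 (next_sym k.+2 s).
Proof.
move=> [[e0 e1] [jo xj0] xo2 lam2 adm] p36.
have p26 : (2 <= p.+2 <= 6)%N by case/andP : p36 => ? ->; rewrite andbT.
have p26' : (2 <= p.+1 <= 6)%N by case/andP : p36 => ? ?; apply/andP; split; lia.
have en : e != 0 by rewrite gt_eqF.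
set lam := x ord0 o / x ord0 j in lam2 adm *.
have Cf := C1M (C1_dsc 0 en) (C1M (C1_shift x (C1_dsc p en))
  (C1M (C1_ramp k) (C1_shift x (C1_ramp k)))).
have fr y : ker_fun x e k.+2 p.+2 y != 0 -> region j lam y.
  by move=> /ker_fun_supp[]// a b d f; exact: adm.
have fr1 y : ker_fun x e k.+2 p.+1 y != 0 -> region j lam y.
  by move=> /ker_fun_supp[]// a b d f; exact: adm.
have fr2 y : ker_fun x e k.+1 p.+2 y != 0 -> region j lam y.
  by move=> /ker_fun_supp[]// a b d f; exact: adm.
(* Dividing the symbol by [mm] beforehand cancels the factor [mm] that appears when the field hits
   the shifted profile. *)
have rot := Rintegral_rotation jo lam2 xo2 hmu (Mul Ei s) Cf fr.
have xo : x ord0 o = lam * x ord0 j by rewrite /lam divfK.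
have b1 := bsupp_region lam2 xo2 s (@ker_fun_continuous x e k.+2 p) fr1.
have b2 := bsupp_region lam2 xo2 (next_sym k.+2 s) (@ker_fun_continuous x e k.+1 p.+1) fr2.
rewrite {Cf}.
have i1 := bsupp_integrable hmu b1; have i2 := bsupp_integrable hmu b2.
have E : \int[mu]_y (2 * x ord0 j * (ker_fun x e k.+2 p.+1 y * val x j lam s y) +
    ker_fun x e k.+1 p.+2 y * val x j lam (next_sym k.+2 s) y) = 0.
  rewrite -[RHS]rot; apply: eq_Rintegral => y _.
  have W : ker_fun x e k.+2 p.+1 y * (mm j lam y * (mm j lam y)^-1) = ker_fun x e k.+2 p.+1 y.
    have [->|/fr1[m0 _]] := eqVneq (ker_fun x e k.+2 p.+1 y) 0; first by rewrite mul0r.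
    rewrite divff ?mulr1//; apply: contraTneq m0 => ->; rewrite normr0 -ltNge; lra.
  have jo' : (o == j) = false by rewrite eq_sym (negbTE jo).
  have xyo : (x + y) ord0 o = x ord0 o + y ord0 o by rewrite mxE.
  have xyj : (x + y) ord0 j = x ord0 j + y ord0 j by rewrite mxE.
  have hP : ramp y ^+ k.+2 = ramp y ^+ k.+1 * (y ord0 o - c) by rewrite exprSr rlX_mul.
  have hQ : ramp (x + y) ^+ k.+2 = ramp (x + y) ^+ k.+1 * (x ord0 o + y ord0 o - c).
    by rewrite -xyo exprSr rlX_mul.
  move: W; rewrite /ker_fun jo' eqxx mulr0 xyo xyj hP hQ /val /= xo.
  move: (ramp y ^+ k.+1) (ramp (x + y) ^+ k.+1) (dsc e 2 _) (dsc e 1 _) (dsc e p.+2 _) (dsc e p.+1 _).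
  have mE : mm j lam y = y ord0 o - lam * y ord0 j by [].
  move: (sval_ s _ _ _ _ _) (sval_ (Do s) _ _ _ _ _) (sval_ (Dj s) _ _ _ _ _).
  move: ((mm j lam y)^-1) => ei; rewrite mE.
  move: (y ord0 o) (y ord0 j) (x ord0 j) (k.+2%:R) => yo yj xj kk vs vo vj P Q a a1 d2 d1 W.
  apply/eqP; rewrite -subr_eq0; apply/eqP.
  (* The two integrands differ by a multiple of 1 - mm / mm, which [W] shows to vanish against the
     kernel. *)
  transitivity (2 * xj * vs * (a * (d1 * (P * (yo - c) * (Q * (lam * xj + yo - c)))) -
    a * (d1 * (P * (yo - c) * (Q * (lam * xj + yo - c)))) * ((yo - lam * yj) * ei))).
    by rewrite {W}; ring.
  by rewrite W subrr mulr0.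
move: E; rewrite RintegralD//; last exact: integrableZR.
rewrite RintegralZl// => E; apply/eqP; rewrite -addr_eq0; apply/eqP.
exact: E.
Qed.

Lemma Rintegral_le_vol (f : G -> R) (A : set G) (D r : R) : bsupp f ->
  measurable (A : set B) -> A `<=` cube r -> 0 <= D ->
  (forall y, f y != 0 -> A y /\ `|f y| <= D) -> `|\int[mu]_y f y| <= D * vol mu A.
Proof.
move=> bf mA Ar D0 h; have [mf _ _] := bf.
have iA : mu.-integrable [set: B] (EFin \o (\1_A : B -> R)).
  apply: ge0_integrableR.
  - exact: measurable_indic.
  - by move=> y; rewrite indicE.
  - rewrite integral_indic ?setIT//; apply: (@le_lt_trans _ _ (vol mu A)%:E); last exact: ltry.
    by rewrite -(vol_fin hmu mA Ar).
have iD : mu.-integrable [set: B] (EFin \o (fun y : B => D * \1_A y)) by exact: integrableZR.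
have E : \int[mu]_y (D * \1_A y) = D * vol mu A.
  by rewrite RintegralZl// /Rintegral integral_indic ?setIT.
rewrite -E.
apply: le_trans (le_normr_Rintegral _ _) _ => //; first exact: bsupp_integrable.
apply: le_Rintegral => //; first exact: (integrable_normR (bsupp_integrable hmu bf)).
move=> y _; rewrite indicE; have [->|fy] := eqVneq (f y) 0.
  by rewrite normr0 mulr_ge0.
by have [Ay fD] := h y fy; rewrite mem_set// mulr1.
Qed.

Lemma ramp_le (y : G) (r : R) : 0 <= r -> `|y| <= r -> 0 <= ramp y <= r.
Proof.
move=> r0 yr; rewrite rl_ge0 /=; apply: rl_le => //.
have yo : y ord0 ord0 <= r by exact: le_trans (ler_norm _) (le_trans (coord_le_normr y o) yr).
have c0 : 0 <= c by move: c12 => h; lra.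
by rewrite lerBlDr (le_trans yo)// lerDl.
Qed.

(** Balance of powers: the unshifted profile is O(e^-2), the shifted one at level 6 is O(e^2), and
    the support has volume O(e). *)
Lemma ker_base s : exists2 C : R, 0 <= C & forall x j e, admissible x j e -> `|x| <= 4 ->
  `|ker_int x j e 1 6 s| <= C * e.
Proof.
have [M M0 hM] := @dsc_bound R.
have [V V0 hV] := shell_vol hmu.
have [S S0 hS] := sval_bound s.
exists (M * M * (2 * 6) * S * (V * 3)); first by rewrite !mulr_ge0.
move=> x j e [[e0 e1] [jo xj0] xo2 lam2 adm] x4.
have ker_r y : ker_fun x e 1 6 y != 0 -> region j (x ord0 o / x ord0 j) y /\ shell (3 * e) y.
  move=> /ker_fun_supp[]// a b d f; have ry := adm y a b d f; split=> //.
  by split; [exact: ltW|split; [move: c12 => h; lra|case: ry]].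
have bf := bsupp_region lam2 xo2 s (@ker_fun_continuous x e 1 5) (fun y h => (ker_r y h).1).
apply: le_trans (_ : M * M * (2 * 6) * S * vol mu (shell (3 * e)) <= _).
  apply: (@Rintegral_le_vol _ _ _ 2) => //.
  - exact: shell_measurable.
  - by move=> y [_ []].
  - by rewrite !mulr_ge0.
  move=> y; rewrite mulf_eq0 negb_or => /andP[/ker_r[[m1 y2] sy] _]; split=> //.
  have h1 := hM e 2%N (qf y) e0 isT; have h2 := hM e 6%N (qf (x + y)) e0 isT.
  have /andP[p0 p2] := ramp_le (ler0n R 2) y2.
  have xy6 : `|x + y| <= 6 by apply: le_trans (ler_normD _ _) _; lra.
  have /andP[q0 q6] := ramp_le (ler0n R 6) xy6.
  have en : e != 0 by rewrite gt_eqF.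
  have sv : `|val x j (x ord0 o / x ord0 j) s y| <= S.
    apply: hS => //; [exact: le_trans (coord_le_normr _ _) y2|
      exact: le_trans (coord_le_normr _ _) y2|].
    by rewrite normfV -[leRHS]invrK lef_pV2 ?posrE; lra.
  rewrite /ker_fun !expr1 !normrM (ger0_norm p0) (ger0_norm q0).
  have -> : M * M * (2 * 6) * S = M * (e ^+ 2 / e ^+ 4) * (M * (e ^+ 6 / e ^+ 4) * (2 * 6)) * S.
    by field.
  by rewrite !ler_pM// ?mulr_ge0.
rewrite -[leRHS]mulrA ler_wpM2l ?mulr_ge0//.
by rewrite -mulrA; apply: hV; rewrite mulr_gt0.
Qed.

(** Induction undoes the integrations by parts one at a time; each costs a factor |x_j| and changes
    the symbol, hence the statement for all [s]. The power of e is settled in the end state by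
    [ker_base], so it is the same for every i. *)
Lemma ker_decay i s : (i <= 4)%N -> exists2 C : R, 0 <= C & forall x j e,
  admissible x j e -> `|x| <= 4 -> `|x ord0 j| ^+ i * `|ker_int x j e i.+1 (6 - i) s| <= C * e.
Proof.
elim: i s => [|i IH] s i4.
  have [C C0 hC] := ker_base s; exists C => // x j e a x4.
  by rewrite expr0 mul1r; exact: hC.
have [C C0 hC] := IH (next_sym i.+2 s) (ltnW i4); exists C => // x j e a x4.
have := hC x j e a x4.
have [q q1 qE] : exists2 q, (3 <= q.+2 <= 6)%N & (6 - i)%N = q.+2.
  by exists (4 - i)%N; [apply/andP; split; lia|lia].
have -> : (6 - i.+1)%N = q.+1 by lia.
rewrite qE => h; have st := ker_int_step i s a q1.
have := congr1 (fun z => `|z|) st; rewrite normrN !normrM normr_nat => st'.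
rewrite -st' in h; apply: le_trans h; rewrite exprSr -!mulrA.
rewrite ler_wpM2l ?exprn_ge0//.
by rewrite ler_peMl ?mulr_ge0// ler1n.
Qed.

End Kernel.

(** * The L^1 norm of the autocorrelation *)

Section Dyadic.
Context {R : realType} {n : nat}.
Local Notation G := 'rV[R]_n.+1.
Local Notation B := (borel_rV R n.+1).
Local Notation o := (ord0 : 'I_n.+1).
Variable mu : {sigma_finite_measure set B -> \bar R}.
Hypothesis hmu : haar_measure mu.

Lemma dyadic (r t : R) L : r < t <= r * 2 ^+ L ->
  exists2 i : 'I_L, r * 2 ^+ i < t & t <= r * 2 ^+ i.+1.
Proof.
elim: L => [|L IH] /andP[rt tL].
  by move: tL; rewrite expr0 mulr1 leNgt rt.
have [h|h] := leP t (r * 2 ^+ L); last by exists ord_max.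
have [|i a b] := IH; first by rewrite rt.
by exists (widen_ord (leqnSn L) i).
Qed.

Lemma Rintegral_cube (r : R) : \int[mu]_y (\1_(cube r) (y : G)) = vol mu (cube r).
Proof.
rewrite /Rintegral integral_indic ?setIT//; exact: cube_measurable.
Qed.

(** Between the radii r 2^i and r 2^(i+1) the function is at most C 16^-i, while the volume is at
    most a constant times 16^(i+1) r^4. The powers cancel, so the L annuli have equal bounds. *)
Lemma n1_dyadic (hn : (3 <= n)%N) : exists2 V : R, 0 <= V & forall (h : G -> R) (C r : R) L,
  bsupp h -> 0 < r -> r * 2 ^+ L <= 8 -> 0 <= C -> (forall x, `|h x| <= C) ->
  (forall x, r < `|x| -> `|x| ^+ 4 * `|h x| <= C * r ^+ 4) ->
  (forall x, r * 2 ^+ L < `|x| -> h x = 0) ->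
  n1 mu h <= C * V * r ^+ 4 * L.+1%:R.
Proof.
have [V hV] := cube_vol hmu hn.
have V0 : 0 <= V.
  have := hV 1; rewrite expr1n mulr1 => hV1; apply: le_trans (vol_ge0 mu (cube 1)) (hV1 _); lra.
exists (16 * V) => [|h C r L bh r0 rL C0 hC h4 hL]; first by rewrite mulr_ge0.
have q0 (i : nat) : 0 <= C / 16 ^+ i by rewrite divr_ge0// exprn_ge0.
pose D (i : nat) (x : G) := C / 16 ^+ i * \1_(cube (r * 2 ^+ i.+1)) x.
have iD (i : nat) : mu.-integrable [set: B] (EFin \o (D i : B -> R)).
  exact: (integrableZR _ (integrable_indic_cube hmu _)).
have le1 x : `|h x| <= C * \1_(cube r) x + \sum_(i < L) D i x.
  have D0 i : 0 <= D i x by rewrite mulr_ge0// indicE.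
  have [xr|rx] := leP `|x| r.
    rewrite indicE mem_set//= mulr1 (le_trans (hC x))// lerDl.
    by apply: sumr_ge0 => i _.
  have [xL|Lx] := leP `|x| (r * 2 ^+ L); last first.
    by rewrite hL// normr0 addr_ge0 ?mulr_ge0 ?indicE// sumr_ge0.
  have [i i1 i2] := dyadic (introT andP (conj rx xL)).
  apply: (@le_trans _ _ (D i x)); last first.
    rewrite (bigD1 i)//= addrCA lerDl addr_ge0//; first by rewrite mulr_ge0// indicE.
    by apply: sumr_ge0.
  rewrite /D indicE mem_set//= mulr1 ler_pdivlMr ?exprn_gt0//.
  have p4 : (r * 2 ^+ i) ^+ 4 <= `|x| ^+ 4.
    by apply: lerXn2r; rewrite ?nnegrE ?mulr_ge0 ?exprn_ge0// ltW.
  rewrite -(@ler_pM2r _ (r ^+ 4)) ?exprn_gt0//; apply: le_trans (h4 x rx).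
  rewrite -mulrA mulrC ler_wpM2r//.
  apply: le_trans p4; rewrite exprMn (_ : 16 ^+ i = (2 ^+ i) ^+ 4 :> R) 1?mulrC//.
  by rewrite -exprM mulnC exprM; congr (_ ^+ _); ring.
have i0 : mu.-integrable [set: B] (EFin \o (fun x : B => C * \1_(cube r) x)).
  exact: (integrableZR _ (integrable_indic_cube hmu _)).
have iS : mu.-integrable [set: B] (EFin \o (fun x : B => \sum_(i < L) D i x)).
  exact: integrable_sumR.
apply: (@le_trans _ _ (\int[mu]_x (C * \1_(cube r) x + \sum_(i < L) D i x))).
  apply: le_Rintegral => //; first exact: (integrable_normR (bsupp_integrable hmu bh)).
  exact: integrableDR.
rewrite RintegralD// RintegralZl//; last exact: integrable_indic_cube.
rewrite Rintegral_sum// Rintegral_cube.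
have hr : vol mu (cube r) <= V * r ^+ 4.
  apply: hV; rewrite r0/=; apply: le_trans rL.
  by rewrite ler_peMr ?exprn_ege1 ?ler1n// ltW.
have r4 : 0 <= r ^+ 4 by rewrite exprn_ge0// ltW.
have -> : C * (16 * V) * r ^+ 4 * L.+1%:R =
    16 * (C * (V * r ^+ 4)) + \sum_(i < L) C * (16 * V) * r ^+ 4.
  rewrite sumr_const card_ord -natr1 -[in RHS]mulr_natr; ring.
apply: lerD.
  by rewrite -[leLHS]mul1r ler_pM ?ler1n ?mulr_ge0 ?vol_ge0// ler_wpM2l.
apply: ler_sum => i _; rewrite /D RintegralZl//; last exact: integrable_indic_cube.
rewrite Rintegral_cube.
have hi : vol mu (cube (r * 2 ^+ i.+1)) <= V * (r * 2 ^+ i.+1) ^+ 4.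
  apply: hV; rewrite mulr_gt0 ?exprn_gt0//=; apply: le_trans rL.
  by rewrite ler_pM2l// ler_eXn2l// ltr1n.
apply: le_trans (ler_wpM2l (q0 i) hi) _.
rewrite (_ : C / 16 ^+ i * _ = C * (16 * V) * r ^+ 4)//.
rewrite (exprS 2 i) !exprMn (_ : (2 ^+ i) ^+ 4 = 16 ^+ i :> R); last first.
  by rewrite -exprM mulnC exprM; congr (_ ^+ _); ring.
have : 16 ^+ i != 0 :> R by rewrite expf_neq0.
by move: (16 ^+ i) => u u0; field.
Qed.

End Dyadic.

(** * Geometry of the cap *)

Section Cap.
Context {R : realType} {n : nat}.
Local Notation G := 'rV[R]_n.+1.
Local Notation o := (ord0 : 'I_n.+1).
Local Notation m := (n.+1%:R : R).

(** On the cap y_j^2 <= 4 [cap_width] = (4 m)^-2 for j != o, so that for two points y, z of the cap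
    the sum of |y_j| + |z_j| over these j is at most 1/2. *)
Definition cap_width : R := (64 * m ^+ 2)^-1.
Definition cap_height : R := 1 - cap_width.

Let m1 : 1 <= m. Proof. by rewrite ler1n. Qed.

Lemma cap_width_gt0 : 0 < cap_width.
Proof. by rewrite invr_gt0 mulr_gt0// exprn_gt0// ltr0n. Qed.

Lemma cap_width_le : cap_width <= 1 / 64.
Proof.
rewrite /cap_width div1r lef_pV2 ?posrE// ?mulr_gt0 ?exprn_gt0// ?ltr0n//.
by rewrite ler_peMr// exprn_ege1.
Qed.

Lemma cap_height_ge : 1 / 2 <= cap_height.
Proof. by rewrite /cap_height; have := cap_width_le; lra. Qed.

Lemma cap_coord (y : G) : `|qf y| < cap_width -> cap_height < y ord0 o ->
  y ord0 o <= 1 + cap_width /\ forall j, j != o -> `|y ord0 j| <= (4 * m)^-1.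
Proof.
have t0 := cap_width_gt0; have t1 := cap_width_le.
move=> /ltr_normlP[_ qy]; rewrite /cap_height => yo.
have S0 (j : 'I_n.+1) : 0 <= y ord0 j ^+ 2 by exact: sqr_ge0.
have qE : qf y = y ord0 o ^+ 2 + \sum_(i < n.+1 | i != o) y ord0 i ^+ 2 - 1.
  by rewrite /qf (bigD1 o).
split.
  have : 0 <= \sum_(i < n.+1 | i != o) y ord0 i ^+ 2 by apply: sumr_ge0.
  rewrite leNgt => s0; apply/negP => h.
  have : (1 + cap_width) * (1 + cap_width) < y ord0 o * y ord0 o by rewrite ltr_pM//; lra.
  move: qE; rewrite expr2; nra.
move=> j jo.
have jS : y ord0 j ^+ 2 <= \sum_(i < n.+1 | i != o) y ord0 i ^+ 2.
  by rewrite (bigD1 j)//= lerDl sumr_ge0.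
have h : (1 - cap_width) * (1 - cap_width) <= y ord0 o * y ord0 o by rewrite ler_pM//; lra.
have h2 : y ord0 j ^+ 2 <= 4 * cap_width by move: qE; rewrite expr2; nra.
have i0 : 0 <= (4 * m)^-1 by rewrite invr_ge0 mulr_ge0.
have n0 : 0 <= `|y ord0 j| by [].
rewrite -(ler_sqr n0 i0) real_normK ?num_real// (le_trans h2)//.
rewrite /cap_width exprVn exprMn.
have : m != 0 by rewrite gt_eqF// ltr0n.
move: m => u u0; rewrite le_eqVlt; apply/orP; left; apply/eqP; field; exact: u0.
Qed.

Lemma exists_max_coord (x : G) : exists j : 'I_n.+1, `|x ord0 j| = `|x|.
Proof.
apply: contrapT => /forallNP h.
have h1 j : `|x ord0 j| < `|x| by rewrite lt_neqAle coord_le_normr andbT; apply/eqP.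
have x0 : 0 < `|x| by exact: le_lt_trans (h1 o).
by have := (normr_rV_lt x x0).2 h1; rewrite ltxx.
Qed.

Lemma qf_diff (x y : G) : qf (x + y) - qf y = \sum_(i < n.+1) x ord0 i * (x ord0 i + 2 * y ord0 i).
Proof.
rewrite /qf opprB addrA subrK -sumrB; apply: eq_bigr => i _; rewrite mxE; ring.
Qed.

(** If |x_o| were maximal, then in qf (x + y) - qf y, the sum of the x_i (x_i + 2 y_i), the term of
    index o would have size at least (7/4) |x| and the others together at most |x| / 2. The
    difference would exceed 6 e, although both values are below 3 e in size. So a maximal coordinate
    has j != o, and then |x_o / x_j| <= 1. *)
Lemma exists_admissible (x : G) (e : R) : 0 < e -> 3 * e <= cap_width -> 6 * e < `|x| ->
  (exists y, [/\ `|qf y| < 3 * e, cap_height < y ord0 o, `|qf (x + y)| < 3 * e &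
     cap_height < (x + y) ord0 o]) ->
  exists2 j, admissible cap_height x j e & `|x ord0 j| = `|x|.
Proof.
move=> e0 et xe [y [qy yo qz zo]].
have t0 := cap_width_gt0; have t1 := cap_width_le.
have [j jx] := exists_max_coord x.
have [yo1 yj] := cap_coord (lt_le_trans qy et) yo.
have [zo1 zj] := cap_coord (lt_le_trans qz et) zo.
have xo2 : `|x ord0 o| <= 2.
  move: zo1 zo yo1 yo; rewrite /cap_height mxE => *; rewrite ler_norml; apply/andP; split; lra.
have rm : (4 * m)^-1 <= 1 / 4.
  by rewrite div1r lef_pV2 ?posrE ?mulr_gt0// ?ltr0n// ler_peMr.
have jo : j != o.
  apply/eqP => jE; move: jx; rewrite jE => xoE.
  have := qf_diff x y; rewrite (bigD1 o)//= => D.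
  have b : `|\sum_(i < n.+1 | i != o) x ord0 i * (x ord0 i + 2 * y ord0 i)| <= `|x| * (1 / 2).
    apply: le_trans (ler_norm_sum _ _ _) _.
    apply: (@le_trans _ _ (\sum_(i < n.+1 | i != o) `|x| * (2 * (4 * m)^-1))).
      apply: ler_sum => i io; rewrite normrM ler_pM//; first exact: coord_le_normr.
      have -> : x ord0 i + 2 * y ord0 i = (x + y) ord0 i + y ord0 i by rewrite mxE; ring.
      apply: le_trans (ler_normD _ _) _; move: (yj i io) (zj i io).
      by move: ((4 * m)^-1) => r; lra.
    apply: (@le_trans _ _ (\sum_(i < n.+1) `|x| * (2 * (4 * m)^-1))).
      rewrite [leRHS](bigD1 o)//= lerDr !mulr_ge0// invr_ge0 mulr_ge0//.
    rewrite sumr_const card_ord -[leLHS]mulr_natr -mulrA ler_wpM2l//.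
    have : m != 0 by rewrite gt_eqF// ltr0n.
    by move: m => u u0; rewrite (_ : 2 * (4 * u)^-1 * u = 1 / 2)//; field.
  set S := \sum_(i < n.+1 | i != o) _ in D b.
  have D2 : x ord0 o * (x ord0 o + 2 * y ord0 o) = (qf (x + y) - qf y) - S by rewrite D addrK.
  have : `|x ord0 o| * (7 / 4) <= `|x ord0 o * (x ord0 o + 2 * y ord0 o)|.
    rewrite normrM ler_wpM2l//.
    have -> : x ord0 o + 2 * y ord0 o = (x + y) ord0 o + y ord0 o by rewrite mxE; ring.
    rewrite ger0_norm; move: zo yo; rewrite /cap_height; lra.
  rewrite D2 => h.
  have := ler_normB (qf (x + y) - qf y) S; have := ler_normB (qf (x + y)) (qf y).
  rewrite xoE in h; lra.
have xj0 : x ord0 j != 0 by rewrite -normr_gt0 jx; lra.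
have lam1 : `|x ord0 o / x ord0 j| <= 1.
  rewrite normrM normfV ler_pdivrMr ?normr_gt0// mul1r jx; exact: coord_le_normr.
exists j => //; split=> //; [by split=> //; lra|lra|].
move=> w qw wo _ _; have [wo1 wj] := cap_coord (lt_le_trans qw et) wo.
have lw : `|x ord0 o / x ord0 j * w ord0 j| <= 1 / 4.
  by rewrite normrM -[leRHS]mul1r ler_pM//; exact: le_trans (wj j jo) rm.
split.
  rewrite /mm; have := ler_norm (w ord0 o - x ord0 o / x ord0 j * w ord0 j).
  move: lw => /ler_normlP[l1 l2]; move: wo; rewrite /cap_height; lra.
apply/normr_rV_le => // i; have [->|io] := eqVneq i o.
  by move: wo; rewrite /cap_height ler_norml => wo; apply/andP; split; lra.
by apply: le_trans (wj i io) (le_trans rm _); lra.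
Qed.

End Cap.

(** * The regularised derivatives on the cap and their estimates *)

Section CapFunctions.
Context {R : realType} {n : nat}.
Local Notation G := 'rV[R]_n.+1.
Local Notation B := (borel_rV R n.+1).
Local Notation o := (ord0 : 'I_n.+1).
Local Notation c := (@cap_height R n).
Local Notation tau := (@cap_width R n).

(** The factor 2 y_o is the derivative of qf in y_o, which turns the pairing with qf into an
    integration by parts. The fifth power of the ramp supplies one power for each of the four steps
    of [ker_decay] and leaves one at the end. *)
Definition cap_fun (e : R) (y : G) : R := sc e 2 (qf y) * (2 * y ord0 o * ramp c y ^+ 5).

Definition cap_diff (e : R) (y : G) : R := dsc e 2 (qf y) * (2 * y ord0 o * ramp c y ^+ 5).

Lemma qf_lt_cube (y : G) : qf y < 1 -> `|y| <= 2.
Proof.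
move=> qy; apply/normr_rV_le => // i.
have iS : y ord0 i ^+ 2 <= qf y + 1.
  by rewrite /qf subrK (bigD1 i)//= lerDl sumr_ge0// => k _; exact: sqr_ge0.
rewrite -(ler_sqr (normr_ge0 _ : `|y ord0 i| \in Num.nneg) (ler0n R 2)) real_normK ?num_real//.
by rewrite (_ : 2 ^+ 2 = 4 :> R); [lra|ring].
Qed.

Lemma bsupp_cube2 (f : G -> R) : continuous f -> (forall y, f y != 0 -> `|y| <= 2) -> bsupp f.
Proof.
move=> cf f2; have [M M0 fM] := continuous_bounded_cube 2 cf; split.
- exact: continuous_measurable_rV.
- exists M => y; have [->|/f2/fM//] := eqVneq (f y) 0; by rewrite normr0.
- by exists 2 => y; apply: contra_ltP; move=> /eqP; exact: f2.
Qed.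

Lemma ramp_supp (y : G) k : ramp c y ^+ k.+1 != 0 -> c < y ord0 o.
Proof. by rewrite expf_eq0 /= => /ramp_gt0. Qed.

Lemma cap_weight_continuous (p : R -> R) : continuous p ->
  continuous (fun y : G => p (qf y) * (2 * y ord0 o * ramp c y ^+ 5)).
Proof.
move=> cp; apply: continuousM_rV; first exact: (continuous_comp_rV (@continuous_qf R n)).
apply: continuousM_rV.
  by apply: continuousM_rV; [exact: continuous_cst_rV|exact: coord_continuous].
apply: (@continuous_comp_rV _ _ _ (fun t : R => t ^+ 5) (@continuous_ramp _ _ _)).
exact: exprn_continuous.
Qed.

Lemma sc2_continuous (e : R) : continuous (sc e 2).
Proof.
move=> s; apply: cvgM; first exact: cvg_cst.
apply: (@continuous_comp _ _ _ (fun s : R => s / e) (spl 2)); last exact: spl_continuous.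
by apply: cvgM; [exact: cvg_id|exact: cvg_cst].
Qed.

Lemma mulf_neq0_ends (u v w : R) : u * (v * w) != 0 -> u != 0 /\ w != 0.
Proof. by rewrite mulf_eq0 negb_or => /andP[? ]; rewrite mulf_eq0 negb_or => /andP[]. Qed.

Lemma cap_fun_supp (e : R) (y : G) : 0 < e -> cap_fun e y != 0 -> `|qf y| < 3 * e /\ c < y ord0 o.
Proof.
move=> e0; move=> /mulf_neq0_ends[a b]; split; last exact: ramp_supp b.
by apply: contra_neqT a; rewrite -leNgt; exact: sc_out.
Qed.

Lemma cap_diff_supp (e : R) (y : G) : 0 < e -> cap_diff e y != 0 -> `|qf y| < 3 * e /\ c < y ord0 o.
Proof.
move=> e0; move=> /mulf_neq0_ends[a b]; split; last exact: ramp_supp b.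
exact: dsc_supp a.
Qed.

Lemma cap_fun_diff (e : R) (y : G) : cap_fun (e / 2) y - cap_fun e y = - cap_diff e y.
Proof. by rewrite /cap_fun /cap_diff /dsc; ring. Qed.

Lemma small_cube (e : R) (y : G) : 3 * e <= tau -> `|qf y| < 3 * e -> `|y| <= 2.
Proof.
move=> et /ltr_normlP[_ qy]; apply: qf_lt_cube; have := @cap_width_le R n; lra.
Qed.

Lemma bsupp_cap_fun (e : R) : 0 < e -> 3 * e <= tau -> bsupp (cap_fun e).
Proof.
move=> e0 et; apply: bsupp_cube2; first exact: (@cap_weight_continuous _ (@sc2_continuous e)).
by move=> y /(cap_fun_supp e0)[qy _]; exact: small_cube qy.
Qed.

Lemma bsupp_cap_diff (e : R) : 0 < e -> 3 * e <= tau -> bsupp (cap_diff e).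
Proof.
move=> e0 et; apply: bsupp_cube2; first exact: (@cap_weight_continuous _ (@dsc_continuous _ e 1)).
by move=> y /(cap_diff_supp e0)[qy _]; exact: small_cube qy.
Qed.

Variable mu : {sigma_finite_measure set B -> \bar R}.
Hypothesis hmu : haar_measure mu.

Lemma autocorr_ker (e : R) (x : G) j : autocorr mu (cap_diff e) x =
  ker_int mu c x j e 5 2 (Mul (Cst 4) (Mul Yo (Add Yo Xo))).
Proof.
apply: eq_Rintegral => y _; rewrite (addrC y x) /cap_diff /ker_fun /val /= mxE.
by ring.
Qed.

Lemma autocorr_eq0 (f : G -> R) (x : G) :
  ~ (exists y, f y != 0 /\ f (x + y) != 0) -> autocorr mu f x = 0.
Proof.
move=> /forallNP h; rewrite /autocorr (_ : (fun t => _) = fun=> 0); first exact: Rintegral0.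
apply/funext => y; apply/eqP; rewrite mulf_eq0; apply/negP => /negP; rewrite negb_or => /andP[a b].
by apply: (h y); split=> //; rewrite addrC.
Qed.

(** For all x: two factors O(e^-2) on a shell of volume O(e). Beyond 6 e: either the support and its
    translate do not meet, or [exists_admissible] provides the plane of rotation and [ker_decay]
    applies with |x_j| = |x|. Supports lie in the cube of radius 2, hence the cutoff at 4. *)
Lemma autocorr_cap_bound : exists2 C : R, 0 <= C & forall e : R, 0 < e -> 3 * e <= tau ->
  forall x : G, [/\ `|autocorr mu (cap_diff e) x| <= C / e ^+ 3,
    6 * e < `|x| -> `|x| ^+ 4 * `|autocorr mu (cap_diff e) x| <= C * e
    & 4 < `|x| -> autocorr mu (cap_diff e) x = 0].
Proof.
have [M M0 hM] := @dsc_bound R.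
have [V V0 hV] := shell_vol hmu.
have [D D0 hD] := ker_decay hmu (@cap_height_ge R n) (Mul (Cst 4) (Mul Yo (Add Yo Xo))) (leqnn 4).
exists ((128 * M) * (128 * M) * (V * 3) + D); first by rewrite addr_ge0// !mulr_ge0.
move=> e e0 et x.
have t1 := @cap_width_le R n.
have en : e != 0 by rewrite gt_eqF.
have h0 : 4 < `|x| -> autocorr mu (cap_diff e) x = 0.
  move=> x4; apply: autocorr_eq0 => -[y [/(cap_diff_supp e0)[qy _] /(cap_diff_supp e0)[qz _]]].
  have y2 := small_cube et qy; have z2 := small_cube et qz.
  have := ler_normB (x + y) y; rewrite addrK; lra.
have bg := bsupp_cap_diff e0 et.
have gM y : cap_diff e y != 0 -> `|cap_diff e y| <= 128 * M * (e ^+ 2 / e ^+ 4).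
  move=> /(cap_diff_supp e0)[qy _]; have y2 := small_cube et qy.
  have /andP[p0 p2] := ramp_le (@cap_height_ge R n) (ler0n R 2) y2.
  have h1 := hM e 2%N (qf y) e0 isT.
  rewrite /cap_diff (normrM (dsc e 2 (qf y))) (normrM (2 * y ord0 o)) (normrM 2) normr_nat (ger0_norm (exprn_ge0 5 p0)).
  have -> : 128 * M * (e ^+ 2 / e ^+ 4) = M * (e ^+ 2 / e ^+ 4) * (2 * 2 * 2 ^+ 5) by ring.
  apply: ler_pM => //; first by rewrite mulr_ge0 ?exprn_ge0 ?mulr_ge0.
  apply: ler_pM; [by rewrite mulr_ge0|exact: exprn_ge0| |].
    by rewrite ler_pM2l//; exact: le_trans (coord_le_normr _ _) y2.
  by apply: lerXn2r; rewrite ?nnegrE.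
have W0 : 0 <= 128 * M * (e ^+ 2 / e ^+ 4).
  apply: mulr_ge0; first by rewrite mulr_ge0.
  by apply: divr_ge0; apply: exprn_ge0; exact: ltW.
set W := 128 * M * (e ^+ 2 / e ^+ 4) in W0 gM.
split=> //.
- apply: (@le_trans _ _ (W * W * vol mu (shell (3 * e)))).
    apply: (@Rintegral_le_vol _ _ _ hmu _ _ _ 2).
    - have := bsuppM bg (bsupp_shift x bg); congr bsupp.
      by apply/funext => y; rewrite (addrC y).
    - exact: shell_measurable.
    - by move=> y [_ []].
    - exact: mulr_ge0.
    move=> y; rewrite mulf_eq0 negb_or => /andP[a b]; split; last by rewrite normrM; apply: ler_pM; rewrite ?gM.
    have [qy yo] := cap_diff_supp e0 a.
    split; [exact: ltW|split; last exact: small_cube qy].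
    have := @cap_height_ge R n; lra.
  have e31 : 0 < 3 * e <= 1 by apply/andP; split; lra.
  apply: (@le_trans _ _ (W * W * (V * (3 * e)))).
    by apply: ler_wpM2l; [exact: mulr_ge0|exact: hV].
  rewrite (_ : W * W * (V * (3 * e)) = (128 * M) * (128 * M) * (V * 3) / e ^+ 3); last by rewrite /W; field.
  by rewrite ler_wpM2r ?invr_ge0 ?exprn_ge0 ?lerDl// ltW.
- move=> x6; have [x4|/h0->] := leP `|x| 4; last first.
    by rewrite normr0 mulr0 mulr_ge0 ?addr_ge0 ?mulr_ge0// ltW.
  have [[y [a b]]|/autocorr_eq0->] := pselect (exists y, cap_diff e y != 0 /\ cap_diff e (x + y) != 0); last first.
    by rewrite normr0 mulr0 mulr_ge0 ?addr_ge0 ?mulr_ge0// ltW.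
  have [qy yo] := cap_diff_supp e0 a; have [qz zo] := cap_diff_supp e0 b.
  have [|j adm <-] := exists_admissible e0 et x6; first by exists y.
  rewrite (autocorr_ker _ _ j); apply: le_trans (hD x j e adm x4) _.
  by rewrite ler_wpM2r ?lerDr ?mulr_ge0// ltW.
Qed.

(** The two bounds meet at radii of order e, where C e^-3 times (6 e)^4 is O(e); the L dyadic annuli
    from 6 e to 4 add the logarithmic factor. *)
Lemma n1_cap (hn : (3 <= n)%N) : exists2 K : R, 0 <= K & forall (e : R) L,
  0 < e -> 3 * e <= tau -> 6 * e * 2 ^+ L = 4 ->
  n1 mu (autocorr mu (cap_diff e)) <= K * e * L.+1%:R.
Proof.
have [V V0 hV] := n1_dyadic hmu hn.
have [C C0 hC] := autocorr_cap_bound.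
exists (6 ^+ 4 * C * V) => [|e L e0 et eL]; first by rewrite !mulr_ge0// exprn_ge0.
have e3 : 0 < e ^+ 3 by rewrite exprn_gt0.
have en : e != 0 by rewrite gt_eqF.
have := hV (autocorr mu (cap_diff e)) (C / e ^+ 3) (6 * e) L.
rewrite (_ : C / e ^+ 3 * V * (6 * e) ^+ 4 = 6 ^+ 4 * C * V * e); last by field.
apply.
- by apply: autocorr_bsupp => //; exact: bsupp_cap_diff.
- by rewrite mulr_gt0.
- by rewrite eL; lra.
- by rewrite divr_ge0// ltW.
- by move=> x; have [] := hC e e0 et x.
- move=> x x6; have [_ h _] := hC e e0 et x; apply: le_trans (h x6) _.
  rewrite (_ : C / e ^+ 3 * (6 * e) ^+ 4 = 6 ^+ 4 * (C * e)); last by field.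
  rewrite ler_peMl ?mulr_ge0 ?exprn_ege1//; [exact: ltW|lra].
- by move=> x; rewrite eL => x4; have [_ _] := hC e e0 et x; exact.
Qed.

(** The antiderivative of [sc e 2 t * t] that vanishes right of 3 e. As t delta' = - delta, it
    approximates 6 times the indicator of t < 0. *)
Definition bump (e t : R) : R := t / e * spl 3 (t / e) - spl 4 (t / e) + 6.

Lemma is_derive_bump (e t : R) : e != 0 -> is_derive t 1 (bump e) (sc e 2 t * t).
Proof.
move=> e0.
have H1 : is_derive t 1 (fun t => t / e) (1 * e^-1 + t * 0) by exact: (dMf (did t) (dcst _ t)).
have H3 := dcomp H1 (is_derive_spl 1 (t / e)).
have H4 := dZf (-1) (dcomp H1 (is_derive_spl 2 (t / e))).
have -> : bump e = (fun t => t / e * spl 3 (t / e) + -1 * spl 4 (t / e) + 6).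
  by apply/funext => u; rewrite /bump mulN1r.
apply: (deq (dDf (dDf (dMf H1 H3) H4) (dcst 6 t))); rewrite /sc mulr0 addr0.
by move: (spl 2 _) (spl 3 _) => u v; field.
Qed.

Lemma bump_right (e t : R) : 0 < e -> 3 * e <= t -> bump e t = 0.
Proof.
move=> e0 te; have h : 3 <= t / e by rewrite ler_pdivlMr.
by rewrite /bump; have [_ _ -> -> _] := spl_right h; rewrite mulr0 sub0r addNr.
Qed.

Lemma bump_left (e t : R) : 0 < e -> t <= - (3 * e) -> bump e t = 6.
Proof.
move=> e0 te; have h : t / e <= -3 by rewrite ler_pdivrMr// mulNr.
by rewrite /bump !spl_left// mulr0 subrr add0r.
Qed.

Lemma bump_bound : exists2 M : R, 0 <= M & forall e t : R, 0 < e -> `|t| <= 3 * e -> `|bump e t| <= M.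
Proof.
have [M M0 hM] := @spl_bound R; exists (3 * M + M + 6); first by rewrite !addr_ge0// mulr_ge0.
move=> e t e0 te.
have h : `|t / e| <= 3 by rewrite normrM normfV (gtr0_norm e0) ler_pdivrMr.
have h6 : t / e <= 6 by have := ler_norm (t / e); lra.
rewrite /bump; apply: le_trans (ler_normD _ _) _; rewrite normr_nat lerD2r.
apply: le_trans (ler_normB _ _) _; apply: lerD; last exact: hM.
by rewrite normrM; apply: ler_pM => //; exact: hM.
Qed.

Lemma bump_continuous (e : R) : e != 0 -> continuous (bump e).
Proof. by move=> e0 t; exact: is_derive_continuous (is_derive_bump t e0). Qed.

Definition bump_fun (e : R) k (y : G) : R := bump e (qf y) * ramp c y ^+ k.

Lemma bsupp_bump_fun (e : R) k : 0 < e -> 3 * e <= tau -> bsupp (bump_fun e k.+1).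
Proof.
move=> e0 et; have en : e != 0 by rewrite gt_eqF.
apply: bsupp_cube2.
  apply: continuousM_rV.
    exact: (@continuous_comp_rV _ _ _ (bump e) (@continuous_qf R n) (@bump_continuous e en)).
  apply: (@continuous_comp_rV _ _ _ (fun t : R => t ^+ k.+1) (@continuous_ramp _ _ _)).
  exact: exprn_continuous.
move=> y; rewrite /bump_fun; have [h|h] := leP (3 * e) (qf y).
  by rewrite bump_right// mul0r eqxx.
move=> _; apply: qf_lt_cube; have := @cap_width_le R n; lra.
Qed.

(* The integrand is d/dy_o of bump_fun e 5 minus 5 bump_fun e 4. *)
Lemma cap_fun_qf (e : R) : 0 < e -> 3 * e <= tau ->
  \int[mu]_y (cap_fun e y * qf y) = - (5 * \int[mu]_y bump_fun e 4 y).
Proof.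
move=> e0 et; have en : e != 0 by rewrite gt_eqF.
have b4 := bsuppZ 5 (@bsupp_bump_fun e 3 e0 et); have b5 := @bsupp_bump_fun e 4 e0 et.
have bc : bsupp (fun y => cap_fun e y * qf y).
  apply: bsupp_cube2.
    apply: continuousM_rV; last exact: continuous_qf.
    exact: (@cap_weight_continuous _ (@sc2_continuous e)).
  move=> y; rewrite mulf_eq0 negb_or => /andP[/(cap_fun_supp e0)[qy _] _].
  exact: small_cube qy.
have bd : bsupp (fun y => cap_fun e y * qf y + 5 * bump_fun e 4 y).
  have := bsuppB bc (bsuppZ (-1) b4); congr bsupp.
  by apply/funext => y; rewrite mulN1r opprK.
have := @Rintegral_pdv _ _ mu hmu o _ (fun y => cap_fun e y * qf y + 5 * bump_fun e 4 y) _ b5 bd.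
have i4 := bsupp_integrable hmu (@bsupp_bump_fun e 3 e0 et).
rewrite RintegralD//; [|exact: bsupp_integrable|exact: integrableZR].
rewrite RintegralZl// => h; apply/eqP; rewrite -addr_eq0; apply/eqP; apply: h => y.
have [Cr _ _] := @C1_ramp R n c 3.
have H := pdvM (pdv_comp (pdv_qf o y) (is_derive_bump (qf y) en)) (Cr o y).
rewrite eqxx in H; rewrite (_ : _ + _ = sc e 2 (qf y) * qf y * (2 * y ord0 o) * ramp c y ^+ 5 +
  bump e (qf y) * (5 * ramp c y ^+ 4 * 1)); first exact: H.
by rewrite /cap_fun /bump_fun; ring.
Qed.

(** The point (1 - tau / 2) e_o lies halfway between the cap height 1 - tau and the sphere; a radius
    of order tau / m keeps a cube around it above that height and inside the ball. *)
Lemma below_sphere : exists2 s : R, 0 < s & forall y : G,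
  `|- ((1 - tau / 2) *: ev o) + y| <= s -> c + tau / 4 <= y ord0 o /\ qf y <= - (tau / 4).
Proof.
have t0 := @cap_width_gt0 R n; have t1 := @cap_width_le R n.
pose m : R := n.+1%:R; have m1 : 1 <= m by rewrite ler1n.
have m0 : 0 < m by lra.
pose s := tau / 16 / m.
have sm : s * m = tau / 16 by rewrite /s divfK// gt_eqF.
have s0 : 0 < s by rewrite /s !divr_gt0.
have st : s <= tau / 16 by rewrite -sm ler_peMr// ltW.
exists s => // y; set z := - _ + y => zs.
have yE : y = (1 - tau / 2) *: ev o + z by rewrite /z addNKr.
have zo : `|z ord0 o| <= s by exact: le_trans (coord_le_normr z o) zs.
have yoE : y ord0 o = 1 - tau / 2 + z ord0 o by rewrite yE coord_shift eqxx.
have /ler_normlP[zo1 zo2] := zo.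
split; first by rewrite yoE /cap_height; lra.
rewrite yE qf_shift.
have qz : qf z <= m * (s * s) - 1.
  rewrite /qf lerB// (@le_trans _ _ (\sum_(i < n.+1) s * s))//.
    apply: ler_sum => i _; have zi := le_trans (coord_le_normr z i) zs.
    by rewrite -[_ ^+ 2]real_normK ?num_real// expr2; apply: ler_pM.
  by rewrite sumr_const card_ord -[leLHS]mulr_natl.
have mss : m * (s * s) <= s by rewrite mulrA (mulrC m) sm ler_piMl ?ltW//; lra.
have h1 : 2 * (1 - tau / 2) * z ord0 o <= 2 * s.
  rewrite -mulrA ler_pM2l//; have [z0|z0] := leP 0 (z ord0 o); first by nra.
  have : (1 - tau / 2) * z ord0 o <= 0 by rewrite mulr_ge0_le0//; lra.
  lra.
have h2 : (1 - tau / 2) ^+ 2 <= 1 - tau + tau / 16 by nra.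
lra.
Qed.

(** On the cube of [below_sphere] the bump is 6 and the ramp at least tau / 4. Where the ramp is
    positive, the bump can be negative only on a shell of volume O(e), and it is bounded there; so
    for small e the integral of [bump_fun e 4] is at least 6 w - 3 w. The factor 5 of [cap_fun_qf]
    makes this 15 w. *)
Lemma cap_fun_neg : exists c0 e0 : R, [/\ 0 < c0, 0 < e0 & forall e : R, 0 < e -> e <= e0 ->
  3 * e <= tau -> \int[mu]_y (cap_fun e y * qf y) <= - c0].
Proof.
have t0 := @cap_width_gt0 R n; have t1 := @cap_width_le R n.
have [M M0 hM] := bump_bound; have [V V0 hV] := shell_vol hmu.
have [s s0 hs] := below_sphere.
set p := - _ in hs.
have v0 : 0 < vol mu (cube s).
  rewrite -lte_fin -(vol_fin hmu (@cube_measurable R n s) (@subset_refl _ _)).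
  exact: mu_cube_gt0.
set v := vol mu (cube s) in v0.
pose w := (tau / 4) ^+ 4 * v.
have w0 : 0 < w by rewrite mulr_gt0// exprn_gt0// divr_gt0.
pose W := M * 2 ^+ 4.
have W0 : 0 <= W by rewrite mulr_ge0// exprn_ge0.
pose e0 := w / (W * V + 1).
have d0 : 0 < W * V + 1 by rewrite ltr_wpDl// mulr_ge0.
(* [e0] makes the loss 3 W V e on the shell at most 3 w; tau / 12 puts the values of qf on the small
   cube left of - 3 e, where the bump is constant. *)
exists (15 * w), (Num.min e0 (tau / 12)); split.
- by rewrite mulr_gt0.
- by rewrite lt_min !divr_gt0.
move=> e ep; rewrite le_min => /andP[ee et] et'.
have We : W * V * e <= w.
  have : (W * V + 1) * e <= w by rewrite mulrC -ler_pdivlMr.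
  by rewrite mulrDl mul1r; lra.
rewrite cap_fun_qf// lerN2.
pose a (y : G) : R := \1_(cube s) (p + y); pose b (y : G) : R := \1_(shell (3 * e)) y.
have pw y : 6 * (tau / 4) ^+ 4 * a y - W * b y <= bump_fun e 4 y.
  have b0 : 0 <= b y by rewrite /b indicE.
  have r0 : 0 <= ramp c y ^+ 4 by rewrite exprn_ge0// rl_ge0.
  have Wb : 0 <= W * b y by rewrite mulr_ge0.
  rewrite /a indicE; have [h|h] := boolP (_ \in _).
    move: h; rewrite inE => /hs[yo qy].
    rewrite mulr1 /bump_fun bump_left//; last by lra.
    have : (tau / 4) ^+ 4 <= ramp c y ^+ 4.
      apply: lerXn2r; rewrite ?nnegrE ?rl_ge0//; first by lra.
      by rewrite /ramp rl_pos; lra.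
    lra.
  rewrite mulr0 sub0r /bump_fun.
  have [q1|q1] := leP (3 * e) (qf y); first by rewrite bump_right// mul0r; lra.
  have [q2|q2] := leP (qf y) (- (3 * e)); first by rewrite bump_left//; lra.
  have [->|/ramp_supp yo] := eqVneq (ramp c y ^+ 4) 0; first by rewrite mulr0; lra.
  have qq : `|qf y| <= 3 * e by rewrite ler_norml; apply/andP; split; exact: ltW.
  have y2 : `|y| <= 2 by apply: qf_lt_cube; lra.
  have sh : shell (3 * e) y.
    by split=> //; split=> //; have := @cap_height_ge R n; lra.
  have /andP[p0 p2] := ramp_le (@cap_height_ge R n) (ler0n R 2) y2.
  have : `|bump e (qf y) * ramp c y ^+ 4| <= W.
    rewrite normrM; apply: ler_pM => //; first exact: hM.
    rewrite ger0_norm//; apply: lerXn2r; rewrite ?nnegrE//.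
  by rewrite /b indicE mem_set// mulr1 => /ler_normlP[? ?]; lra.
have ic := integrable_indic_cube hmu s.
have ia : mu.-integrable [set: B] (EFin \o (a : B -> R)) by exact: (integrable_shift hmu p ic).
have sh2 : (shell (3 * e) : set G) `<=` cube 2 by move=> y [_ []].
have ib : mu.-integrable [set: B] (EFin \o (b : B -> R)).
  apply: ge0_integrableR.
  - by apply: measurable_indic; exact: shell_measurable.
  - by move=> y; rewrite /b indicE.
  - rewrite integral_indic ?setIT//; last exact: shell_measurable.
    apply: (@le_lt_trans _ _ (vol mu (shell (3 * e)))%:E); last exact: ltry.
    by rewrite -(vol_fin hmu (@shell_measurable R n (3 * e)) sh2).
have i1 := integrableZR (6 * (tau / 4) ^+ 4) ia; have i2 := integrableZR W ib.
have i4 := bsupp_integrable hmu (@bsupp_bump_fun e 3 ep et').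
have : \int[mu]_y (6 * (tau / 4) ^+ 4 * a y - W * b y) <= \int[mu]_y bump_fun e 4 y.
  by apply: le_Rintegral => //; exact: integrableBR.
rewrite RintegralB// RintegralZl// RintegralZl//.
have -> : \int[mu]_y a y = v.
  by rewrite (Rintegral_shift hmu p) ?Rintegral_cube//; apply: measurable_indic; exact: cube_measurable.
have -> : \int[mu]_y b y = vol mu (shell (3 * e)).
  by rewrite /Rintegral integral_indic ?setIT//; exact: shell_measurable.
have hv : W * vol mu (shell (3 * e)) <= W * (V * (3 * e)).
  by apply: ler_wpM2l => //; apply: hV; apply/andP; split; lra.
rewrite -(mulrA 6) -/w; move: (\int[mu]_y _) => I.
have E : W * (V * (3 * e)) = 3 * (W * V * e) by ring.
rewrite E in hv; lra.
Qed.

End CapFunctions.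

(** * Choice of the scales *)

Section Sequence.
Context {R : realType} {n : nat}.
Local Notation G := 'rV[R]_n.+1.
Local Notation B := (borel_rV R n.+1).

Lemma not_synthesis_sigma_finite (mu : {sigma_finite_measure set B -> \bar R})
  (hn : (3 <= n)%N) (hmu : haar_measure mu) :
  ~ reduced_spectral_synthesis mu (@unit_sphere R n.+1).
Proof.
have t0 := @cap_width_gt0 R n; have t1 := @cap_width_le R n.
(* As 2^L >= L, this makes 3 e_k = 2 / 2^(k + L) at most [cap_width] for every k. *)
pose L := (128 * n.+1 ^ 2)%N.
(* The factor 2/3 makes 6 e_k 2^(k + L) exactly 4, the radius beyond which the autocorrelation
   vanishes. *)
pose e k : R := 2 / 3 / 2 ^+ (k + L).
have p2 k : 0 < 2 ^+ k :> R by rewrite exprn_gt0.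
have e0 k : 0 < e k by rewrite !divr_gt0.
have eS k : e k.+1 = e k / 2.
  rewrite /e addSn exprS; have := p2 (k + L)%N; move: (2 ^+ (k + L)) => u u0.
  by field; rewrite gt_eqF.
have eL k : 6 * e k * 2 ^+ (k + L) = 4.
  by rewrite /e; have := p2 (k + L)%N; move: (2 ^+ (k + L)) => u u0; field; rewrite gt_eqF.
have ek k : e k <= (2 ^+ k)^-1.
  rewrite /e exprD invfM mulrCA ler_piMr ?invr_ge0 ?exprn_ge0//.
  rewrite -[leRHS]mulr1 ler_pM ?invr_ge0 ?exprn_ge0//; first by lra.
  by rewrite invf_le1// exprn_ege1// ler1n.
have et k : 3 * e k <= @cap_width R n.
  have h : (L <= 2 ^ (k + L))%N.
    by apply: leq_trans (ltnW (ltn_expl L (ltnSn 1))) _; rewrite leq_pexp2l// leq_addl.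
  have m0 : 0 < (n.+1%:R : R) by rewrite ltr0n.
  have hR : 128 * n.+1%:R ^+ 2 <= 2 ^+ (k + L) :> R.
    by move: h; rewrite -(ler_nat R) /L natrM !natrX.
  rewrite (_ : 3 * e k = (2 ^+ (k + L) / 2)^-1); last first.
    by rewrite /e; have := p2 (k + L)%N; move: (2 ^+ (k + L)) => u u0; field; rewrite gt_eqF.
  rewrite /cap_width lef_pV2 ?posrE ?divr_gt0 ?mulr_gt0 ?exprn_gt0//.
  by rewrite ler_pdivlMr//; lra.
have small (a : R) : 0 < a -> exists k0 : nat, forall k, (k0 <= k)%N -> e k <= a.
  move=> a0; exists (Num.bound a^-1) => k kk.
  apply: le_trans (ek k) _; rewrite -[leRHS]invrK lef_pV2 ?posrE ?invr_gt0//.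
  have ai : 0 <= a^-1 by rewrite invr_ge0 ltW.
  apply: le_trans (ltW (archi_boundP ai)) _; rewrite -natrX ler_nat.
  exact: leq_trans kk (ltnW (ltn_expl k (ltnSn 1))).
have [K K0 hK] := n1_cap hmu hn.
have [c0 [a [c00 a0 ha]]] := cap_fun_neg hmu.
have [k0 hk0] := small a a0.
(* The logarithmic factor is absorbed by (3/2)^k, which worsens the ratio 1/2 of the scales to the
   3/4 used for convergence. *)
have grow k : k.+1%:R <= 2 * (3 / 2) ^+ k :> R.
  elim: k => [|k IH]; first by rewrite expr0 mulr1 ler1n.
  rewrite -natr1 exprS; have : 1 <= (3 / 2) ^+ k :> R by rewrite exprn_ege1//; lra.
  by move: ((3 / 2) ^+ k) IH => u; lra.
apply: (@not_synthesis R n mu hmu (fun k => cap_fun (e k)) (K * (2 * L.+1%:R)) _ _ _ _ c0 k0 c00).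
- by move=> k; exact: bsupp_cap_fun.
- move=> k; rewrite (_ : autocorr mu _ = autocorr mu (cap_diff (e k))); last first.
    apply/funext => x; apply: eq_Rintegral => y _.
    by rewrite eS !cap_fun_diff mulrNN.
  apply: le_trans (hK _ _ (e0 k) (et k) (eL k)) _.
  rewrite -(mulrA K) -(mulrA K); apply: ler_wpM2l => //.
  apply: (@le_trans _ _ ((2 ^+ k)^-1 * (L.+1%:R * k.+1%:R))).
    apply: ler_pM => //; first exact: ltW.
    by rewrite -natrM ler_nat; lia.
  rewrite (_ : (3 / 4) ^+ k = (3 / 2) ^+ k * (2 ^+ k)^-1 :> R); last first.
    by rewrite -exprVn -exprMn; congr (_ ^+ _); field.
  have u0 : 0 <= (2 ^+ k)^-1 :> R by rewrite invr_ge0 ltW.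
  rewrite (_ : 2 * L.+1%:R * _ = (2 ^+ k)^-1 * (L.+1%:R * (2 * (3 / 2) ^+ k))); last by ring.
  by apply: ler_wpM2l => //; apply: ler_wpM2l.
- move=> b b0; have [k1 hk1] := small (b / 3) (divr_gt0 b0 (ltr0n R 3)).
  exists k1 => k kk y /(cap_fun_supp (e0 k))[qy _]; apply: le_trans (ltW qy) _.
  by have := hk1 k kk; lra.
- by move=> k y /(cap_fun_supp (e0 k))[qy _]; exact: small_cube qy.
- by move=> k kk; apply: ha => //; exact: hk0.
Qed.

End Sequence.

Section SigmaFinite.
Context d (T : measurableType d) (R : realType) (mu : {measure set T -> \bar R}).
Hypothesis sf : sigma_finite setT mu.

(** An alias of [mu] that takes the proof of sigma-finiteness as an argument, so that the structure
    required by Fubini's theorem can be attached to it. *)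
Definition sfmeasure of sigma_finite setT mu : set T -> \bar R := mu.

HB.instance Definition _ := Measure.on (sfmeasure sf).
HB.instance Definition _ := @Measure_isSigmaFinite.Build d T R (sfmeasure sf) sf.

End SigmaFinite.

Theorem proposition3p3 (R : realType) (n : nat)
    (mu : {measure set (borel_rV R n) -> \bar R})
    (hn : (4 <= n)%N) (hmu : haar_measure mu) :
  ~ reduced_spectral_synthesis mu (@unit_sphere R n).
Proof.
case: n mu hn hmu => // n mu hn hmu.
have sf : sigma_finite [set: borel_rV R n.+1] mu.
  exists (fun k => cube k%:R).
    apply/esym; rewrite -subTset => y _; exists (Num.bound `|y|) => //=.
    by apply: ltW; exact: archi_boundP.
  move=> k; split; first exact: cube_measurable.
  by case: hmu => _ _ h _ _; apply: h; exact: cube_compact.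
have E : mu = (sfmeasure sf : {sigma_finite_measure set (borel_rV R n.+1) -> \bar R}) :> {measure set _ -> \bar R}.
  exact: eq_measure.
rewrite E in hmu *; exact: not_synthesis_sigma_finite.
Qed.
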